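(* Let $k>1$ be an integer. Let $f\in L^2(0,1)$ and let $g(x)=\int_0^x \frac{f(y)}{\sqrt{x-y}}\,dy$ ($0\leqslant x\leqslant1$) be its Abel transform. Suppose that $g\in H^k_\mu(0,1)$ and that $$\lim_{t\to0}D_t^{j}\left[g\!\left(\sin^2\tfrac t2\right)\right]=0\qquad (j=0,1,\ldots,k-1).$$ Let $f_N=\sum_{n=0}^N c_n\overline{P}_n$ with $c_n=\int_0^1 f(x)\overline{P}_n(x)\,dx$. Then, for every integer $N\geqslant1$, $$\|f-f_N\|_{L^2(0,1)}\leqslant q_5(k)\,\frac{\|g\|_{H^k_\mu(0,1)}}{N^{k-1}},$$ where $q_5(k)=q_2(k)\,q_3(k)\,q_4(k)$ with $$q_2(k)=2\pi\binom{k}{\lfloor k/2\rfloor},\qquad q_3(k)=\sqrt{\frac{3}{2(k-1)}},\qquad q_4(k)=\frac{\sqrt{2(k+1)}\,(k!)^2}{\pi}.$$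
   Context: $\overline{P}_n(x)=\sqrt{2n+1}\,P_n(2x-1)$, with $P_n$ the ordinary Legendre polynomials; $\{\overline{P}_n\}_{n\geqslant0}$ is an orthonormal basis of $L^2(0,1)$. The measure $\mu$ on $(0,1)$ is $d\mu(x)=\frac{dx}{\sqrt{x(1-x)}}$, and $L^2_\mu(0,1)$ is the space of measurable $u:(0,1)\to\mathbb{R}$ with $\|u\|_{L^2_\mu(0,1)}=\left(\int_0^1|u(x)|^2\,d\mu(x)\right)^{1/2}<\infty$. For an integer $k\geqslant0$, $H^k_\mu(0,1)$ is the space of $u\in L^2_\mu(0,1)$ whose weak derivatives $D^ju$ exist and belong to $L^2_\mu(0,1)$ for all $0\leqslant j\leqslant k$, with norm $\|u\|_{H^k_\mu(0,1)}=\sum_{j=0}^k\|D^ju\|_{L^2_\mu(0,1)}$. $D_t^j=d^j/dt^j$; in the limit conditions the derivatives of order $j\leqslant k-1$ are understood through their continuous representatives. *)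

(* Defs.v *)
From HB Require Import structures.
From mathcomp Require Import all_boot all_order all_algebra.
From mathcomp Require Import all_classical all_reals all_analysis.
Set Implicit Arguments.
Unset Strict Implicit.
Unset Printing Implicit Defensive.
Import Order.TTheory GRing.Theory Num.Theory.
Import numFieldNormedType.Exports.
Local Open Scope classical_set_scope.
Local Open Scope ring_scope.

(* Functions on (0,1) are total functions R -> R of which only the values on
   `]0, 1[ matter. *)

Notation leb R := (@lebesgue_measure R).

Notation I01 R := (`]0, 1[%classic : set R).

(* Rodrigues' formula; [derivn] is the iterated formal derivative. *)
Definition legendre (R : realType) (n : nat) : {poly R} :=
  (2 ^+ n * (n`!)%:R)^-1 *: derivn n (('X ^+ 2 - 1) ^+ n).

Definition shifted_legendre (R : realType) (n : nat) (x : R) : R :=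
  Num.sqrt (2 * n%:R + 1) * (legendre R n).[2 * x - 1].

(* [w] is the density, with respect to the Lebesgue measure on (0,1), of the
   measure of integration: L^2(0,1) is [w = 1] and L^2_mu(0,1) is
   [w = arcsine_density]. *)
Definition in_L2 (R : realType) (w u : R -> R) : Prop :=
  measurable_fun (I01 R) u /\
  (\int[leb R]_(x in I01 R) (u x ^+ 2 * w x)%:E < +oo)%E.

Definition L2_norm (R : realType) (w u : R -> R) : R :=
  Num.sqrt (\int[leb R]_(x in I01 R) (u x ^+ 2 * w x)).

Definition uniform_density (R : realType) : R -> R := fun=> 1.

Definition arcsine_density (R : realType) : R -> R :=
  fun x => (Num.sqrt (x * (1 - x)))^-1.

Definition test_function (R : realType) (phi : R -> R) : Prop :=
  (forall n x, derivable (derive1n n phi) x 1) /\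
  exists K : set R, [/\ compact K, K `<=` I01 R &
    forall x, ~ K x -> phi x = 0].

Definition weak_derivative (R : realType) (j : nat) (u v : R -> R) : Prop :=
  [/\ locally_integrable (I01 R) u, locally_integrable (I01 R) v &
    forall phi : R -> R, test_function phi ->
      \int[leb R]_(x in I01 R) (u x * derive1n j phi x) =
      (-1) ^+ j * \int[leb R]_(x in I01 R) (v x * phi x)].

(* A weak derivative of order [j] is unique up to a null set; [weakD j u] is
   one of them, and 0 if there is none. *)
Definition weakD (R : realType) (j : nat) (u : R -> R) : R -> R :=
  xget (fun=> 0) [set v | weak_derivative j u v].

Definition in_Hmu (R : realType) (k : nat) (u : R -> R) : Prop :=
  in_L2 (@arcsine_density R) u /\
  forall j : nat, (j <= k)%N ->
    (exists v, weak_derivative j u v) /\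
    in_L2 (@arcsine_density R) (weakD j u).

Definition Hmu_norm (R : realType) (k : nat) (u : R -> R) : R :=
  \sum_(j < k.+1) L2_norm (@arcsine_density R) (weakD j u).

(* [G] is a representative of [u] that is of class C^m on (0,1); such a [G] is
   unique on (0,1), and [derive1n j G] is then the continuous representative
   of the weak derivative of order [j] of [u], for [j <= m]. *)
Definition Cn_representative (R : realType) (m : nat) (u G : R -> R) : Prop :=
  [/\ {ae leb R, forall x, I01 R x -> G x = u x},
      (forall (j : nat) (x : R), (j < m)%N -> I01 R x ->
         derivable (derive1n j G) x 1) &
      (forall (j : nat) (x : R), (j <= m)%N -> I01 R x ->
         {for x, continuous (derive1n j G)})].

(* The integral is taken to be 0 at the points [x], forming a null set when [f]
   is in L^2(0,1), where it diverges. *)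
Definition abel (R : realType) (f : R -> R) (x : R) : R :=
  \int[leb R]_(y in `]0, x[) (f y / Num.sqrt (x - y)).

Definition legendre_coef (R : realType) (f : R -> R) (n : nat) : R :=
  \int[leb R]_(x in I01 R) (f x * shifted_legendre n x).

Definition legendre_sum (R : realType) (f : R -> R) (N : nat) (x : R) : R :=
  \sum_(n < N.+1) legendre_coef f n * shifted_legendre n x.

Definition q2 (R : realType) (k : nat) : R := 2 * pi * ('C(k, k./2))%:R.

Definition q3 (R : realType) (k : nat) : R :=
  Num.sqrt (3 / (2 * (k%:R - 1))).

Definition q4 (R : realType) (k : nat) : R :=
  Num.sqrt (2 * (k%:R + 1)) * (k`!)%:R ^+ 2 / pi.

Definition q5 (R : realType) (k : nat) : R := q2 R k * q3 R k * q4 R k.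

(* Main.v *)
Require Import Defs.
From HB Require Import structures.
From mathcomp Require Import all_boot all_order all_algebra.
From mathcomp Require Import all_classical all_reals all_analysis.
From mathcomp Require Import measurable_realfun ring lra zify.
Set Implicit Arguments.
Unset Strict Implicit.
Unset Printing Implicit Defensive.
Import Order.TTheory GRing.Theory Num.Theory.
Import numFieldNormedType.Exports.
Local Open Scope classical_set_scope.
Local Open Scope ring_scope.

(** Write g for the Abel transform of f.  The proof rests on an identity that
    turns the Legendre coefficients of f into sine coefficients of the function
    t |-> g (sin (t / 2) ^ 2).  Up to sign, the polynomial [sineU n] satisfies
    sin ((2 n + 1) th) = sin th * sineU n (cos th ^ 2), and its image under the
    adjoint of the Abel transform is the shifted Legendre polynomial
    ([Rintegral_sineU_akernel]): both sides are polynomials in 1 - y, and the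
    powers of 1 - x have explicit moments against the kernel.  By Fubini
    ([abel_adjoint]), with the substitution x = sin (t / 2) ^ 2 encoded by the
    function [angle 0], the inverse of that substitution,
      pi |c_n| = sqrt (2 n + 1) |int_0^1 g x sin ((n + 1/2) t) / sqrt (x (1 - x)) dx|
    ([abel_legendre_coef]).

    Decay of the coefficients then follows from k integrations by parts in t
    ([chainsum_parts]).  The derivative of order j of g (sin (t / 2) ^ 2) is a sum
    of terms chain j i t * g^(i) (sin (t / 2) ^ 2), where chain j i is a
    trigonometric polynomial of size at most j! and of the parity of j.  The
    boundary terms vanish at t = 0 by assumption ([chainsum_eq0]); at t = pi they
    vanish because cos ((n + 1/2) pi) = 0 when j is even, and because the
    coefficients chain j i are odd, hence zero at pi, when j is odd.  The
    Cauchy-Schwarz inequality bounds the last integral, whence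
      c_n ^ 2 * n ^ (2 k - 1) <= (2 / pi) (k + 1) (k!) ^ 2 (norm of g) ^ 2
    ([legendre_coef_decay]), and the tail of the sum of the c_n ^ 2 is at most the
    right-hand side over N ^ (2 k - 2).  The constant q5 leaves a lot of room
    ([q5_sqr_ge]).

    Two analytic facts underlie this.  The weak derivatives of g must be realised
    by genuine iterated antiderivatives that are continuous up to the endpoints
    ([weakd_antiderivatives]); this uses that weak derivatives are unique, hence
    the fundamental lemma of the calculus of variations for smooth bump
    functions.  And f must be the sum of its Legendre series
    ([legendre_error]): thanks to the decay just obtained, the partial sums along
    powers of 2 converge almost everywhere and dominatedly, their limit has the
    same polynomial moments as f, and an integrable function is determined by
    its moments ([moments_eq0]); Fatou's lemma gives the error bound. *)

(** * Integrable real functions *)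

Section integrals.
Context {R : realType}.
Notation mu := (@lebesgue_measure R).
Implicit Types (D : set (measurableTypeR R)) (u v U V : R -> R).

Definition L1 D u := mu.-integrable D (EFin \o u).

Lemma measurable_fun_EFin D u : measurable_fun D u ->
  measurable_fun D (fun x => (u x)%:E).
Proof. by move=> mu_; exact/measurable_EFinP. Qed.

Lemma L1_measurable D u : L1 D u -> measurable_fun D u.
Proof. by move=> /measurable_int /measurable_EFinP. Qed.

Lemma L1_le D u v : measurable D -> measurable_fun D u ->
  (forall x, D x -> `|u x| <= v x) -> L1 D v -> L1 D u.
Proof.
move=> mD mu_ uv; apply: le_integrable => //; first exact/measurable_EFinP.
by move=> x Dx /=; rewrite lee_fin (le_trans (uv x Dx)) ?ler_norm.
Qed.

Lemma L1_eq D u v : measurable D -> (forall x, D x -> u x = v x) -> L1 D u -> L1 D v.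
Proof.
move=> mD uv; apply: eq_integrable => // x; rewrite inE => Dx /=.
by rewrite uv.
Qed.

Lemma L1D D u v : measurable D -> L1 D u -> L1 D v -> L1 D (fun x => u x + v x).
Proof. by move=> mD Lu Lv; exact (@integrableD _ _ _ mu D mD (EFin \o u) (EFin \o v) Lu Lv). Qed.

Lemma L1Z D c u : measurable D -> L1 D u -> L1 D (fun x => c * u x).
Proof. by move=> mD Lu; exact (@integrableZl _ _ _ mu D mD c (EFin \o u) Lu). Qed.

Lemma L1B D u v : measurable D -> L1 D u -> L1 D v -> L1 D (fun x => u x - v x).
Proof. by move=> mD Lu Lv; exact (@integrableB _ _ _ mu D mD (EFin \o u) (EFin \o v) Lu Lv). Qed.

Lemma L1_sum D I (s : seq I) (P : pred I) (h : I -> R -> R) : measurable D ->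
  (forall i, P i -> L1 D (h i)) -> L1 D (fun x => \sum_(i <- s | P i) h i x).
Proof.
move=> mD Lh; have := @integrable_sum _ _ _ mu D mD I s P (fun i => EFin \o h i) Lh.
by apply: eq_integrable => // x _ /=; rewrite sumEFin.
Qed.

Lemma L1_norm D u : L1 D u -> L1 D (fun x => `|u x|).
Proof. exact: integrable_norm. Qed.

Lemma L1S D E u : measurable D -> measurable E -> E `<=` D -> L1 D u -> L1 E u.
Proof. by move=> mD mE ED; exact: integrableS. Qed.

Lemma L1_bounded_mul D u v (M : R) : measurable D -> measurable_fun D v ->
  (forall x, D x -> `|v x| <= M) -> L1 D u -> L1 D (fun x => u x * v x).
Proof.
move=> mD mv vM Lu.
apply: (@L1_le _ _ (fun x => M * `|u x|)) => //.
- by apply: measurable_funM => //; exact: L1_measurable.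
- by move=> x Dx; rewrite normrM mulrC ler_wpM2r ?vM.
- by apply: L1Z => //; exact: L1_norm.
Qed.

Lemma L1_cst (a b : R) (b0 b1 : bool) (c : R) :
  L1 [set` Interval (BSide b0 a) (BSide b1 b)] (fun=> c).
Proof.
apply: measurable_bounded_integrable => //=.
  by rewrite lebesgue_measure_itv/=; case: ifP => // _; rewrite -EFinB ltry.
exists `|c|; split; first by rewrite num_real.
by move=> M cM x _ /=; exact: ltW.
Qed.

Lemma Rintegral_sum D I (s : seq I) (P : pred I) (h : I -> R -> R) : measurable D ->
  (forall i, P i -> L1 D (h i)) ->
  \int[mu]_(x in D) (\sum_(i <- s | P i) h i x) =
  \sum_(i <- s | P i) \int[mu]_(x in D) h i x.
Proof.
move=> mD Lh; elim: s => [|i s IH].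
  rewrite big_nil; under eq_Rintegral do rewrite big_nil.
  by rewrite Rintegral_cst// mul0r.
rewrite big_cons; under eq_Rintegral do rewrite big_cons.
case: ifP => Pi; last exact: IH.
by rewrite RintegralD ?IH//; [exact: Lh|exact: L1_sum].
Qed.

Lemma ae_eq_Rintegral D u v : measurable D -> measurable_fun D u ->
  measurable_fun D v -> {ae mu, forall x, D x -> u x = v x} ->
  \int[mu]_(x in D) u x = \int[mu]_(x in D) v x.
Proof.
move=> mD mu_ mv uv; rewrite /Rintegral; congr fine.
apply: ae_eq_integral => //; try exact/measurable_EFinP.
by apply: filterS uv => x uv Dx; rewrite uv.
Qed.

Lemma EFin_Rintegral D u : measurable D -> L1 D u ->
  (\int[mu]_(x in D) u x)%:E = (\int[mu]_(x in D) (u x)%:E)%E.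
Proof. by move=> mD Lu; rewrite /Rintegral fineK//; exact: integrable_fin_num. Qed.

(** Fubini's theorem on the square D x D, with integrability reduced to an
    integrable bound M on the inner integrals of the absolute value. *)
Lemma Rintegral_swap (F : R * R -> R) (D : set (measurableTypeR R)) (M : R -> R) : measurable D ->
  measurable_fun setT F -> (forall x y, ~ (D x /\ D y) -> F (x, y) = 0) ->
  (forall y, D y -> (\int[mu]_(x in D) `|(F (x, y))%:E| <= (M y)%:E)%E) ->
  L1 D M ->
  \int[mu]_(x in D) \int[mu]_(y in D) F (x, y) =
  \int[mu]_(y in D) \int[mu]_(x in D) F (x, y).
Proof.
move=> mD mF F0 FM LM.
have mf : measurable_fun setT (EFin \o F) by exact/measurable_EFinP.
have Fx x y : ~ D x -> F (x, y) = 0 by move=> Dx; apply: F0 => -[].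
have Fy x y : ~ D y -> F (x, y) = 0 by move=> Dx; apply: F0 => -[].
have toT (h : R -> \bar R) : (forall x, ~ D x -> h x = 0%E) ->
   (\int[mu]_(x in D) h x = \int[mu]_x h x)%E.
  move=> h0; rewrite integral_mkcond; apply: eq_integral => x _.
  rewrite patchE; case: ifPn => //; rewrite notin_setE => Dx.
  by rewrite h0.
have iF : (mu \x mu)%E.-integrable setT (EFin \o F).
  apply/(integrable21ltyP mu mu mf).
  rewrite -toT; last first.
    move=> y Dy; rewrite (eq_integral (cst 0%E)) ?integral0// => x _ /=.
    by rewrite Fy// normr0.
  have /integrableP[mM LMoo] := LM.
  apply: le_lt_trans LMoo; apply: ge0_le_integral => //.
  - move=> y Dy; exact: integral_ge0.
  - apply: measurable_funTS.
    have := measurable_fun_fubini_tonelli_G (m1 := mu) (abse \o (EFin \o F)).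
    by apply => //=; exact: measurableT_comp.
  - by apply: measurableT_comp => //.
  - move=> y Dy; rewrite -toT; last by move=> x Dx /=; rewrite Fx// normr0.
    by rewrite (le_trans (FM y Dy))//= lee_fin ler_norm.
rewrite /Rintegral; congr fine.
have E1 : (\int[mu]_(x in D) (fine (\int[mu]_(y in D) (F (x, y))%:E))%:E =
           \int[mu]_x \int[mu]_y (EFin \o F) (x, y))%E.
  rewrite toT; last first.
    move=> x Dx; rewrite (eq_integral (cst 0%E)) ?integral0//= => y _ /=.
    by rewrite Fx.
  under eq_integral.
    move=> x _; rewrite toT; last by move=> y Dy; rewrite Fy.
    over.
  apply: ae_eq_integral => //.
  - apply/measurable_EFinP; apply: measurableT_comp => //.
    exact: (measurable_fubini_F iF).
  - exact: (measurable_fubini_F iF).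
  - have := ae_integrable1 iF; apply: filterS => x ix _.
    by rewrite fineK//; exact: integrable_fin_num.
have E2 : (\int[mu]_(y in D) (fine (\int[mu]_(x in D) (F (x, y))%:E))%:E =
           \int[mu]_y \int[mu]_x (EFin \o F) (x, y))%E.
  rewrite toT; last first.
    move=> x Dx; rewrite (eq_integral (cst 0%E)) ?integral0//= => y _ /=.
    by rewrite Fy.
  under eq_integral.
    move=> x _; rewrite toT; last by move=> y Dy; rewrite Fx.
    over.
  apply: ae_eq_integral => //.
  - apply/measurable_EFinP; apply: measurableT_comp => //.
    exact: (measurable_fubini_G iF).
  - exact: (measurable_fubini_G iF).
  - have := ae_integrable2 iF; apply: filterS => x ix _.
    by rewrite fineK//; exact: integrable_fin_num.
by rewrite E1 E2; exact: Fubini.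
Qed.

Lemma is_deriveW (F : R -> R) (x d1 d2 : R) : is_derive x 1 F d1 -> d1 = d2 ->
  is_derive x 1 F d2.
Proof. by move=> H <-. Qed.

End integrals.

(** * The fundamental theorem of calculus on open intervals *)

Section FTC.
Context {R : realType}.
Notation mu := (@lebesgue_measure R).
Implicit Types (u v U V F f : R -> R) (a b x : R).

Lemma L1_itv a b (b0 b1 : bool) u : L1 `]a, b[ u ->
  L1 [set` Interval (BSide b0 a) (BSide b1 b)] u.
Proof.
move=> Lu; have mu1 : measurable_fun `[a, b] u.
  by have := L1_measurable Lu; exact: measurable_fun_itv_cc.
apply: (@L1S _ `[a, b]%classic) => //.
  by move=> x /=; case: b0; case: b1; rewrite !in_itv/= => /andP[h1 h2];
    rewrite ?h1 ?h2 ?(ltW h1) ?(ltW h2).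
apply/integrableP; split; first exact/measurable_EFinP.
rewrite integral_itv_bndoo.
  by case/integrableP : Lu.
do 2 apply: measurableT_comp => //; exact: L1_measurable.
Qed.

Lemma Rintegral_itv_oo a b (b0 b1 : bool) u : L1 `]a, b[ u ->
  \int[mu]_(x in [set` Interval (BSide b0 a) (BSide b1 b)]) u x =
  \int[mu]_(x in `]a, b[) u x.
Proof.
move=> Lu; rewrite /Rintegral; congr fine; apply: integral_itv_bndoo.
by apply/measurable_EFinP; exact: L1_measurable.
Qed.

Lemma L1_sub_oo a b x y u : a <= x -> y <= b -> L1 `]a, b[ u -> L1 `]x, y[ u.
Proof.
move=> ax xb; apply: L1S => // z /=; rewrite !in_itv/= => /andP[az zx].
by rewrite (le_lt_trans ax az) (lt_le_trans zx xb).
Qed.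

Lemma Rintegral_oo_split a b x u : L1 `]a, b[ u -> a <= x -> x <= b ->
  \int[mu]_(t in `]a, b[) u t =
  \int[mu]_(t in `]a, x[) u t + \int[mu]_(t in `]x, b[) u t.
Proof.
move=> Lu ax xb.
have := @Rintegral_itvB R u (BRight a) (BLeft b) x Lu.
have [<-|xb'] := eqVneq x b.
  rewrite [X in _ = _ + X](_ : _ = 0) ?addr0//.
  by rewrite set_itv_ge ?Rintegral_set0// bnd_simp ltxx.
move=> /(_ _ _) <-; last 2 first.
- by rewrite bnd_simp.
- by rewrite bnd_simp lt_neqAle xb' xb.
rewrite -(@Rintegral_itv_oo a x false false) ?subrKC//.
exact: L1_sub_oo Lu.
Qed.

Lemma continuous_primitive a b u : a < b -> L1 `]a, b[ u ->
  {within `[a, b], continuous (fun x => \int[mu]_(t in `]a, x[) u t)}.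
Proof.
move=> ab Lu; have Lu' := L1_itv true false Lu.
have := parameterized_integral_continuous (ltW ab) Lu'.
apply: subspace_eq_continuous => x /[1!inE] /=; rewrite in_itv/= => /andP[ax xb].
rewrite /from_subspace /parameterized_integral Rintegral_itv_oo//.
  exact: L1_sub_oo Lu.
Qed.

(** The derivative f is continuous inside the interval but may blow up at the
    endpoints, as the arcsine density does; the mean value theorem applied to F
    minus the indefinite integral of f shows that this difference is constant. *)
Lemma FTC_oo F f a b : {within `[a, b], continuous F} ->
  (forall x, a < x < b -> is_derive x 1 F (f x)) ->
  (forall x, a < x < b -> {for x, continuous f}) ->
  L1 `]a, b[ f ->
  forall x, a <= x -> x <= b -> \int[mu]_(t in `]a, x[) f t = F x - F a.
Proof.
move=> cF dF cf Lf x; rewrite le_eqVlt => /predU1P[<- _|ax xb].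
  by rewrite set_itv_ge ?Rintegral_set0 ?subrr// bnd_simp ltxx.
have ab := lt_le_trans ax xb.
have Lf' := L1_itv true false Lf.
pose P y := \int[mu]_(t in `[a, y]) f t.
have cP : {within `[a, b], continuous P}.
  exact: (parameterized_integral_continuous (ltW ab) Lf').
have dP y : a < y < b -> is_derive y 1 P (f y).
  move=> /andP[ay yb].
  have [] := @continuous_FTC1_closed R f a y b yb Lf' ay.
    by apply: cf; rewrite ay yb.
  by move=> dPy Py; apply: DeriveDef => //; rewrite -derive1E Py.
have sub : `[a, x] `<=` `[a, b].
  by move=> z /=; rewrite !in_itv/= => /andP[-> /le_trans ->].
have [y||c _] := @MVT R (F \- P) (fun=> 0) a x ax.
- rewrite in_itv/= => /andP[ay yx].
  rewrite -(subrr (f y)); apply: is_deriveB; [apply: dF|apply: dP];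
    by rewrite ay (lt_le_trans yx xb).
- apply: continuous_subspaceW sub _ => z; apply: continuousB; [exact: cF|exact: cP].
rewrite mul0r /= {2}/P set_itv1 Rintegral_set1 subr0 => /eqP.
rewrite /P Rintegral_itv_oo; last exact: L1_sub_oo Lf.
by move=> /eqP; lra.
Qed.

(** A nonnegative derivative is integrable: its integrals over intervals whose
    closure lies inside are increments of F, hence bounded by F b - F a. *)
Lemma FTC_oo_ge0 F f a b : a < b -> {within `[a, b], continuous F} ->
  (forall x, a < x < b -> is_derive x 1 F (f x)) ->
  (forall x, a < x < b -> {for x, continuous f}) ->
  (forall x, a < x < b -> 0 <= f x) ->
  L1 `]a, b[ f.
Proof.
move=> ab cF dF cf f0.
have cf' : {in `]a, b[, continuous f} by move=> x; rewrite in_itv/=; exact: cf.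
have mf : measurable_fun `]a, b[ f.
  apply: open_continuous_measurable_fun => // x /[1!inE]/=.
  by rewrite in_itv; exact: cf.
have Fmono x y : a <= x -> x <= y -> y <= b -> F x <= F y.
  move=> ax xy yb; rewrite -subr_ge0.
  move: xy; rewrite le_eqVlt => /predU1P[->|xy]; first by rewrite subrr.
  have [z||z zxy ->] := @MVT R F f x y xy.
  - rewrite in_itv/= => /andP[xz zy]; apply: dF.
    by rewrite (le_lt_trans ax xz) (lt_le_trans zy yb).
  - apply: continuous_subspaceW cF => z /=; rewrite !in_itv/= => /andP[xz zy].
    by rewrite (le_trans ax xz) (le_trans zy yb).
  move: zxy; rewrite in_itv/= => /andP[xz zy].
  apply: mulr_ge0; last by rewrite subr_ge0 ltW.
  apply: f0; by rewrite (le_lt_trans ax xz) (lt_le_trans zy yb).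
(* [e] is a sequence decreasing to 0 along which the interval is shrunk. *)
have [e [e0 e2 nie e_small]] : exists e : nat -> R,
    [/\ (forall n, 0 < e n), (forall n, e n + e n <= b - a),
     (forall m n, (m <= n)%N -> e n <= e m) &
     forall d, 0 < d -> exists n, e n < d].
  have nie m n : (m <= n)%N -> (b - a) / n.+2%:R <= (b - a) / m.+2%:R.
    by move=> mn; rewrite ler_wpM2l ?subr_ge0 ?(ltW ab)// lef_pV2 ?posrE// ler_nat.
  exists (fun n => (b - a) / n.+2%:R); split => //.
  - by move=> n; rewrite divr_gt0 ?subr_gt0.
  - move=> n /=; move: (nie 0%N n isT).
    by move: (_ / n.+2%:R) => y; lra.
  - move=> d d0; exists (Num.truncn ((b - a) / d)).
    rewrite ltr_pdivrMr// mulrC -ltr_pdivrMr//.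
    by apply: lt_le_trans (truncnS_gt _) _; rewrite ler_nat.
pose c n := a + e n; pose d n := b - e n.
have cd n : c n <= d n by have := e2 n; rewrite /c /d; lra.
pose A n : set R := `]c n, d n[%classic.
have nA : nondecreasing_seq A.
  move=> m n mn; rewrite subsetEset => x; rewrite /A /= !in_itv/=.
  have := nie _ _ mn.
  by rewrite /c /d => h /andP[h1 h2]; lra.
have Aab n : A n `<=` `]a, b[.
  move=> x; rewrite /A /= !in_itv/= /c /d => /andP[h1 h2].
  by have := e0 n; lra.
have bA : \bigcup_n A n = `]a, b[%classic.
  apply/seteqP; split => x; first by move=> [n _]; exact: Aab.
  rewrite /= in_itv/= => /andP[ax xb].
  have [|n] := e_small (Num.min (x - a) (b - x)).
    by rewrite lt_min !subr_gt0 ax xb.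
  rewrite lt_min => /andP[h1 h2]; exists n => //.
  by rewrite /A /= in_itv/= /c /d; lra.
apply/integrableP; split; first exact/measurable_EFinP.
have -> : (\int[mu]_(x in `]a, b[) `|(EFin \o f) x| = \int[mu]_(x in `]a, b[) (f x)%:E)%E.
  apply: eq_integral => x /[1!inE]/=; rewrite in_itv/= => xab.
  by rewrite ger0_norm// f0.
have LA n : L1 (A n) f.
  apply: (@L1S _ `[c n, d n]%classic) => //; first exact: measurable_itv.
    by move=> x; rewrite /A /= !in_itv/= => /andP[/ltW -> /ltW ->].
  apply: continuous_compact_integrable; first exact: segment_compact.
  apply: continuous_in_subspaceT => x /[1!inE]/=; rewrite in_itv/= => /andP[h1 h2].
  by apply: cf; move: h1 h2; have := e0 n; rewrite /c /d; lra.
have IA n : (\int[mu]_(x in A n) (f x)%:E <= (F b - F a)%:E)%E.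
  rewrite -EFin_Rintegral; [|exact: measurable_itv|exact: LA].
  have h : forall x, c n < x < d n -> a < x < b.
    by move=> x; have := e0 n; rewrite /c /d; lra.
  have -> : \int[mu]_(x in A n) f x = F (d n) - F (c n).
    apply: (@FTC_oo F f (c n) (d n)) => //.
    - apply: continuous_subspaceW cF => x /=; rewrite !in_itv/=.
      by have := e0 n; rewrite /c /d; lra.
    - by move=> x /h; exact: dF.
    - by move=> x /h; exact: cf.
    - exact: LA.
  by rewrite lee_fin lerB//; apply: Fmono => //; have := e0 n; have := cd n;
    rewrite /c /d; lra.
have cvgA := @ge0_nondecreasing_set_cvg_integral _ (measurableTypeR R) R A (EFin \o f) mu nA.
rewrite -bA.
have {}cvgA : (\int[mu]_(x in A i) (f x)%:E @[i --> \oo] -->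
    \int[mu]_(x in \bigcup_n A n) (f x)%:E)%E.
  apply: cvgA.
  - by move=> i; exact: measurable_itv.
  - by move=> i; apply/measurable_EFinP; exact: L1_measurable (LA i).
  - by move=> i x /Aab /=; rewrite in_itv/= => h; rewrite lee_fin f0.
apply: (@le_lt_trans _ _ (F b - F a)%:E); last exact: ltry.
rewrite -(cvg_lim _ cvgA)//; apply: lime_le; first exact: cvgP cvgA.
by near=> n; exact: IA.
Unshelve. all: by end_near. Qed.

End FTC.

(** * Absolutely continuous functions on the unit interval *)

Section abs_cont.
Context {R : realType}.
Notation mu := (@lebesgue_measure R).
Implicit Types (u v U V F f : R -> R) (a b x : R).

(** The interval is open, and empty for [x <= 0], so that [primitive u 0 = 0]. *)
Definition primitive u x := \int[mu]_(t in `]0, x[) u t.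

(** [U] is absolutely continuous on the closed unit interval, with almost
    everywhere derivative [u].  The derivative is part of the data because it is
    only defined up to a null set. *)
Definition abs_cont U u :=
  L1 `]0, 1[ u /\ forall x, 0 <= x <= 1 -> U x = U 0 + primitive u x.

Lemma primitive0 u : primitive u 0 = 0.
Proof. by rewrite /primitive set_itv_ge ?Rintegral_set0// bnd_simp ltxx. Qed.

Lemma abs_cont_primitive c u : L1 `]0, 1[ u ->
  abs_cont (fun x => c + primitive u x) u.
Proof. by move=> Lu; split => // x _; rewrite primitive0 addr0. Qed.

Lemma abs_cont_continuous U u : abs_cont U u -> {within `[0, 1], continuous U}.
Proof.
move=> [Lu Uu]; have := continuous_primitive (@ltr01 R) Lu.
move=> cP.
have : {within `[0, 1], continuous (fun x => U 0 + primitive u x)}.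
  by move=> x; apply: continuousD; [exact: cst_continuous|exact: cP].
apply: subspace_eq_continuous => x /[1!inE]/=; rewrite in_itv/= => x01.
by rewrite /from_subspace -Uu.
Qed.

Lemma within_continuous_bounded U : {within `[0, 1], continuous U} ->
  exists M, forall x, 0 <= x <= 1 -> `|U x| <= M.
Proof.
move=> cU.
have cnU : {within `[0, 1], continuous (fun x => `|U x|)}.
  by move=> x; apply: continuous_comp; [exact: cU|exact: norm_continuous].
have [c _ Mc] := EVT_max (@ler01 R) cnU.
by exists `|U c| => x x01; apply: Mc; rewrite in_itv/=.
Qed.

Lemma within_continuous_measurable U : {within `[0, 1], continuous U} ->
  measurable_fun (I01 R) U.
Proof.
move=> cU; have : measurable_fun (`[0, 1]%classic : set R) U.
  exact: subspace_continuous_measurable_fun.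
by apply: measurable_funS => //; exact: subset_itv_oo_cc.
Qed.

Lemma L1_within_continuous U : {within `[0, 1], continuous U} -> L1 `]0, 1[ U.
Proof.
move=> cU; have [M UM] := within_continuous_bounded cU.
apply: (@L1_le _ _ _ (fun=> M)) => //.
- exact: within_continuous_measurable.
- by move=> x /=; rewrite in_itv/= => /andP[x0 x1]; apply: UM; rewrite !ltW.
- exact: L1_cst.
Qed.

Lemma L1_mul_continuous u V : L1 `]0, 1[ u -> {within `[0, 1], continuous V} ->
  L1 `]0, 1[ (fun x => u x * V x).
Proof.
move=> Lu cV; have [M VM] := within_continuous_bounded cV.
apply: (L1_bounded_mul (M := M)) => //.
- exact: within_continuous_measurable.
- by move=> x /=; rewrite in_itv/= => /andP[x0 x1]; apply: VM; rewrite !ltW.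
Qed.

Lemma abs_cont_cst c : abs_cont (fun=> c) (fun=> 0).
Proof.
split; first exact: L1_cst.
by move=> x _; rewrite /primitive Rintegral_cst// mul0r addr0.
Qed.

Lemma L1_itv0x x u : x <= 1 -> L1 `]0, 1[ u -> L1 `]0, x[ u.
Proof. by move=> x1; exact: L1_sub_oo. Qed.

Lemma abs_contD U u V v : abs_cont U u -> abs_cont V v ->
  abs_cont (fun x => U x + V x) (fun x => u x + v x).
Proof.
move=> [Lu Uu] [Lv Vv]; split; first exact: L1D.
move=> x x01; rewrite Uu// Vv// /primitive RintegralD//; first by ring.
- by apply: L1_itv0x Lu; case/andP: x01.
- by apply: L1_itv0x Lv; case/andP: x01.
Qed.

Lemma abs_cont_sum (I : eqType) (s : seq I) (U u : I -> R -> R) :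
  (forall i, i \in s -> abs_cont (U i) (u i)) ->
  abs_cont (fun x => \sum_(i <- s) U i x) (fun x => \sum_(i <- s) u i x).
Proof.
elim: s => [|i s IH] Us.
  have -> : (fun x => \sum_(i <- [::]) U i x) = cst 0.
    by apply/funext => x; rewrite big_nil.
  have -> : (fun x => \sum_(i <- [::]) u i x) = cst 0.
    by apply/funext => x; rewrite big_nil.
  exact: abs_cont_cst.
have -> : (fun x => \sum_(j <- i :: s) U j x) =
          (fun x => U i x + \sum_(j <- s) U j x).
  by apply/funext => x; rewrite big_cons.
have -> : (fun x => \sum_(j <- i :: s) u j x) =
          (fun x => u i x + \sum_(j <- s) u j x).
  by apply/funext => x; rewrite big_cons.
apply: abs_contD; first by apply: Us; rewrite mem_head.
by apply: IH => j js; apply: Us; rewrite in_cons js orbT.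
Qed.

(** The two integrals on the left are those of u s * v t over the two triangles
    into which the diagonal cuts the square of side x.  This is integration by
    parts for absolutely continuous functions. *)
Lemma primitive_mul u v x : 0 <= x <= 1 -> L1 `]0, 1[ u -> L1 `]0, 1[ v ->
  \int[mu]_(s in `]0, x[) (u s * primitive v s) +
  \int[mu]_(t in `]0, x[) (v t * primitive u t) = primitive u x * primitive v x.
Proof.
move=> /andP[x0 x1] Lu Lv.
set D := (`]0, x[%classic : set R).
have mD : measurable D by exact: measurable_itv.
have Lu' := L1_itv0x x1 Lu; have Lv' := L1_itv0x x1 Lv.
have LuP w z : L1 `]0, 1[ w -> L1 `]0, 1[ z -> L1 D (fun s => w s * primitive z s).
  move=> Lw Lz; apply: (@L1_sub_oo _ 0 1) => //.
  by apply: L1_mul_continuous => //; exact: continuous_primitive.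
(* The integrand on the triangle s < t, extended by 0 to the plane. *)
pose F (p : R * R) := (u \_ D) p.1 * (v \_ D) p.2 * \1_[set p : R * R | p.1 < p.2] p.
have uD s : D s -> (u \_ D) s = u s by move=> Ds; rewrite patchE mem_set.
have uD0 s : ~ D s -> (u \_ D) s = 0 by move=> Ds; rewrite patchE memNset.
have vD s : D s -> (v \_ D) s = v s by move=> Ds; rewrite patchE mem_set.
have vD0 s : ~ D s -> (v \_ D) s = 0 by move=> Ds; rewrite patchE memNset.
have mt : measurable [set p : R * R | p.1 < p.2].
  have := @measurable_fun_ltr _ _ R setT (fst : R * R -> R) snd.
  move=> /(_ measurable_fst measurable_snd measurableT [set true]).
  by rewrite setTI; apply.
have F1 s : D s -> \int[mu]_(t in D) F (s, t) =
    u s * (primitive v x - primitive v s).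
  move=> Ds.
  have -> : \int[mu]_(t in D) F (s, t) = \int[mu]_(t in D `&` `]s, x[) (u s * v t).
    rewrite Rintegral_mkcondr; apply: eq_Rintegral => t /[1!inE] Dt.
    rewrite /F/= uD// vD// patchE indicE /=.
    move: Dt; rewrite /D /= in_itv/= => /andP[t0 tx].
    have [st|st] := ltP s t.
      by rewrite mem_set//= ?mem_set ?mulr1//= in_itv/= st tx.
    by rewrite memNset/= ?mulr0 ?memNset//= ?in_itv/= ltNge st.
  have sx : `]s, x[ `<=` D.
    move=> t; rewrite /D /= !in_itv/= => /andP[st ->].
    by move: Ds; rewrite /D /= in_itv/= => /andP[s0 _]; rewrite (lt_trans s0 st).
  rewrite setIidr// RintegralZl//; last exact: L1S Lv'.
  congr (_ * _); move: Ds; rewrite /D /= in_itv/= => /andP[s0 sx'].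
  by rewrite /primitive (Rintegral_oo_split Lv' (ltW s0) (ltW sx')); ring.
have F2 t : D t -> \int[mu]_(s in D) F (s, t) = v t * primitive u t.
  move=> Dt.
  have -> : \int[mu]_(s in D) F (s, t) = \int[mu]_(s in D `&` `]0, t[) (v t * u s).
    rewrite Rintegral_mkcondr; apply: eq_Rintegral => s /[1!inE] Ds.
    rewrite /F/= uD// vD// patchE indicE /= mulrC.
    move: Ds; rewrite /D /= in_itv/= => /andP[s0 sx].
    have [st|st] := ltP s t.
      by rewrite mem_set//= ?mem_set ?mul1r 1?mulrC//= in_itv/= st s0.
    by rewrite memNset/= ?mul0r ?memNset//= ?in_itv/= ?s0/= ltNge st.
  have sx : `]0, t[ `<=` D.
    move=> s; rewrite /D /= !in_itv/= => /andP[-> st].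
    by move: Dt; rewrite /D /= in_itv/= => /andP[_ tx]; rewrite (lt_trans st tx).
  by rewrite setIidr// RintegralZl//; exact: L1S Lu'.
have mF : measurable_fun setT F.
  apply: measurable_funM; last by exact: measurable_indic.
  apply: measurable_funM.
    apply: measurableT_comp => //.
    by apply/(measurable_restrictT _ mD); exact: L1_measurable.
  apply: measurableT_comp => //.
  by apply/(measurable_restrictT _ mD); exact: L1_measurable.
have E : \int[mu]_(s in D) \int[mu]_(t in D) F (s, t) =
    \int[mu]_(t in D) \int[mu]_(s in D) F (s, t).
  apply: (@Rintegral_swap R F D (fun t => `|v t| * \int[mu]_(s in D) `|u s|) mD mF).
  - move=> s t Dst; rewrite /F/=; have [Ds|Ds] := pselect (D s); last first.
      by rewrite uD0// !mul0r.
    by rewrite vD0 ?mulr0 ?mul0r// => Dt; exact: Dst.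
  - move=> t Dt; rewrite EFinM EFin_Rintegral//; last exact: L1_norm.
    rewrite -ge0_integralZl//; last first.
      by apply: measurable_fun_EFin; apply: measurableT_comp => //; exact: L1_measurable.
    apply: ge0_le_integral => //.
    + apply: measurable_funTS; apply: measurableT_comp => //.
      apply: measurable_fun_EFin.
      exact: measurable_fun_pair1.
    + apply: measurable_funeM; apply: measurable_fun_EFin; apply: measurableT_comp => //.
      exact: L1_measurable.
    + move=> s Ds; rewrite -EFinM lee_fin /F/= uD// vD// indicE !normrM.
      rewrite [leRHS]mulrC ler_piMr ?mulr_ge0//.
      by case: (_ \in _); rewrite ?normr0 ?normr1.
  - by under eq_fun do rewrite mulrC; apply: L1Z => //; exact: L1_norm.
have <- : \int[mu]_(s in D) (primitive v x * u s) = primitive u x * primitive v x.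
  by rewrite RintegralZl// mulrC.
have <- : \int[mu]_(y in D) \int[mu]_(x in D) F (x, y) =
          \int[mu]_(t in D) (v t * primitive u t).
  by apply: eq_Rintegral => t /[1!inE]; exact: F2.
rewrite -E -RintegralD//; last 2 first.
- exact: LuP.
- have := L1B mD (L1Z (primitive v x) mD Lu') (LuP u v Lu Lv).
  by apply: L1_eq => // s Ds; rewrite F1//=; ring.
apply: eq_Rintegral => s /[1!inE] Ds.
by rewrite F1//; ring.
Qed.

Lemma abs_contM U u V v : abs_cont U u -> abs_cont V v ->
  abs_cont (fun x => U x * V x) (fun x => u x * V x + v x * U x).
Proof.
move=> Uu Vv; have cU := abs_cont_continuous Uu; have cV := abs_cont_continuous Vv.
move: (Uu) (Vv) => [Lu Ux] [Lv Vx].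
split; first by apply: L1D => //; exact: L1_mul_continuous.
move=> x x01; have /andP[x0 x1] := x01.
rewrite Ux// Vx//.
have LuP w z : L1 `]0, 1[ w -> L1 `]0, 1[ z -> L1 `]0, x[ (fun s => w s * primitive z s).
  move=> Lw Lz; apply: (@L1_sub_oo _ 0 1) => //.
  by apply: L1_mul_continuous => //; exact: continuous_primitive.
have Lu' := L1_itv0x x1 Lu; have Lv' := L1_itv0x x1 Lv.
have -> : primitive (fun x => u x * V x + v x * U x) x =
  \int[mu]_(s in `]0, x[) ((V 0 * u s + U 0 * v s) +
    (u s * primitive v s + v s * primitive u s)).
  apply: eq_Rintegral => s /[1!inE]/=; rewrite in_itv/= => /andP[s0 sx].
  by rewrite (Ux s) ?(Vx s) ?(ltW s0) ?(le_trans (ltW sx) x1)//; ring.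
rewrite !RintegralD//; try (apply: L1D => //); try (exact: L1Z); try exact: LuP.
rewrite primitive_mul// !RintegralZl// -!/(primitive _ _); ring.
Qed.

Lemma abs_cont_Rintegral U u : abs_cont U u ->
  \int[mu]_(x in `]0, 1[) u x = U 1 - U 0.
Proof. by move=> [Lu ->]; [rewrite addrC addKr|rewrite ler01 lexx]. Qed.

End abs_cont.

(** * The arcsine kernel and its moments *)

Section kernel.
Context {R : realType}.
Notation mu := (@lebesgue_measure R).
Implicit Types (x y : R).

(** [angle y] is the inverse of t |-> y + (1 - y) * sin (t / 2) ^ 2, which maps
    the interval from 0 to pi onto the interval from y to 1; its derivative is
    [akernel y].  Integrals against [akernel y] are thus integrals in the angle t,
    without any change of variables. *)
Definition angle y x : R := acos (1 - 2 * ((x - y) / (1 - y))).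

Lemma cos_angle x : 0 <= x <= 1 -> cos (angle 0 x) = 1 - 2 * x.
Proof. by move=> x01; rewrite /angle !subr0 divr1 acosK// in_itv/=; lra. Qed.

Lemma angle_itv x : 0 <= x <= 1 -> 0 <= angle 0 x <= pi.
Proof.
move=> x01; rewrite /angle !subr0 divr1.
by apply/andP; split; [apply: acos_ge0|apply: acos_lepi]; lra.
Qed.

Lemma angle0 y : angle y y = 0.
Proof. by rewrite /angle subrr mul0r mulr0 subr0 acos1. Qed.

Lemma angle1 y : y < 1 -> angle y 1 = pi.
Proof.
move=> y1; rewrite /angle divff ?mulr1; last lra.
by rewrite (_ : 1 - 2 = -1) ?acosN1//; lra.
Qed.

Lemma angle_continuous y : y < 1 -> {within `[y, 1], continuous (angle y)}.
Proof.
move=> y1; pose g t := y + (1 - y) / 2 * (1 - cos t) : R.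
have cg : {within `[0, pi], continuous g}.
  apply: continuous_subspaceT => x; apply: cvgD; first exact: cvg_cst.
  apply: cvgM; first exact: cvg_cst.
  by apply: cvgB; [exact: cvg_cst|exact: continuous_cos].
have gK : {in `[0, pi], cancel g (angle y)}.
  move=> t t0; rewrite /angle /g.
  rewrite (_ : 1 - _ = cos t) ?cosK//; field; lra.
have := segment_can_le_continuous (pi_ge0 R) cg gK.
by rewrite /g cospi cos0 subrr mulr0 addr0 (_ : y + _ = 1)//; lra.
Qed.

(** For y = 0 this is the arcsine density; for general y it is the kernel of the
    adjoint of the Abel transform, divided by the square root of 1 - x. *)
Definition akernel y x : R := (Num.sqrt ((1 - x) * (x - y)))^-1.

Lemma akernel_ge0 y x : 0 <= akernel y x.
Proof. by rewrite /akernel invr_ge0 sqrtr_ge0. Qed.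

Lemma is_derive_angle y x : y < x < 1 -> is_derive x 1 (angle y) (akernel y x).
Proof.
move=> yx1.
have y1 : 1 - y != 0 by lra.
pose h z : R := 1 - 2 * ((z - y) / (1 - y)).
have dh : is_derive x 1 h (- (2 / (1 - y))).
  have -> : h = (fun z => (1 + 2 / (1 - y) * y) - (2 / (1 - y)) * z).
    by apply/funext => z; rewrite /h; field.
  by apply: is_derive_eq; rewrite /GRing.scale/=; ring.
have hx : -1 < h x < 1.
  have -> : h x = 1 - 2 * ((x - y) / (1 - y)) by [].
  have : 0 < (x - y) / (1 - y) < 1.
    by rewrite divr_gt0 ?ltr_pdivrMr; lra.
  lra.
have da := is_derive1_acos hx.
apply: is_deriveW (is_derive1_comp da dh) _.
have -> : 1 - h x ^+ 2 = (2 / (1 - y)) ^+ 2 * ((1 - x) * (x - y)).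
  by rewrite /h; field.
rewrite sqrtrM ?exprn_even_ge0// sqrtr_sqr ger0_norm ?divr_ge0; [|lra..].
rewrite /akernel invfM; field.
by rewrite y1 sqrtr_eq0 -ltNge mulr_gt0; lra.
Qed.

Lemma akernel_continuous y x : y < x < 1 -> {for x, continuous (akernel y)}.
Proof.
move=> yx1; apply: cvgV; first by rewrite sqrtr_eq0 -ltNge mulr_gt0; lra.
apply: (@cvg_comp _ _ _ (fun x => (1 - x) * (x - y)) Num.sqrt _ (nbhs ((1 - x) * (x - y)))).
  apply: cvgM; first by apply: cvgB; [exact: cvg_cst|exact: cvg_id].
  by apply: cvgB; [exact: cvg_id|exact: cvg_cst].
exact: sqrt_continuous.
Qed.

(** The kernel is the nonnegative derivative of the continuous function
    [angle y]. *)
Lemma L1_akernel y : y < 1 -> L1 `]y, 1[ (akernel y).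
Proof.
move=> y1; apply: (FTC_oo_ge0 y1 (angle_continuous y1)).
- exact: is_derive_angle.
- exact: akernel_continuous.
- by move=> x _; exact: akernel_ge0.
Qed.

Lemma Rintegral_akernel y x : y < 1 -> y <= x <= 1 ->
  \int[mu]_(s in `]y, x[) akernel y s = angle y x.
Proof.
move=> y1 /andP[yx x1].
rewrite (FTC_oo (angle_continuous y1) _ _ (L1_akernel y1))//.
- by rewrite angle0 subr0.
- exact: is_derive_angle.
- exact: akernel_continuous.
Qed.

Lemma continuous_horner_onem (p : {poly R}) : continuous (fun x => p.[1 - x]).
Proof.
move=> x.
apply: (@cvg_comp _ _ _ (fun x => 1 - x) (horner p) _ (nbhs (1 - x))).
  by apply: cvgB; [exact: cvg_cst|exact: cvg_id].
exact: continuous_horner.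
Qed.

Lemma is_derive_horner_onem (p : {poly R}) x :
  is_derive x 1 (fun x => p.[1 - x]) (- p^`().[1 - x]).
Proof.
have d1 : is_derive x 1 (fun x : R => 1 - x) (- 1).
  by have := is_deriveB (is_derive_cst (1 : R) x 1) (is_derive_id x 1); rewrite sub0r.
have := @is_derive1_comp R (horner p) (fun x => 1 - x) x _ _ (is_derive_poly p (1 - x)) d1.
by rewrite mulrN1.
Qed.

Lemma continuous_onemX j : continuous (fun x : R => (1 - x) ^+ j).
Proof.
by have := @continuous_horner_onem 'X^j; under eq_fun do rewrite hornerXn.
Qed.

Lemma L1_akernel_horner y (p : {poly R}) : 0 <= y < 1 ->
  L1 `]y, 1[ (fun x => p.[1 - x] * akernel y x).
Proof.
move=> y01.
have cp : {within `[0, 1], continuous (fun x => p.[1 - x])}.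
  exact/continuous_subspaceT/continuous_horner_onem.
have [M pM] := within_continuous_bounded cp.
apply: (@L1_eq _ _ (fun x => akernel y x * p.[1 - x])) => //.
  by move=> x _; rewrite mulrC.
apply: (L1_bounded_mul (M := M)) => //.
- have := within_continuous_measurable cp; apply: measurable_funS => //.
  by apply: subset_itvr; rewrite bnd_simp; case/andP: y01.
- by move=> x /=; rewrite in_itv/= => x01; apply: pM; lra.
- by apply: L1_akernel; case/andP: y01.
Qed.

Definition moment y j := \int[mu]_(x in `]y, 1[) ((1 - x) ^+ j * akernel y x).

Lemma moment0 y : 0 <= y < 1 -> moment y 0 = pi.
Proof.
move=> /andP[y0 y1]; rewrite /moment; under eq_Rintegral do rewrite expr0 mul1r.
by rewrite Rintegral_akernel ?angle1// (ltW y1) lexx.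
Qed.

(** Integrating the derivative of (1 - x)^j * sqrt ((1 - x) (x - y)), which
    vanishes at both endpoints, gives the recurrence. *)
Lemma momentS y j : 0 <= y < 1 ->
  moment y j.+1 * (j.+1)%:R = (1 - y) * (j%:R + 2^-1) * moment y j.
Proof.
move=> y01; have /andP[y0 y1] := y01.
pose F x : R := (1 - x) ^+ j * Num.sqrt ((1 - x) * (x - y)).
pose f x : R := (j.+1)%:R * ((1 - x) ^+ j.+1 * akernel y x) -
  (1 - y) * (j%:R + 2^-1) * ((1 - x) ^+ j * akernel y x).
have Lj i : L1 `]y, 1[ (fun x => (1 - x) ^+ i * akernel y x).
  by apply: L1_eq (L1_akernel_horner 'X^i y01) => // x _; rewrite hornerXn.
have Lf : L1 `]y, 1[ f by apply: L1B => //; apply: L1Z.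
have cF : {within `[y, 1], continuous F}.
  apply: continuous_subspaceT => x; apply: cvgM.
    exact: continuous_onemX.
  apply: (@cvg_comp _ _ _ (fun x => (1 - x) * (x - y)) Num.sqrt _ (nbhs ((1 - x) * (x - y)))).
    apply: cvgM; first by apply: cvgB; [exact: cvg_cst|exact: cvg_id].
    by apply: cvgB; [exact: cvg_id|exact: cvg_cst].
  exact: sqrt_continuous.
have dF x : y < x < 1 -> is_derive x 1 F (f x).
  move=> yx1; have q0 : 0 < (1 - x) * (x - y) by rewrite mulr_gt0; lra.
  have ds := is_derive1_sqrt q0.
  have dq : is_derive x 1 (fun x => (1 - x) * (x - y)) (1 + y - 2 * x).
    by apply: is_derive_eq; rewrite /GRing.scale/=; ring.
  have dsq := @is_derive1_comp R Num.sqrt (fun x => (1 - x) * (x - y)) x _ _ ds dq.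
  have dX : is_derive x 1 (fun x : R => (1 - x) ^+ j) (- (j%:R * (1 - x) ^+ j.-1)).
    have := is_derive_horner_onem 'X^j x.
    rewrite derivXn hornerMn hornerXn mulr_natl.
    by under eq_fun do rewrite hornerXn.
  apply: is_deriveW (is_deriveM dX dsq) _.
  rewrite /f /akernel /GRing.scale/=.
  have s0 : Num.sqrt ((1 - x) * (x - y)) != 0 by rewrite sqrtr_eq0 -ltNge.
  have sE := sqr_sqrtr (ltW q0).
  move: s0 sE; set q := Num.sqrt _ => s0 sE.
  have -> : j%:R * (1 - x) ^+ j.-1 = j%:R * (1 - x) ^+ j / (1 - x).
    case: j {F f Lj Lf cF dX} => [|j]; first by rewrite !mul0r.
    by rewrite /= exprSr; field; lra.
  apply: (mulfI s0).
  have x1 : 1 - x != 0 by lra.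
  transitivity ((1 - x) ^+ j * ((1 + y - 2 * x) / 2) - j%:R * (1 - x) ^+ j * (q ^+ 2 / (1 - x))).
    by field; rewrite s0 x1.
  rewrite sE exprS -natr1; field.
  by rewrite s0 x1.
have cf x : y < x < 1 -> {for x, continuous f}.
  move=> yx1; have ck := akernel_continuous yx1.
  by apply: cvgB; (apply: cvgM; first exact: cvg_cst); apply: cvgM => //; exact: continuous_onemX.
have := @FTC_oo R F f y 1 cF dF cf Lf 1 (ltW y1) (lexx _).
rewrite /F !subrr mulr0 mul0r sqrtr0 !mulr0 subrr.
rewrite /f RintegralB//; try exact: L1Z.
have E i c : \int[mu]_(x in `]y, 1[) (c * ((1 - x) ^+ i * akernel y x)) =
    c * moment y i by rewrite RintegralZl//; exact: Lj.
rewrite !E => /eqP.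
by rewrite subr_eq0 mulrC => /eqP ->.
Qed.

End kernel.

(** * Shifted Legendre polynomials and the sine identity *)

Section legendre.
Context {R : realType}.
Notation mu := (@lebesgue_measure R).
Implicit Types (x y : R) (p q : {poly R}) (n m i j : nat).

(** The polynomials of this part are evaluated at 1 - x: the powers of 1 - x are
    those whose moments against the kernel are monomials in 1 - y. *)
Definition rodrigues n : {poly R} := ('X * (1 - 'X)) ^+ n.

Definition legendre01 n : {poly R} := (n`!%:R)^-1 *: derivn n (rodrigues n).

Lemma derivn_comp_affine p (a b : R) n :
  derivn n (p \Po (a%:P + b *: 'X)) = b ^+ n *: (derivn n p \Po (a%:P + b *: 'X)).
Proof.
elim: n => [|n IH]; first by rewrite expr0 scale1r !derivn0.
rewrite !derivnS IH derivZ deriv_comp derivD derivC add0r derivZ derivX.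
by rewrite mulr_algr scalerA exprSr.
Qed.

(** Rodrigues' formula is transported by the affine map X |-> 1 - 2 X, which
    sends X^2 - 1 to - 4 X (1 - X). *)
Lemma legendre_affine n x : (legendre R n).[2 * x - 1] = (legendre01 n).[1 - x].
Proof.
have E : legendre R n \Po (1%:P + (-2) *: 'X) = legendre01 n.
  rewrite /legendre /legendre01 comp_polyZ.
  have := derivn_comp_affine (('X ^+ 2 - 1) ^+ n) 1 (- 2) n.
  rewrite rmorphXn/= rmorphB/= rmorphXn/= comp_polyX comp_polyC.
  have -> : (1%:P + -2 *: 'X) ^+ 2 - 1%:P = (- 2) ^+ 2 *: (- ('X * (1 - 'X))) :> {poly R}.
    by rewrite -!mul_polyC; ring.
  rewrite -[- ('X * _)]scaleN1r scalerA exprZn derivnZ => H.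
  have n20 : (- 2) ^+ n != 0 :> R by rewrite expf_neq0// oppr_eq0 pnatr_eq0.
  rewrite -[X in _ *: X](scalerK n20) -H !scalerA; congr (_ *: _).
  rewrite exprMn -exprM mulnC exprM.
  have -> : ((-2) ^+ n) ^+ 2 = 2 ^+ n * 2 ^+ n :> R.
    by rewrite -exprM mulnC exprM sqrrN -exprM mulnC exprM.
  have -> : (-2) ^+ n = (-1) ^+ n * 2 ^+ n :> R by rewrite -exprMn mulN1r.
  have n2 : 2 ^+ n != 0 :> R by rewrite expf_neq0.
  have n1 : (-1) ^+ n != 0 :> R by rewrite expf_neq0.
  have nf : n`!%:R != 0 :> R by rewrite pnatr_eq0 -lt0n fact_gt0.
  by field; rewrite nf n1 n2.
have -> : 2 * x - 1 = (1%:P + (-2) *: 'X : {poly R}).[1 - x].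
  by rewrite !hornerE; ring.
by rewrite -horner_comp E.
Qed.

Lemma coef_legendre01 n j :
  (legendre01 n)`_j = (-1) ^+ j * 'C(n, j)%:R * 'C(n + j, n)%:R.
Proof.
rewrite coefZ coef_derivn /rodrigues exprMn coefXnM ltnNge leq_addr/= addKn.
have -> : ((1 - 'X) ^+ n)`_j = (-1) ^+ j * 'C(n, j)%:R :> R.
  have -> : (1 - 'X) ^+ n = \poly_(i < n.+1) ((-1) ^+ i * 'C(n, i)%:R) :> {poly R}.
    rewrite exprBn poly_def; apply: eq_bigr => i _.
    rewrite expr1n mulr1 -mul_polyC rmorphM rmorphXn rmorphN rmorph1 rmorph_nat /=.
    by rewrite -[LHS]mulr_natr; ring.
  by rewrite coef_poly; case: ltnP => // nj; rewrite bin_small// mulr0.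
have nf : n`!%:R != 0 :> R by rewrite pnatr_eq0 -lt0n fact_gt0.
rewrite -[(_ ^+ _ * _) *+ _]mulr_natr -bin_ffact natrM.
by field.
Qed.

Lemma size_legendre01 n : (size (legendre01 n) <= n.+1)%N.
Proof.
by apply/leq_sizeP => j nj; rewrite coef_legendre01 bin_small// mulr0 mul0r.
Qed.

(** The functional that defines orthogonality.  Its properties used below
    are algebraic consequences of linearity and of [J_deriv]. *)
Definition J p := \int[mu]_(x in `]0, 1[) p.[1 - x].

Lemma L1_horner_onem p : L1 `]0, 1[ (fun x => p.[1 - x]).
Proof.
by apply: L1_within_continuous; exact/continuous_subspaceT/continuous_horner_onem.
Qed.

Lemma J_deriv p : J p^`() = p.[1] - p.[0].
Proof.
have cF : {within `[0, 1], continuous (fun x => - p.[1 - x])}.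
  by apply: continuous_subspaceT => x; apply: cvgN; exact: continuous_horner_onem.
have dF x : 0 < x < 1 -> is_derive x 1 (fun x => - p.[1 - x]) p^`().[1 - x].
  move=> _; rewrite -[X in is_derive _ _ _ X]opprK; apply: is_deriveN.
  exact: is_derive_horner_onem.
have cf x : 0 < x < 1 -> {for x, continuous (fun x => p^`().[1 - x])}.
  by move=> _; exact: continuous_horner_onem.
have := FTC_oo cF dF cf (L1_horner_onem _) ler01 (lexx 1).
by rewrite /J => ->; rewrite subrr subr0 opprK addrC.
Qed.

Lemma JD p q : J (p + q) = J p + J q.
Proof.
rewrite /J -RintegralD//; try exact: L1_horner_onem.
by apply: eq_Rintegral => x _; rewrite hornerD.
Qed.

Lemma JZ c p : J (c *: p) = c * J p.
Proof.
rewrite /J -RintegralZl//; try exact: L1_horner_onem.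
by apply: eq_Rintegral => x _; rewrite hornerZ.
Qed.

Lemma J_parts p q : p.[0] = 0 -> p.[1] = 0 -> J (p^`() * q) = - J (p * q^`()).
Proof.
move=> p0 p1; have := J_deriv (p * q).
rewrite derivM JD !hornerM p0 p1 !mul0r subrr => /eqP.
by rewrite addr_eq0 => /eqP.
Qed.

Lemma J_beta a b : J ('X^a * (1 - 'X) ^+ b) * (a + b).+1`!%:R = a`!%:R * b`!%:R.
Proof.
elim: b a => [|b IH] a.
  rewrite expr0 mulr1 addn0 fact0 mulr1 factS natrM mulrA.
  have := J_deriv ('X^(a.+1)).
  rewrite derivXn/= -scaler_nat JZ mulrC => ->.
  by rewrite !hornerXn expr1n expr0n subr0 mul1r.
have := J_deriv ('X^(a.+1) * (1 - 'X) ^+ b.+1).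
rewrite !hornerE subrr !expr0n/= !(mulr0, mul0r) subr0.
have -> : ('X^(a.+1) * (1 - 'X) ^+ b.+1)^`() =
  a.+1%:R *: ('X^a * (1 - 'X) ^+ b.+1) - b.+1%:R *: ('X^(a.+1) * (1 - 'X) ^+ b) :> {poly R}.
  rewrite derivM derivXn/= deriv_exp/= derivB derivC derivX sub0r.
  rewrite -(scaler_nat a.+1 'X^a) -(scaler_nat b.+1 (_ * _)) -!mul_polyC !exprS.
  move: 'X^a ((1 - 'X) ^+ b) a.+1%:R%:P b.+1%:R%:P => A B c d.
  by rewrite mulN1r; ring.
rewrite -scaleNr JD !JZ mulNr => /eqP; rewrite subr_eq0 => /eqP E.
apply: (mulfI (_ : a.+1%:R != 0)); first by rewrite pnatr_eq0.
by rewrite mulrA E -mulrA addnS -addSn IH !factS !natrM; ring.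
Qed.

(** The derivatives of order less than n of (X (1 - X))^n vanish at 0 and 1, so
    that Rodrigues' formula can be integrated by parts n times. *)
Lemma rodrigues_derivn n i : (i <= n)%N ->
  exists E, derivn i (rodrigues n) = E * ('X * (1 - 'X)) ^+ (n - i).
Proof.
elim: i => [_|i IH ni]; first by exists 1; rewrite derivn0 mul1r subn0.
have [E EE] := IH (ltnW ni).
exists (E^`() * ('X * (1 - 'X)) + (n - i)%:R *: (E * ('X * (1 - 'X))^`())).
rewrite derivnS EE -(subnSK ni) [LHS]derivM deriv_exp/= -(scaler_nat _ (_ * _)) -!mul_polyC.
by rewrite exprS; ring.
Qed.

Lemma J_rodrigues n q i : (i <= n)%N ->
  J (derivn n (rodrigues n) * q) =
  (-1) ^+ i * J (derivn (n - i) (rodrigues n) * derivn i q).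
Proof.
elim: i => [_|i IH ni]; first by rewrite expr0 mul1r subn0 derivn0.
rewrite IH ?(ltnW ni)// -(subnSK ni) derivnS J_parts.
- by rewrite -derivnS exprS mulN1r mulrN mulNr.
- have [|E ->] := @rodrigues_derivn n (n - i.+1); first exact: leq_subr.
  by rewrite subKn// hornerM horner_exp hornerM hornerX mul0r expr0n mulr0.
- have [|E ->] := @rodrigues_derivn n (n - i.+1); first exact: leq_subr.
  rewrite subKn// hornerM horner_exp hornerM hornerD hornerN hornerX hornerC.
  by rewrite subrr mulr0 expr0n mulr0.
Qed.

Lemma J_legendre01_lt m n : (m < n)%N -> J (legendre01 n * legendre01 m) = 0.
Proof.
move=> mn; rewrite /legendre01 -scalerAl JZ (J_rodrigues _ (leqnn n)).
rewrite (_ : derivn n _ = 0) ?mulr0; last first.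
  apply: derivn_poly0; exact: leq_trans (size_legendre01 m) mn.
by rewrite -[X in J X](scale0r 0) JZ mul0r !mulr0.
Qed.

Lemma J_legendre01 n m :
  J (legendre01 n * legendre01 m) = (n == m)%:R / (n.*2.+1)%:R.
Proof.
have [mn|nm|->] := ltngtP m n.
- by rewrite J_legendre01_lt// mul0r.
- by rewrite mulrC J_legendre01_lt// mul0r.
have nf : n`!%:R != 0 :> R by rewrite pnatr_eq0 -lt0n fact_gt0.
have DL : derivn n (legendre01 n) = ((-1) ^+ n * 'C(n + n, n)%:R * n`!%:R)%:P.
  apply/polyP => i; rewrite coef_derivn coef_legendre01 coefC.
  case: i => [|i]; first by rewrite addn0 binn mulr1 ffactnn -[LHS]mulr_natr.
  by rewrite bin_small ?mulr0 ?mul0r ?mul0rn//; lia.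
rewrite {1}/legendre01 -scalerAl JZ (J_rodrigues _ (leqnn n)) subnn derivn0 DL.
rewrite [rodrigues n * _]mulrC mul_polyC JZ.
have := J_beta n n; rewrite -exprMn -/(rodrigues n) => Jn.
have fb : (n + n).+1`!%:R = (n.*2.+1)%:R * ('C(n + n, n)%:R * (n`!%:R * n`!%:R)) :> R.
  by rewrite factS -!natrM -addnn -(@bin_fact (n + n) n) ?addnK// leq_addl.
have n1 : (-1) ^+ n * (-1) ^+ n = 1 :> R by rewrite -expr2 sqrr_sign.
have nn : (n.*2.+1)%:R != 0 :> R by rewrite pnatr_eq0.
have nC : 'C(n + n, n)%:R != 0 :> R by rewrite pnatr_eq0 -lt0n bin_gt0 leq_addl.
have -> : J (rodrigues n) = n`!%:R * n`!%:R / (n + n).+1`!%:R.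
  by rewrite -Jn mulfK// pnatr_eq0 -lt0n fact_gt0.
rewrite fb; transitivity ((-1) ^+ n * (-1) ^+ n / (n.*2.+1)%:R : R); last by rewrite n1.
move: nn nC nf; move: n.*2.+1%:R ('C(n + n, n)%:R) (n`!%:R) ((-1) ^+ n) => a b c d a0 b0 c0.
by field; rewrite a0 b0 c0.
Qed.

(** This identity matches the coefficients of [legendre01 n] with those of
    [sineU n] weighted by the moments of the kernel. *)
Lemma bin_double_mul n j : ('C(n + j, j.*2) * 'C(j.*2, j) = 'C(n, j) * 'C(n + j, n))%N.
Proof.
have [jn|nj] := leqP j n; last first.
  by rewrite [in RHS]bin_small// bin_small// -addnn ltn_add2r.
have H1 : ('C(n + j, j.*2) * (j.*2`! * (n - j)`!) = (n + j)`!)%N.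
  rewrite -(@bin_fact (n + j) j.*2); first by rewrite -addnn subnDr.
  by rewrite -addnn leq_add2r.
have H2 : ('C(j.*2, j) * (j`! * j`!) = j.*2`!)%N.
  rewrite -(@bin_fact j.*2 j); first by rewrite -addnn addnK.
  by rewrite -addnn leq_addl.
have H3 : ('C(n + j, n) * (n`! * j`!) = (n + j)`!)%N.
  by rewrite -(@bin_fact (n + j) n) ?leq_addr// addKn.
have H4 : ('C(n, j) * (j`! * (n - j)`!) = n`!)%N by rewrite bin_fact.
apply/eqP; rewrite -(eqn_pmul2r (_ : 0 < j`! * j`! * (n - j)`!)%N); last first.
  by rewrite !muln_gt0 !fact_gt0.
apply/eqP; transitivity ((n + j)`!).
  by rewrite -H1 -H2; ring.
by rewrite -H3 -H4; ring.
Qed.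

(** In terms of the Chebyshev polynomials of the second kind, [sineU n] at
    cos th ^ 2 is (-1)^n U_2n (cos th); the explicit coefficients are what the
    moment computation needs. *)
Definition sineU n : {poly R} := \poly_(j < n.+1) ((-1) ^+ j * 'C(n + j, j.*2)%:R * 4 ^+ j).

Lemma coef_sineU n j : (sineU n)`_j = (-1) ^+ j * 'C(n + j, j.*2)%:R * 4 ^+ j.
Proof.
rewrite coef_poly; case: ltnP => // nj.
by rewrite bin_small ?mulr0 ?mul0r// -addnn ltn_add2r.
Qed.

Lemma sineU_rec n : sineU n.+2 = (2%:P - 4 *: 'X) * sineU n.+1 - sineU n.
Proof.
apply/polyP => j; rewrite coefB mulrBl coefB -scalerAl coefZ coefXM.
rewrite coefCM !coef_sineU.
case: j => [|j]; first by rewrite !bin0 /=; ring.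
rewrite /=.
have -> : ((n.+2 + j.+1) = (n + j).+3)%N by lia.
have -> : ((n.+1 + j.+1) = (n + j).+2)%N by lia.
have -> : ((n + j.+1) = (n + j).+1)%N by lia.
have -> : ((n.+1 + j) = (n + j).+1)%N by lia.
rewrite doubleS !binS !natrD !exprS; ring.
Qed.

(** Both sides satisfy the recurrence [sineU_rec] in n, because of
    sin (a + 2 th) + sin (a - 2 th) = 2 sin a cos (2 th). *)
Lemma sin_odd n (th : R) :
  (-1) ^+ n * sin ((n.*2.+1)%:R * th) = sin th * (sineU n).[cos th ^+ 2].
Proof.
suff : (-1) ^+ n * sin ((n.*2.+1)%:R * th) = sin th * (sineU n).[cos th ^+ 2] /\
  (-1) ^+ n.+1 * sin ((n.+1.*2.+1)%:R * th) = sin th * (sineU n.+1).[cos th ^+ 2].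
  by case.
have s2 : sin th ^+ 2 = 1 - cos th ^+ 2 by rewrite sin2cos2.
elim: n => [|n [IH1 IH2]].
  split.
    rewrite expr0 !mul1r (_ : sineU 0 = 1) ?hornerC ?mulr1//.
    apply/polyP => -[|j]; rewrite coef_sineU coef1 ?bin0 /= ?expr0 ?mulr1//.
    by rewrite bin_small ?mulr0 ?mul0r//; lia.
  have -> : sineU 1 = 1%:P - 4 *: 'X.
    apply/polyP => -[|[|j]]; rewrite coef_sineU coefB coefC coefZ coefX /=.
    - by rewrite bin0 !expr0 mulr0 subr0 !mulr1.
    - by rewrite !expr1 mulr1 sub0r mulr1 mulN1r.
    - by rewrite bin_small ?mulr0 ?mul0r ?subr0//; lia.
  rewrite !(hornerD, hornerN, hornerZ, hornerX, hornerC).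
  have -> : 1.*2.+1%:R * th = th + th + th by rewrite -!addnn; ring.
  rewrite expr1 !sinD !cosD.
  rewrite mulN1r; transitivity (sin th * (sin th ^+ 2 - 3 * cos th ^+ 2)); first by ring.
  by rewrite s2; ring.
split => //; rewrite sineU_rec !(hornerM, hornerD, hornerN, hornerZ, hornerX, hornerC).
rewrite mulrDr mulrN -IH1 mulrCA -IH2.
have -> : n.+2.*2.+1%:R * th = n.+1.*2.+1%:R * th + 2 * th.
  by rewrite -mulrDl -natrD; congr (_%:R * _); lia.
have -> : n.*2.+1%:R * th = n.+1.*2.+1%:R * th - 2 * th.
  by rewrite -mulrBl -natrB//; congr (_%:R * _); lia.
have c2 : cos (2 * th) = 2 * cos th ^+ 2 - 1.
  by rewrite mulr_natl cos_mulr2n -mulr_natl.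
move: (n.+1.*2.+1%:R * th) => a; rewrite sinD sinB c2.
by rewrite !exprS; ring.
Qed.

Lemma momentE y j : 0 <= y < 1 ->
  moment y j * 4 ^+ j = pi * 'C(j.*2, j)%:R * (1 - y) ^+ j.
Proof.
move=> y01; elim: j => [|j IH].
  by rewrite !expr0 !mulr1 moment0.
have H : ('C(j.+1.*2, j.+1) * j.+1 = (j.*2.+1).*2 * 'C(j.*2, j))%N.
  have := mul_bin_diag j.*2.+2 j; have := mul_bin_down j.*2.+1 j.
  rewrite /= -doubleS; nia.
apply: (mulIf (_ : j.+1%:R != 0)); first by rewrite pnatr_eq0.
rewrite mulrAC momentS//.
transitivity ((1 - y) * (j%:R + 2^-1) * 4 * (moment y j * 4 ^+ j)); first by rewrite exprS; ring.
rewrite IH; transitivity (pi * ('C(j.+1.*2, j.+1) * j.+1)%:R * (1 - y) ^+ j.+1 : R);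
  last by rewrite natrM; ring.
have d : (j.*2.+1.*2)%:R = 4 * j%:R + 2 :> R.
  by rewrite -natrM -natrD; congr (_%:R); lia.
by rewrite H natrM d exprS; field.
Qed.

(** The adjoint of the Abel transform maps sines of half-integer frequency to
    Legendre polynomials; the two polynomials in 1 - y are compared coefficient
    by coefficient. *)
Lemma Rintegral_sineU_akernel n y : 0 <= y < 1 ->
  \int[mu]_(x in `]y, 1[) ((sineU n).[1 - x] * akernel y x) =
  pi * (legendre01 n).[1 - y].
Proof.
move=> y01.
have Lj i : L1 `]y, 1[ (fun x => (1 - x) ^+ i * akernel y x).
  by apply: L1_eq (L1_akernel_horner 'X^i y01) => // x _; rewrite hornerXn.
transitivity (\int[mu]_(x in `]y, 1[)
  (\sum_(j < n.+1) (sineU n)`_j * ((1 - x) ^+ j * akernel y x))).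
  apply: eq_Rintegral => x _.
  rewrite (@horner_coef_wide _ n.+1); last exact: size_poly.
  by rewrite big_distrl/=; apply: eq_bigr => j _; rewrite mulrA.
rewrite Rintegral_sum//; last by move=> j _; exact: L1Z.
rewrite (horner_coef_wide _ (size_legendre01 n)) big_distrr/=.
apply: eq_bigr => j _; rewrite RintegralZl//; last exact: Lj.
rewrite -/(moment y j) coef_sineU coef_legendre01.
transitivity ((-1) ^+ j * 'C(n + j, j.*2)%:R * (moment y j * 4 ^+ j)); first by ring.
rewrite momentE//.
transitivity ((-1) ^+ j * ('C(n + j, j.*2) * 'C(j.*2, j))%:R * pi * (1 - y) ^+ j : R).
  by rewrite natrM; ring.
by rewrite bin_double_mul natrM; ring.
Qed.

End legendre.

(** * The adjoint of the Abel transform *)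

Section abel.
Context {R : realType}.
Notation mu := (@lebesgue_measure R).
Implicit Types (x y : R) (f : R -> R).

(** Without integrability both sides are 0, by the convention on real-valued
    integrals.  This matters because the Abel integral may diverge at some
    points. *)
Lemma RintegralZl_measurable (D : set (measurableTypeR R)) c f :
  measurable D -> measurable_fun D f ->
  \int[mu]_(x in D) (c * f x) = c * \int[mu]_(x in D) f x.
Proof.
move=> mD mf; have [->|c0] := eqVneq c 0.
  by rewrite mul0r; under eq_Rintegral do rewrite mul0r; rewrite Rintegral_cst// mul0r.
have [Lf|nLf] := pselect (L1 D f); first by rewrite RintegralZl.
have not_L1 u : measurable_fun D u -> ~ L1 D u -> \int[mu]_(x in D) u x = 0.
  move=> mu_ nLu; rewrite /Rintegral.
  have mEu : measurable_fun D (EFin \o u) by exact: measurable_fun_EFin.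
  have : (\int[mu]_(x in D) (EFin \o u) x)%E \isn't a fin_num.
    rewrite -(@integral_fin_num_abs _ _ _ mu D u mD mu_); apply/negP => h; apply: nLu.
    by apply/integrableP; split.
  by rewrite /=; case: (\int[mu]_(x in D) _)%E.
rewrite (not_L1 _ mf nLf) not_L1 ?mulr0//.
  by apply: measurable_funM.
move=> Lcf; apply: nLf; have := L1Z c^-1 mD Lcf.
by apply: L1_eq => // x _; rewrite mulKf.
Qed.

(** The two sides are the iterated integrals of
    f y * p (1 - x) / sqrt ((1 - x) (x - y)) over the triangle y < x; the bound
    C pi |f y| on the inner integrals makes Fubini's theorem applicable. *)
Lemma abel_adjoint f (p : {poly R}) : L1 `]0, 1[ f ->
  \int[mu]_(x in `]0, 1[) (abel f x * (p.[1 - x] / Num.sqrt (1 - x))) =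
  \int[mu]_(y in `]0, 1[) (f y * \int[mu]_(x in `]y, 1[) (p.[1 - x] * akernel y x)).
Proof.
move=> Lf; set D := (`]0, 1[%classic : set R).
have mD : measurable D by exact: measurable_itv.
have [C pC] : exists M, forall x, 0 <= x <= 1 -> `|p.[1 - x]| <= M.
  apply: within_continuous_bounded.
  exact/continuous_subspaceT/continuous_horner_onem.
pose w x : R := p.[1 - x] / Num.sqrt (1 - x).
pose T := [set q : R * R | q.2 < q.1].
pose F (q : R * R) := (f \_ D) q.2 * (w \_ D) q.1 * (Num.sqrt (q.1 - q.2))^-1 * \1_T q.
have inD (u : R -> R) s : D s -> (u \_ D) s = u s by move=> Ds; rewrite patchE mem_set.
have inD0 (u : R -> R) s : ~ D s -> (u \_ D) s = 0 by move=> Ds; rewrite patchE memNset.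
have mT : measurable T.
  have := @measurable_fun_ltr _ _ R setT (snd : R * R -> R) fst.
  move=> /(_ measurable_snd measurable_fst measurableT [set true]).
  by rewrite setTI; apply.
(* The square root is 0 on negative numbers, so its inverse is the extension
   by 0 of a continuous function. *)
have msqrtV : measurable_fun setT (fun x : R => (Num.sqrt x)^-1).
  have -> : (fun x : R => (Num.sqrt x)^-1) = (fun x => (Num.sqrt x)^-1) \_ `]0, +oo[.
    apply/funext => x; rewrite patchE; case: ifPn => // /negP xn.
    rewrite ler0_sqrtr ?invr0// leNgt; apply/negP => x0; apply: xn.
    by rewrite inE /= in_itv/= x0.
  apply/(measurable_restrictT _ (measurable_itv _)).
  apply: open_continuous_measurable_fun => // x /[1!inE]/=; rewrite in_itv/= andbT => x0.
  by apply: cvgV; [rewrite gt_eqF// sqrtr_gt0|exact: sqrt_continuous].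
have mw : measurable_fun D w.
  apply: measurable_funTS; apply: measurable_funM.
    by apply: continuous_measurable_fun; exact: continuous_horner_onem.
  apply: (measurableT_comp msqrtV); apply: measurable_funB => //.
have mF : measurable_fun setT F.
  apply: measurable_funM; last by exact: measurable_indic.
  apply: measurable_funM.
    apply: measurable_funM.
      apply: measurableT_comp => //.
      by apply/(measurable_restrictT _ mD); exact: L1_measurable.
    apply: measurableT_comp => //.
    by apply/(measurable_restrictT _ mD).
  apply: (measurableT_comp msqrtV); exact: measurable_funB.
have F1 x : D x -> \int[mu]_(y in D) F (x, y) = abel f x * w x.
  move=> Dx.
  have -> : \int[mu]_(y in D) F (x, y) =
      \int[mu]_(y in D `&` `]0, x[) (w x * (f y / Num.sqrt (x - y))).
    rewrite Rintegral_mkcondr; apply: eq_Rintegral => y /[1!inE] Dy.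
    rewrite /F/= inD// inD// patchE indicE /=.
    move: Dy; rewrite /D /= in_itv/= => /andP[y0 y1].
    have [yx|yx] := ltP y x.
      rewrite mem_set//= ?mem_set ?mulr1//= ?in_itv/= ?y0 ?yx//; ring.
    have nyx : (y < x) = false by rewrite ltNge yx.
    rewrite memNset; last by rewrite /T/= nyx.
    by rewrite mulr0 memNset//= in_itv/= nyx andbF.
  have sx : `]0, x[ `<=` D.
    move=> y; rewrite /D /= !in_itv/= => /andP[-> yx].
    by move: Dx; rewrite /D /= in_itv/= => /andP[_ x1]; rewrite (lt_trans yx x1).
  rewrite setIidr// RintegralZl_measurable//; first by rewrite mulrC.
  apply: measurable_funM.
    by have := L1_measurable Lf; apply: measurable_funS.
  apply: measurable_funTS; apply: (measurableT_comp msqrtV).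
  exact: measurable_funB.
have E x y : D x -> D y -> F (x, y) =
    f y * ((fun z => p.[1 - z] * akernel y z) \_ `]y, 1[) x.
  move=> Dx Dy; rewrite /F/= inD// inD// patchE indicE /=.
  move: Dx Dy; rewrite /D /= !in_itv/= => /andP[x0 x1] /andP[y0 y1].
  have [yx|yx] := ltP y x.
    rewrite mem_set//= ?mem_set ?mulr1//= ?in_itv/= ?x1 ?yx//.
    by rewrite /w /akernel sqrtrM ?invfM; [ring|lra].
  have nyx : (y < x) = false by rewrite ltNge yx.
  rewrite memNset; last by rewrite /T/= nyx.
  by rewrite mulr0 memNset ?mulr0//= in_itv/= nyx.
have sy y : D y -> `]y, 1[ `<=` D.
  move=> Dy x; rewrite /D /= !in_itv/= => /andP[yx ->].
  by move: Dy; rewrite /D /= in_itv/= => /andP[y0 _]; rewrite (lt_trans y0 yx).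
have y01 y : D y -> 0 <= y < 1.
  by rewrite /D /= in_itv/= => /andP[y0 ->]; rewrite ltW.
have Lk y : D y -> L1 D ((fun z => p.[1 - z] * akernel y z) \_ `]y, 1[).
  move=> Dy; rewrite /L1 -restrict_EFin.
  have my : measurable (`]y, 1[%classic : set R) by exact: measurable_itv.
  apply/integrable_restrict => //=; rewrite setIidr; last exact: sy.
  by apply: L1_akernel_horner; exact: y01.
have F2 y : D y -> \int[mu]_(x in D) F (x, y) =
    f y * \int[mu]_(x in `]y, 1[) (p.[1 - x] * akernel y x).
  move=> Dy.
  have -> : \int[mu]_(x in D) F (x, y) = \int[mu]_(x in D)
      (f y * ((fun z => p.[1 - z] * akernel y z) \_ `]y, 1[) x).
    by apply: eq_Rintegral => x /[1!inE] Dx; exact: E.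
  rewrite RintegralZl//; last exact: Lk.
  by rewrite -Rintegral_mkcondr setIidr//; exact: sy.
have := @Rintegral_swap R F D (fun y => C * pi * `|f y|) mD mF.
have -> : \int[mu]_(x in D) \int[mu]_(y in D) F (x, y) =
   \int[mu]_(x in D) (abel f x * (p.[1 - x] / Num.sqrt (1 - x))).
  by apply: eq_Rintegral => x /[1!inE]; exact: F1.
have -> : \int[mu]_(y in D) \int[mu]_(x in D) F (x, y) =
   \int[mu]_(y in D) (f y * \int[mu]_(x in `]y, 1[) (p.[1 - x] * akernel y x)).
  by apply: eq_Rintegral => y /[1!inE]; exact: F2.
apply.
- move=> x y Dxy; rewrite /F/=; have [Dx|Dx] := pselect (D x); last first.
    by rewrite (inD0 w)// !(mulr0,mul0r).
  by rewrite (inD0 f) ?mul0r// => Dy; exact: Dxy.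
- move=> y Dy.
  have -> : (\int[mu]_(x in D) `|(F (x, y))%:E| = \int[mu]_(x in D)
     (`|f y * ((fun z => p.[1 - z] * akernel y z) \_ `]y, 1[) x|)%:E)%E.
    by apply: eq_integral => x /[1!inE] Dx; rewrite E.
  rewrite -EFin_Rintegral//; last by apply: L1_norm; apply: L1Z => //; exact: Lk.
  rewrite lee_fin; under eq_Rintegral do rewrite normrM.
  rewrite RintegralZl//; last by apply: L1_norm; exact: Lk.
  rewrite mulrC ler_wpM2r//.
  have -> : \int[mu]_(x in D) `|((fun z => p.[1 - z] * akernel y z) \_ `]y, 1[) x| =
    \int[mu]_(x in `]y, 1[) `|p.[1 - x] * akernel y x|.
    rewrite -[in RHS](setIidr (sy y Dy)) Rintegral_mkcondr.
    apply: eq_Rintegral => x _; rewrite !patchE; case: ifP => //.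
    by rewrite normr0.
  have /andP[y0 y1] := y01 _ Dy.
  have <- : \int[mu]_(x in `]y, 1[) (C * akernel y x) = C * pi.
    rewrite RintegralZl//; last exact: L1_akernel.
    by rewrite Rintegral_akernel ?angle1// (ltW y1) lexx.
  apply: le_Rintegral => //.
  + by apply: L1_norm; apply: L1_akernel_horner; exact: y01.
  + by apply: L1Z => //; exact: L1_akernel.
  + move=> x /=; rewrite in_itv/= => /andP[yx x1].
    rewrite normrM (ger0_norm (akernel_ge0 _ _)) ler_wpM2r ?akernel_ge0//.
    by apply: pC; rewrite (ltW x1) andbT (le_trans y0 (ltW yx)).
- by apply: L1Z => //; exact: L1_norm.
Qed.

End abel.

(** * Repeated integration by parts in the angle *)

Section trigpoly.
Context {R : realType}.
Notation mu := (@lebesgue_measure R).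
Implicit Types (x t A B c : R) (S T : R -> R) (b : bool) (d m i j n k : nat).

(** The boolean is the parity: [true] for the odd function [sin]. *)
Definition trig b : R -> R := if b then sin else cos.

(** [trigpoly b d A T]: T is a trigonometric polynomial of degree at most d, a
    combination of sines if b and of cosines otherwise, whose coefficients have
    absolute sum at most A.  In this norm differentiation costs a factor d
    (Bernstein's inequality is immediate) and multiplication by sin costs
    nothing; with the supremum norm the first bound would need an argument. *)
Inductive trigpoly b d : R -> (R -> R) -> Prop :=
| tp_atom m of (m <= d)%N : trigpoly b d 1 (fun t => trig b (m%:R * t))
| tp_scale c A T of trigpoly b d A T : trigpoly b d (`|c| * A) (fun t => c * T t)
| tp_add A B S T of trigpoly b d A S & trigpoly b d B T :
    trigpoly b d (A + B) (fun t => S t + T t)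
| tp_le A B T of A <= B & trigpoly b d A T : trigpoly b d B T.

Lemma normr_trig b t : `|trig b t| <= 1.
Proof.
by rewrite ler_norml; case: b; rewrite /trig ?sin_geN1 ?sin_le1 ?cos_geN1 ?cos_le1.
Qed.

Lemma trigpoly_bound b d A T : trigpoly b d A T -> forall t, `|T t| <= A.
Proof.
elim=> {A T} [m _ t|c A T _ IH t|A B S T _ IHS _ IHT t|A B T AB _ IH t].
- exact: normr_trig.
- by rewrite normrM ler_wpM2l.
- by rewrite (le_trans (ler_normD _ _))// lerD.
- exact: le_trans (IH t) AB.
Qed.

Lemma is_derive_trig b c t :
  is_derive t 1 (fun t => trig b (c * t)) ((-1) ^+ (~~ b) * c * trig (~~ b) (c * t)).
Proof.
have dc : is_derive t 1 (fun t => c * t) c.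
  by have := is_deriveZ c (is_derive_id t (1 : R)); rewrite /GRing.scale/= mulr1.
case: b; rewrite /trig /=.
  have := @is_derive1_comp R sin (fun t => c * t) t _ _ (is_derive_sin _) dc.
  by move=> /is_deriveW; apply; rewrite expr0 mul1r mulrC.
have := @is_derive1_comp R cos (fun t => c * t) t _ _ (is_derive_cos _) dc.
by move=> /is_deriveW; apply; rewrite expr1; ring.
Qed.

Lemma continuous_trigM b c : continuous (fun t => trig b (c * t)).
Proof.
move=> t; apply/differentiable_continuous/derivable1_diffP.
by case: (is_derive_trig b c t).
Qed.

Lemma trigpoly_derive b d A T : trigpoly b d A T ->
  exists2 T', (forall t, is_derive t 1 T (T' t)) & trigpoly (~~ b) d (d%:R * A) T'.
Proof.
elim=> {A T} [m md|c A T _ [T' dT IH]|A B S T _ [S' dS IHS] _ [T' dT IHT]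
              |A B T AB _ [T' dT IH]].
- exists (fun t => (-1) ^+ (~~ b) * m%:R * trig (~~ b) (m%:R * t)).
    by move=> t; exact: is_derive_trig.
  apply: tp_le (tp_scale _ (tp_atom _ md)).
  by rewrite normrM normr_nat normrX normrN1 expr1n mul1r mulr1 mulr1 ler_nat.
- exists (fun t => c * T' t); first by move=> t; exact: (is_deriveZ c (dT t)).
  by rewrite mulrCA; exact: tp_scale.
- exists (fun t => S' t + T' t); first by move=> t; exact: (is_deriveD (dS t) (dT t)).
  by rewrite mulrDr; exact: tp_add.
- by exists T' => //; apply: tp_le IH; rewrite ler_wpM2l.
Qed.

Lemma trigpoly_derive1 b d A T : trigpoly b d A T ->
  (forall t, is_derive t 1 T (derive1 T t)) /\
  trigpoly (~~ b) d (d%:R * A) (derive1 T).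
Proof.
move=> /trigpoly_derive[T' dT tT'].
have -> : derive1 T = T'.
  by apply/funext => t; rewrite derive1E; case: (dT t).
by [].
Qed.

Lemma trigpoly_sin b d A T : trigpoly b d A T ->
  trigpoly (~~ b) d.+1 A (fun t => T t * sin t).
Proof.
elim=> {A T} [m md|c A T _ IH|A B S T _ IHS _ IHT|A B T AB _ IH]; last 3 first.
- under eq_fun do rewrite -mulrA; exact: tp_scale.
- under eq_fun do rewrite mulrDl; exact: tp_add.
- exact: tp_le IH.
case: m md => [_|m md].
  case: b => /=.
    have -> : (fun t => trig true (0%:R * t) * sin t) =
        (fun t => 0 * trig false (0%:R * t)).
      by apply/funext => t; rewrite /trig mul0r sin0 !mul0r.
    apply: (@tp_le _ _ (`|0| * 1)); first by rewrite normr0 mul0r.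
    exact/tp_scale/tp_atom.
  have -> : (fun t => trig false (0%:R * t) * sin t) = (fun t => trig true (1%:R * t)).
    by apply/funext => t; rewrite /trig mul0r cos0 !mul1r.
  exact: tp_atom.
have m2 : (m.+2 <= d.+1)%N by [].
have m0 : (m <= d.+1)%N by rewrite (leq_trans _ (leqnSn d))// ltnW.
have E t : m.+2%:R * t = m.+1%:R * t + t by rewrite -natr1 mulrDl mul1r.
have E' t : m%:R * t = m.+1%:R * t - t by rewrite -natr1; ring.
case: b => /=.
  have -> : (fun t => trig true (m.+1%:R * t) * sin t) =
    (fun t => 2^-1 * trig false (m%:R * t) + (- 2^-1) * trig false (m.+2%:R * t)).
    apply/funext => t; rewrite E E' /trig cosB cosD; move: (_ * t) => a.
    by field.
  apply: (@tp_le _ _ (`|2^-1| * 1 + `| - 2^-1| * 1)).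
    by rewrite normrN !mulr1 ger0_norm//; lra.
  by apply: tp_add; apply: tp_scale; exact: tp_atom.
have -> : (fun t => trig false (m.+1%:R * t) * sin t) =
  (fun t => 2^-1 * trig true (m.+2%:R * t) + (- 2^-1) * trig true (m%:R * t)).
  apply/funext => t; rewrite E E' /trig sinB sinD; move: (_ * t) => a.
  by field.
apply: (@tp_le _ _ (`|2^-1| * 1 + `| - 2^-1| * 1)).
  by rewrite normrN !mulr1 ger0_norm//; lra.
by apply: tp_add; apply: tp_scale; exact: tp_atom.
Qed.

Lemma sin_natpi m : sin (m%:R * pi : R) = 0.
Proof.
elim: m => [|m IH]; first by rewrite mul0r sin0.
by rewrite -natr1 mulrDl mul1r sinDpi IH oppr0.
Qed.

Lemma trigpoly_sin_pi d A T : trigpoly true d A T -> T pi = 0.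
Proof.
elim=> {A T} [m _|c A T _ IH|A B S T _ IHS _ IHT|A B T AB _ IH] //.
- exact: sin_natpi.
- by rewrite IH mulr0.
- by rewrite IHS IHT addr0.
Qed.

(** The coefficients of the higher chain rule for G (sin (t / 2) ^ 2): its
    derivative of order j is the sum over i of chain j i t times the derivative
    of order i of G at sin (t / 2) ^ 2.  The recurrence is the product rule,
    sin t / 2 being the derivative of sin (t / 2) ^ 2. *)
Fixpoint chain j i : R -> R :=
  match j with
  | 0%N => fun=> (i == 0%N)%:R
  | j'.+1 => fun t => derive1 (chain j' i) t +
      (if i is i'.+1 then chain j' i' t else 0) * (sin t / 2)
  end.

Lemma chain_gt j i : (j < i)%N -> chain j i = fun=> 0.
Proof.
elim: j i => [|j IH] [|i]//= ji.
rewrite IH ?(ltnW ji)// IH//; apply/funext => t.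
by rewrite derive1_cst mul0r addr0.
Qed.

(** Induction on j: chain j.+1 i.+1 has size at most (i.+1 + 1 / 2) * j!, which
    is at most j.+1! as long as i < j; for i = j the first term is absent. *)
Lemma chain_trigpoly j i : trigpoly (odd j) i j`!%:R (chain j i).
Proof.
elim: j i => [|j IH] i.
  have -> : chain 0 i = fun t => (i == 0%N)%:R * trig false (0%:R * t).
    by apply/funext => t; rewrite /trig mul0r cos0 mulr1.
  apply: (@tp_le _ _ (`|(i == 0%N)%:R| * 1)).
    by rewrite mulr1 normr_nat lern1; case: (i == 0%N).
  exact/tp_scale/tp_atom.
have [ij|ji] := leqP i j.+1; last first.
  rewrite chain_gt// (_ : (fun=> 0) = (fun t => 0 * trig (odd j.+1) (0%:R * t))).
    apply: (@tp_le _ _ (`|0| * 1)); first by rewrite normr0 mul0r.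
    exact/tp_scale/tp_atom.
  by apply/funext => t; rewrite mul0r.
have [A AE tA] : exists2 A : R, A = (if i == j.+1 then 0 else j`!%:R) &
    trigpoly (odd j.+1) i (i%:R * A) (derive1 (chain j i)).
  exists (if i == j.+1 then 0 else j`!%:R) => //.
  case: eqP => [ij'|_]; last exact: (trigpoly_derive1 (IH i)).2.
  rewrite mulr0 chain_gt ?ij'//.
  have -> : derive1 (fun=> 0) = (fun t => 0 * trig (odd j.+1) (0%:R * t)) :> (R -> R).
    by apply/funext => t; rewrite derive1_cst mul0r.
  apply: (@tp_le _ _ (`|0| * 1)); first by rewrite normr0 mul0r.
  exact/tp_scale/tp_atom.
case: i ij AE tA => [|i] ij AE tA.
  have -> : chain j.+1 0 = derive1 (chain j 0).
    by apply/funext => t /=; rewrite mul0r addr0.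
  by apply: tp_le tA; rewrite mul0r.
have -> : chain j.+1 i.+1 = fun t => derive1 (chain j i.+1) t + 2^-1 * (chain j i t * sin t).
  by apply/funext => t /=; ring.
apply: tp_le (tp_add tA (tp_scale _ (trigpoly_sin (IH i)))).
rewrite ger0_norm// factS natrM AE; case: eqP => [->|/eqP ij'].
  rewrite mulr0 add0r ler_wpM2r ?ler0n//.
  by apply: le_trans (_ : 1 <= _); [lra|rewrite ler1n].
rewrite -mulrDl ler_wpM2r ?ler0n//.
have : (i.+2 <= j.+1)%N by rewrite ltn_neqAle ij' ij.
by rewrite -(ler_nat R) -natr1; lra.
Qed.

(** The factor dx / dt of the chain rule cancels the kernel dt / dx. *)
Lemma sin_angle x : 0 < x < 1 -> sin (angle 0 x) / 2 * akernel 0 x = 1.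
Proof.
move=> x01; rewrite /angle /akernel !subr0 divr1 sin_acos; last lra.
have -> : 1 - (1 - 2 * x) ^+ 2 = 2 ^+ 2 * ((1 - x) * x) by ring.
rewrite sqrtrM ?exprn_ge0// sqrtr_sqr ger0_norm//.
by field; rewrite sqrtr_eq0 -ltNge mulr_gt0; lra.
Qed.

Lemma abs_cont_eq (U u v : R -> R) : (forall x, 0 < x < 1 -> u x = v x) ->
  abs_cont U u -> abs_cont U v.
Proof.
move=> uv [Lu Uu]; split.
  by apply: L1_eq Lu => // x /=; rewrite in_itv/=; exact: uv.
move=> x x01; rewrite Uu//; congr (_ + _); apply: eq_Rintegral => s /[1!inE]/=.
by rewrite in_itv/= => /andP[s0 sx]; apply: uv; rewrite s0 (lt_le_trans sx)//; case/andP: x01.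
Qed.

Lemma abs_cont_angle T T' : (forall t, is_derive t 1 T (T' t)) -> continuous T' ->
  abs_cont (fun x => T (angle 0 x)) (fun x => T' (angle 0 x) * akernel 0 x).
Proof.
move=> dT cT'.
have cT : continuous T.
  move=> t; apply/differentiable_continuous/derivable1_diffP.
  by case: (dT t).
have ca := angle_continuous (@ltr01 R).
have cTa : {within `[0, 1], continuous (fun x => T (angle 0 x))}.
  by move=> x; apply: continuous_comp; [exact: ca|exact: cT].
have cTa' : {within `[0, 1], continuous (fun x => T' (angle 0 x))}.
  by move=> x; apply: continuous_comp; [exact: ca|exact: cT'].
have L : L1 `]0, 1[ (fun x => T' (angle 0 x) * akernel 0 x).
  apply: (@L1_eq _ _ (fun x => akernel 0 x * T' (angle 0 x))) => //.
    by move=> x _; rewrite mulrC.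
  by apply: L1_mul_continuous => //; exact: L1_akernel.
have dTa x : 0 < x < 1 ->
    is_derive x 1 (fun x => T (angle 0 x)) (T' (angle 0 x) * akernel 0 x).
  by move=> x01; have := is_derive1_comp (dT (angle 0 x)) (is_derive_angle x01).
have cta x : 0 < x < 1 -> {for x, continuous (fun x => T' (angle 0 x) * akernel 0 x)}.
  move=> x01; apply: cvgM; last exact: akernel_continuous.
  apply: (@cvg_comp _ _ _ (angle 0) T' _ (nbhs (angle 0 x))); last exact: cT'.
  apply/differentiable_continuous/derivable1_diffP.
  by case: (is_derive_angle x01).
split=> // x /andP[x0 x1].
by rewrite /primitive (FTC_oo cTa dTa cta L x0 x1) subrKC.
Qed.

(** When each G i.+1 is the derivative of G i, this is the derivative of order j,
    in the angle, of the function G 0. *)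
Definition chainsum (G : nat -> R -> R) j x :=
  \sum_(i < j.+1) chain j i (angle 0 x) * G i x.

Lemma continuous_derive1_chain j i : continuous (derive1 (chain j i)).
Proof.
have [_ tT] := trigpoly_derive1 (chain_trigpoly j i).
have [dT _] := trigpoly_derive1 tT.
move=> t; apply/differentiable_continuous/derivable1_diffP.
by case: (dT t).
Qed.

Lemma abs_cont_chainsum (G : nat -> R -> R) k :
  (forall i, (i < k)%N -> abs_cont (G i) (G i.+1)) ->
  forall j, (j < k)%N ->
  abs_cont (chainsum G j) (fun x => akernel 0 x * chainsum G j.+1 x).
Proof.
move=> acG j jk.
have ac (i : 'I_j.+1) : i \in index_enum 'I_j.+1 ->
  abs_cont (fun x => chain j i (angle 0 x) * G i x)
    (fun x => derive1 (chain j i) (angle 0 x) * akernel 0 x * G i x +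
              G i.+1 x * chain j i (angle 0 x)).
  move=> _; apply: abs_contM.
    apply: abs_cont_angle; last exact: continuous_derive1_chain.
    exact: (trigpoly_derive1 (chain_trigpoly j i)).1.
  by apply: acG; apply: leq_ltn_trans jk; rewrite -ltnS.
apply: abs_cont_eq (abs_cont_sum ac) => x x01; rewrite /chainsum.
rewrite big_split/=.
have s1 := sin_angle x01.
under [in RHS]eq_bigr do rewrite /= mulrDl.
rewrite big_split mulrDr; congr (_ + _).
  rewrite [in RHS]big_ord_recr/= chain_gt// derive1_cst mul0r addr0 big_distrr/=.
  by apply: eq_bigr => i _; ring.
rewrite [in RHS]big_ord_recl/= !mul0r add0r big_distrr/=; apply: eq_bigr => i _.
transitivity (sin (angle 0 x) / 2 * akernel 0 x * (G i.+1 x * chain j i (angle 0 x))).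
  by rewrite s1 mul1r.
by rewrite /bump/= add1n; ring.
Qed.

(** One integration by parts for each j.  The boundary term at 0 is excluded by
    assumption.  At x = 1, that is at the angle pi, one of the two factors
    vanishes: cos ((n + 1/2) pi) if j is even, and otherwise the coefficients
    chain j i, which are sums of sines. *)
Lemma chainsum_parts (G : nat -> R -> R) k n :
  (forall i, (i < k)%N -> abs_cont (G i) (G i.+1)) ->
  (forall j, (j < k)%N -> chainsum G j 0 = 0) ->
  forall j, (j <= k)%N ->
  (n%:R + 2^-1) ^+ j *
  `|\int[mu]_(x in `]0, 1[) (akernel 0 x * chainsum G 0 x *
      sin ((n%:R + 2^-1) * angle 0 x))| =
  `|\int[mu]_(x in `]0, 1[) (akernel 0 x * chainsum G j x *
      trig (~~ odd j) ((n%:R + 2^-1) * angle 0 x))|.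
Proof.
move=> acG G0; set nu := n%:R + 2^-1.
have nu0 : 0 < nu by rewrite /nu; have := ler0n R n; lra.
elim=> [_|j IH jk]; first by rewrite expr0 mul1r.
rewrite exprS -mulrA IH ?(ltnW jk)//.
have acH := abs_cont_chainsum acG jk.
have [s sE s0] : exists2 s : R, s = (-1) ^+ (~~ odd j) * nu & s != 0.
  by exists ((-1) ^+ (~~ odd j) * nu); rewrite ?mulf_neq0 ?signr_eq0 ?gt_eqF.
have acV : abs_cont (fun x => trig (odd j) (nu * angle 0 x))
    (fun x => s * trig (~~ odd j) (nu * angle 0 x) * akernel 0 x).
  apply: (@abs_cont_angle (fun t => trig (odd j) (nu * t))
            (fun t => s * trig (~~ odd j) (nu * t))).
    by move=> t; rewrite sE; exact: is_derive_trig.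
  by move=> t; apply: cvgM; [exact: cvg_cst|exact: continuous_trigM].
have := abs_cont_Rintegral (abs_contM acH acV).
rewrite G0// mul0r subr0 angle1//.
have -> : chainsum G j 1 * trig (odd j) (nu * pi) = 0.
  case oj : (odd j); last first.
    rewrite /trig /nu mulrDl cosD.
    by rewrite mulrC [2^-1 * pi]mulrC cos_pihalf sin_natpi mul0r mulr0 subr0 mul0r.
  rewrite /chainsum big1 ?mul0r// => i _.
  have := chain_trigpoly j i; rewrite oj angle1// => /trigpoly_sin_pi ->.
  by rewrite mul0r.
have L1a := acH.1; have L1b := acV.1.
rewrite RintegralD//; last 2 first.
- by apply: L1_mul_continuous => //; exact: abs_cont_continuous acV.
- by apply: L1_mul_continuous => //; exact: abs_cont_continuous acH.
move=> /eqP; rewrite addr_eq0 => /eqP E.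
have -> : trig (~~ odd j.+1) = trig (odd j) by rewrite /= negbK.
rewrite E normrN.
have -> : \int[mu]_(x in `]0, 1[)
    (s * trig (~~ odd j) (nu * angle 0 x) * akernel 0 x * chainsum G j x) =
    s * \int[mu]_(x in `]0, 1[)
    (akernel 0 x * chainsum G j x * trig (~~ odd j) (nu * angle 0 x)).
  rewrite -RintegralZl//; first by apply: eq_Rintegral => x _; ring.
  have LH := L1_mul_continuous L1b (abs_cont_continuous acH).
  apply: L1_eq (L1Z s^-1 (measurable_itv _) LH) => // x _.
  by rewrite /= -!mulrA mulKf//; ring.
by rewrite normrM sE normrM normrX normrN1 expr1n mul1r (gtr0_norm nu0).
Qed.

End trigpoly.

(** * Smooth bump functions *)

Section bump.
Context {R : realType}.
Notation mu := (@lebesgue_measure R).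
Implicit Types (x y a b : R) (f g : R -> R) (p q : {poly R}).

(** The functions p (1 / x) * exp (- 1 / x), extended by 0, form a class closed
    under differentiation, which makes their smoothness a formality. *)
Definition flat p x : R := if 0 < x then p.[x^-1] * expR (- x^-1) else 0.

Lemma horner_le_expR p : exists2 C, 0 <= C & forall y, 0 <= y -> `|p.[y]| <= C * expR y.
Proof.
exists (\sum_(i < size p) `|p`_i| * i`!%:R).
  by apply: sumr_ge0 => i _; rewrite mulr_ge0.
move=> y y0; rewrite horner_coef (le_trans (ler_norm_sum _ _ _))// big_distrl/=.
apply: ler_sum => i _; rewrite normrM -mulrA ler_wpM2l//.
rewrite ger0_norm ?exprn_ge0// mulrC -ler_pdivrMr ?ltr0n ?fact_gt0//.
case: (nat_of_ord i) => [|n].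
  by rewrite expr0 fact0 divr1 -expR0 ler_expR.
by apply: le_trans (expR_ge1Dxn n y0); rewrite lerDr.
Qed.

Lemma flat_le p : exists2 C, 0 <= C & forall x, `|flat p x| <= C * `|x|.
Proof.
have [C C0 pC] := horner_le_expR (p * 'X).
exists C => // x; rewrite /flat; case: ifPn => x0; last first.
  by rewrite normr0 mulr_ge0.
have xV0 : 0 < x^-1 by rewrite invr_gt0.
rewrite normrM (ger0_norm (expR_ge0 _)) expRN (gtr0_norm x0).
rewrite ler_pdivrMr ?expR_gt0// mulrAC -ler_pdivrMr//.
have := pC _ (ltW xV0); rewrite hornerM hornerX normrM (gtr0_norm xV0).
by apply.
Qed.

Lemma flat_cvg0 p : flat p x @[x --> (0 : R)] --> (0 : R).
Proof.
have [C C0 fC] := flat_le p; apply/cvgr0Pnorm_le => e e0.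
have C1 : 0 < C + 1 by lra.
have eC : 0 < e / (C + 1) by rewrite divr_gt0.
near=> z; apply: le_trans (fC z) _.
apply: (@le_trans _ _ ((C + 1) * `|z|)); first by rewrite ler_wpM2r// lerDl.
rewrite mulrC -ler_pdivlMr//; near: z; exact: nbhs0_le.
Unshelve. all: by end_near. Qed.

(** At 0 the difference quotient is again a function of the class, with X p in
    place of p, and [flat_cvg0] says that it is continuous there. *)
Lemma flat_is_derive p x : is_derive x 1 (flat p) (flat ('X^2 * (p - p^`())) x).
Proof.
have [x0|x0|->] := ltrgtP x 0.
- have -> : flat ('X^2 * (p - p^`())) x = 0 by rewrite /flat ltNge (ltW x0).
  apply: (@near_eq_is_derive _ _ _ (fun=> 0)) => //.
  near=> z; rewrite /flat ltNge (_ : z <= 0)// ltW//.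
  by near: z; exact: lt_nbhsl.
- have -> : flat ('X^2 * (p - p^`())) x =
     - (x ^- 2) * p^`().[x^-1] * expR (- x^-1) + p.[x^-1] * (x ^- 2 * expR (- x^-1)).
    rewrite /flat x0 hornerM hornerXn hornerD hornerN exprVn; ring.
  apply: (@near_eq_is_derive R R R (fun z => p.[z^-1] * expR (- z^-1))).
    near=> z; rewrite /flat (_ : 0 < z)//.
    by near: z; apply: lt_nbhsr.
  have dV : is_derive x 1 (fun z : R => z^-1) (- x ^- 2).
    have := @is_deriveV R id x 1 1 _ (is_derive_id _ _).
    by rewrite /GRing.scale/= mulr1; apply; rewrite gt_eqF.
  have dN : is_derive x 1 (fun z : R => - z^-1) (x ^- 2).
    by have := is_deriveN dV; rewrite opprK.
  have dp := @is_derive1_comp R (horner p) (fun z => z^-1) x _ _ (is_derive_poly p _) dV.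
  have de := @is_derive1_comp R expR (fun z => - z^-1) x _ _ (is_derive_expR _) dN.
  apply: is_deriveW (is_deriveM dp de) _.
  by rewrite /GRing.scale/=; ring.
apply/is_derive1_caratheodory; exists (flat (p * 'X)); split.
- move=> z; rewrite subr0 /flat ltxx subr0; case: ifPn => z0; last by rewrite mul0r.
  by rewrite hornerM hornerX; field; rewrite gt_eqF.
- have := @flat_cvg0 (p * 'X).
  by rewrite -[X in _ --> X](_ : flat (p * 'X) 0 = 0)// /flat ltxx.
- by rewrite /flat ltxx.
Unshelve. all: by end_near. Qed.

Definition smooth f := forall n x, derivable (derive1n n f) x 1.

Lemma derive1nSr n f : derive1n n.+1 f = derive1n n (derive1 f).
Proof. by rewrite /derive1n iterSr. Qed.

(** A class of functions each of which has a derivative in the class consists of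
    smooth functions. *)
Lemma smooth_coind (C : (R -> R) -> Prop) :
  (forall f, C f -> exists2 f', (forall x, is_derive x 1 f (f' x)) & C f') ->
  forall f, C f -> smooth f.
Proof.
move=> CC f Cf n; elim: n f Cf => [|n IH] f Cf x.
  by have [f' df _] := CC _ Cf; case: (df x).
rewrite derive1nSr; apply: IH; have [f' df Cf'] := CC _ Cf.
rewrite (_ : derive1 f = f')//; apply/funext => z; rewrite derive1E.
by case: (df z).
Qed.

Inductive flat_algebra : (R -> R) -> Prop :=
| fa_left p a : flat_algebra (fun x => flat p (x - a))
| fa_right p b : flat_algebra (fun x => flat p (b - x))
| fa_cst c : flat_algebra (fun=> c)
| fa_add f g of flat_algebra f & flat_algebra g : flat_algebra (fun x => f x + g x)
| fa_mul f g of flat_algebra f & flat_algebra g : flat_algebra (fun x => f x * g x).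

Lemma flat_algebra_smooth f : flat_algebra f -> smooth f.
Proof.
apply: smooth_coind => {}f; elim=> {f} [p a|p b|c|f g _ [f' df Cf] _ [g' dg Cg]
    |f g Af [f' df Cf] Ag [g' dg Cg]].
- exists (fun x => flat ('X^2 * (p - p^`())) (x - a)); last exact: fa_left.
  move=> x; have d : is_derive x 1 (fun x => x - a) (1 : R).
    by have := is_deriveB (is_derive_id x (1 : R)) (is_derive_cst a x 1); rewrite subr0.
  have := @is_derive1_comp R (flat p) (fun x => x - a) x _ _ (flat_is_derive p _) d.
  by rewrite mulr1.
- exists (fun x => (-1) * flat ('X^2 * (p - p^`())) (b - x)); last first.
    by apply: fa_mul; [exact: fa_cst|exact: fa_right].
  move=> x; have d : is_derive x 1 (fun x => b - x) (- 1 : R).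
    by have := is_deriveB (is_derive_cst b x 1) (is_derive_id x (1 : R)); rewrite sub0r.
  have := @is_derive1_comp R (flat p) (fun x => b - x) x _ _ (flat_is_derive p _) d.
  by rewrite mulrC.
- by exists (fun=> 0) => [x|]; [exact: is_derive_cst|exact: fa_cst].
- exists (fun x => f' x + g' x); last exact: fa_add.
  by move=> x; exact: (is_deriveD (df x) (dg x)).
- exists (fun x => f x * g' x + g x * f' x); last by apply: fa_add; apply: fa_mul.
  by move=> x; exact: (is_deriveM (df x) (dg x)).
Qed.

Definition smooth_bump a b x := flat 1 (x - a) * flat 1 (b - x).

Lemma bump_gt0 a b x : a < x < b -> 0 < smooth_bump a b x < 1.
Proof.
move=> /andP[ax xb].
rewrite /smooth_bump /flat !subr_gt0 ax xb !hornerC !mul1r mulr_gt0 ?expR_gt0//=.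
by rewrite mulr_ilt1 ?expR_ge0 ?expR_lt1 ?oppr_lt0 ?invr_gt0 ?subr_gt0.
Qed.

Lemma bump_eq0 a b x : ~~ (a < x < b) -> smooth_bump a b x = 0.
Proof.
by rewrite /smooth_bump /flat !subr_gt0 negb_and => /orP[] /negbTE ->; rewrite ?mul0r ?mulr0.
Qed.

(** These increase to the indicator of the interval: the function
    1 - smooth_bump is 1 outside the interval and lies strictly between 0 and 1
    inside it. *)
Definition plateau a b n x := 1 - (1 - smooth_bump a b x) ^+ n.

Lemma plateau_smooth a b n : smooth (plateau a b n).
Proof.
apply: flat_algebra_smooth.
have pow f : flat_algebra f -> flat_algebra (fun x => f x ^+ n).
  move=> Af; elim: n => [|n IH]; first exact: (fa_cst 1).
  by under eq_fun do rewrite exprS; exact: fa_mul.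
have sub1 f : flat_algebra f -> flat_algebra (fun x => 1 - f x).
  move=> Af; under eq_fun do rewrite -mulN1r.
  by apply: fa_add; [exact: fa_cst|apply: fa_mul => //; exact: fa_cst].
apply: (sub1 (fun x => (1 - smooth_bump a b x) ^+ n)).
apply: (pow (fun x => 1 - smooth_bump a b x)); apply: sub1.
by apply: fa_mul; [exact: fa_left|exact: fa_right].
Qed.

Lemma plateau_eq0 a b n x : ~~ (a < x < b) -> plateau a b n x = 0.
Proof. by move=> /bump_eq0 B0; rewrite /plateau B0 subr0 expr1n subrr. Qed.

Lemma plateau_ge0_le1 a b n x : 0 <= plateau a b n x <= 1.
Proof.
have [ab|ab] := boolP (a < x < b); last by rewrite plateau_eq0// lexx ler01.
have /andP[B0 B1] := bump_gt0 ab.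
rewrite /plateau.
have y0 : 0 <= (1 - smooth_bump a b x) ^+ n by apply: exprn_ge0; lra.
have y1 : (1 - smooth_bump a b x) ^+ n <= 1 by apply: exprn_ile1; lra.
lra.
Qed.

Lemma plateau_cvg a b x : a < x < b -> plateau a b n x @[n --> \oo] --> (1 : R).
Proof.
move=> ab; have /andP[B0 B1] := bump_gt0 ab.
rewrite -[X in _ --> X]subr0; apply: cvgB; first exact: cvg_cst.
by apply: cvg_expr; rewrite ger0_norm ?subr_ge0 ?ltW// gtrBl.
Qed.

(** The support lies in an interval, and not merely in a compact set: an
    antiderivative of a bump function of integral 0 is then again a bump function,
    with the same interval. *)
Definition bump_function f := smooth f /\
  exists a b, [/\ 0 < a, a < b, b < 1 & forall x, ~~ (a < x < b) -> f x = 0].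

Lemma bump_function_test f : bump_function f -> test_function f.
Proof.
move=> [sf [a [b [a0 ab b1 f0]]]]; split=> //; exists `[a, b]%classic; split.
- exact: segment_compact.
- move=> x /=; rewrite !in_itv/= => /andP[ax xb].
  by rewrite (lt_le_trans a0 ax) (le_lt_trans xb b1).
- move=> x /= xab; apply: f0; apply/negP => /andP[ax xb]; apply: xab.
  by rewrite in_itv/= !ltW.
Qed.

Lemma plateau_bump a b n : 0 < a -> a < b -> b < 1 -> bump_function (plateau a b n).
Proof.
move=> a0 ab b1; split; first exact: plateau_smooth.
by exists a, b; split=> // x; exact: plateau_eq0.
Qed.

End bump.

(** * Weak derivatives are iterated antiderivatives *)

Section weak.
Context {R : realType}.
Notation mu := (@lebesgue_measure R).
Implicit Types (x y a b : R) (u v z f g phi psi : R -> R).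

Lemma Rintegral_dominated (D : set (measurableTypeR R)) (f_ : nat -> R -> R) f g :
  measurable D -> (forall n, measurable_fun D (f_ n)) -> measurable_fun D f ->
  {ae mu, forall x, D x -> f_ n x @[n --> \oo] --> f x} ->
  {ae mu, forall x n, D x -> `|f_ n x| <= g x} -> L1 D g ->
  L1 D f /\
  \int[mu]_(x in D) f_ n x @[n --> \oo] --> \int[mu]_(x in D) f x.
Proof.
move=> mD mf_ mf cf fg Lg.
have FF := ae_filter_ringOfSetsType mu.
have [] := @dominated_convergence _ _ _ mu D mD (fun n => EFin \o f_ n) (EFin \o f)
  (EFin \o g) _ _ _ Lg _.
- by move=> n; exact: measurable_fun_EFin.
- exact: measurable_fun_EFin.
- apply: filterS cf => x cfx Dx; apply: cvg_EFin; first exact: nearW.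
  exact: cfx.
- by apply: filterS fg => x fgx n Dx; rewrite lee_fin fgx.
move=> Lf _ cI; split=> //.
by apply: fine_cvg; rewrite EFin_Rintegral.
Qed.

(** The indefinite integral of z is constant, and its derivative is z almost
    everywhere by Lebesgue's differentiation theorem. *)
Lemma ae_eq0_of_Rintegral z : L1 `]0, 1[ z ->
  (forall a b, 0 < a -> a < b -> b < 1 -> \int[mu]_(x in `]a, b[) z x = 0) ->
  {ae mu, forall x, I01 R x -> z x = 0}.
Proof.
move=> Lz z0; pose z' := z \_ `]0, 1[.
have Lz'T : L1 setT z'.
  rewrite /L1 /z' -restrict_EFin.
  by apply/integrable_restrict => //=; rewrite setTI.
have Lz' (i : interval R) : L1 [set` i] z'.
  apply: (@L1S _ setT) => //; exact: measurable_itv.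
have li : locally_integrable [set: R] z'.
  by apply: open_integrable_locally => //; exact: openT.
have FF := ae_filter_ringOfSetsType mu.
have := @FTC1 R z' (BRight 0) (fun y => Lz' _) li.
apply: filterS => x /= dF; rewrite in_itv/= => /andP[x0 x1].
have [|_] := dF; first by rewrite ?bnd_simp ?x0.
rewrite /z' patchE mem_set/= ?in_itv/= ?x0// => <-.
have Fcst y : 0 < y < 1 -> \int[mu]_(t in `]0, y]) z' t =
    \int[mu]_(t in `]0, x]) z' t.
  have E w : 0 < w < 1 -> \int[mu]_(t in `]0, w]) z' t = \int[mu]_(t in `]0, w[) z t.
    move=> /andP[w0 w1]; rewrite -(@Rintegral_itv_oo _ _ _ false false).
      apply: eq_Rintegral => t /[1!inE]/=; rewrite in_itv/= => /andP[t0 tw].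
      by rewrite /z' patchE mem_set//= in_itv/= t0 (le_lt_trans tw w1).
    exact: (L1_sub_oo (lexx _) (ltW w1) Lz).
  move=> y01; rewrite !E ?x0//; have /andP[y0 y1] := y01.
  have [xy|yx|->//] := ltgtP x y.
    rewrite (@Rintegral_oo_split _ 0 y x) ?(ltW x0) ?(ltW xy)//.
      by rewrite (z0 x y)// addr0.
    exact: (L1_sub_oo (lexx _) (ltW y1) Lz).
  rewrite (@Rintegral_oo_split _ 0 x y) ?(ltW y0) ?(ltW yx)//.
    by rewrite (z0 y x)// addr0.
  exact: (L1_sub_oo (lexx _) (ltW x1) Lz).
rewrite derive1E.
have [_ ->//] : is_derive x 1 (fun y => \int[mu]_(t in `]0, y]) z' t) (0 : R).
apply: (@near_eq_is_derive R R R (fun=> \int[mu]_(t in `]0, x]) z' t)).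
  near=> y; rewrite Fcst//; apply/andP; split; near: y.
    exact: lt_nbhsr.
  exact: lt_nbhsl.
Unshelve. all: by end_near. Qed.

Lemma smooth_is_derive f x : smooth f -> is_derive x 1 f (derive1 f x).
Proof. by move=> /(_ 0%N x) df; apply: DeriveDef => //; rewrite derive1E. Qed.

Lemma smooth_continuous n f : smooth f -> continuous (derive1n n f).
Proof.
by move=> sf x; apply/differentiable_continuous/derivable1_diffP; exact: sf.
Qed.

Lemma smooth_continuous0 f : smooth f -> continuous f.
Proof. exact: (@smooth_continuous 0%N). Qed.

Lemma L1_mul_smooth n u f : L1 `]0, 1[ u -> smooth f ->
  L1 `]0, 1[ (fun x => u x * derive1n n f x).
Proof.
move=> Lu sf; apply: L1_mul_continuous => //.
exact/continuous_subspaceT/smooth_continuous.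
Qed.

(** Plateau functions increase to the indicators of intervals, so z has integral
    zero over every interval. *)
Lemma fundamental_lemma z : L1 `]0, 1[ z ->
  (forall phi, bump_function phi -> \int[mu]_(x in `]0, 1[) (z x * phi x) = 0) ->
  {ae mu, forall x, I01 R x -> z x = 0}.
Proof.
move=> Lz z0; apply: ae_eq0_of_Rintegral => // a b a0 ab b1.
have sub : `]a, b[ `<=` `]0, 1[.
  move=> x /=; rewrite !in_itv/= => /andP[ax xb].
  by rewrite (lt_trans a0 ax) (lt_trans xb b1).
have mz := L1_measurable Lz.
have mab : measurable (`]a, b[%classic : set R) by exact: measurable_itv.
have [|||||_] := @Rintegral_dominated `]0, 1[ (fun n x => z x * plateau a b n x)
  (z \_ `]a, b[) (fun x => `|z x|) _ _ _ _ _ (L1_norm Lz).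
- by [].
- move=> n; apply: measurable_funM => //; apply: measurable_funTS.
  apply: continuous_measurable_fun; apply: smooth_continuous0; exact: plateau_smooth.
- apply/measurable_restrict => //; apply: measurable_funS mz => //.
- apply: aeW => x _; rewrite patchE; case: ifPn => [|] xab.
    rewrite -[X in _ --> X]mulr1; apply: cvgM; first exact: cvg_cst.
    by apply: plateau_cvg; rewrite inE/= in_itv/= in xab.
  rewrite (_ : (fun n => _) = fun=> 0); first exact: cvg_cst.
  apply/funext => n; rewrite plateau_eq0 ?mulr0//.
  by apply: contra xab => xab; rewrite inE/= in_itv/=.
- apply: aeW => x n _; rewrite normrM ler_piMr//.
  by have /andP[p0 p1] := plateau_ge0_le1 a b n x; rewrite ger0_norm.
rewrite -Rintegral_mkcondr setIidr//.
have -> : (fun n => \int[mu]_(x in `]0, 1[) (z x * plateau a b n x)) = fun=> 0.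
  by apply/funext => n; apply: z0; exact: plateau_bump.
move=> c; have c0 : (fun=> 0 : R) n @[n --> \oo] --> (0 : R) by exact: cvg_cst.
exact: (cvg_unique _ c c0).
Qed.

(** Bump functions suffice to determine a weak derivative almost everywhere;
    integrability is kept as a separate hypothesis. *)
Definition weakd j u v := forall phi, bump_function phi ->
  \int[mu]_(x in `]0, 1[) (u x * derive1n j phi x) =
  (-1) ^+ j * \int[mu]_(x in `]0, 1[) (v x * phi x).

Lemma weakd_unique j u v w : L1 `]0, 1[ v -> L1 `]0, 1[ w -> weakd j u v ->
  weakd j u w -> {ae mu, forall x, I01 R x -> v x = w x}.
Proof.
move=> Lv Lw uv uw; have FF := ae_filter_ringOfSetsType mu.
have : {ae mu, forall x, I01 R x -> v x - w x = 0}.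
  apply: fundamental_lemma; first exact: L1B.
  move=> phi bphi; have sphi := bphi.1.
  under eq_Rintegral do rewrite mulrBl.
  rewrite RintegralB//; try exact: (@L1_mul_smooth 0%N).
  apply/eqP; rewrite subr_eq0; apply/eqP.
  apply: (mulfI (_ : (-1) ^+ j != 0 :> R)); first by rewrite signr_eq0.
  by rewrite -uv// -uw.
by apply: filterS => x /[apply] /eqP; rewrite subr_eq0 => /eqP.
Qed.

Lemma derive1n_lin n f g c : smooth f -> smooth g ->
  derive1n n (fun x => f x + c * g x) = fun x => derive1n n f x + c * derive1n n g x.
Proof.
move=> sf sg; elim: n => [//|n IH]; rewrite !derive1nS IH.
apply/funext => x; rewrite derive1E.
have dfn : is_derive x 1 (derive1n n f) (derive1 (derive1n n f) x).
  by apply: DeriveDef; [exact: sf|rewrite derive1E].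
have dgn : is_derive x 1 (derive1n n g) (derive1 (derive1n n g) x).
  by apply: DeriveDef; [exact: sg|rewrite derive1E].
by have [_ ->] := is_deriveD dfn (is_deriveZ c dgn).
Qed.

Lemma smooth_lin f g c : smooth f -> smooth g -> smooth (fun x => f x + c * g x).
Proof.
move=> sf sg n x; rewrite derive1n_lin//.
by apply: derivableD; [exact: sf|apply: derivableZ; exact: sg].
Qed.

Lemma bump_function_lin f g c : bump_function f -> bump_function g ->
  bump_function (fun x => f x + c * g x).
Proof.
move=> [sf [a [b [a0 ab b1 f0]]]] [sg [a' [b' [a'0 ab' b'1 g0]]]].
split; first exact: smooth_lin.
exists (Num.min a a'), (Num.max b b'); split.
- by rewrite lt_min a0 a'0.
- by rewrite lt_max gt_min ab.
- by rewrite gt_max b1 b'1.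
- move=> x; rewrite gt_min lt_max => xab; rewrite f0 ?g0 ?mulr0 ?addr0//.
    by apply: contra xab => /andP[-> ->]; rewrite ?orbT.
  by apply: contra xab => /andP[-> ->]; rewrite ?orbT.
Qed.

Lemma smooth_abs_cont f : smooth f -> abs_cont f (derive1 f).
Proof.
move=> sf; have Lf : L1 `]0, 1[ (derive1 f).
  apply: L1_within_continuous; apply: continuous_subspaceT.
  exact: (@smooth_continuous 1%N).
split=> // x /andP[x0 x1].
have cf : {within `[0, 1], continuous f}.
  by apply: continuous_subspaceT; exact: (@smooth_continuous 0%N).
have df y : 0 < y < 1 -> is_derive y 1 f (derive1 f y).
  by move=> _; exact: smooth_is_derive.
have cdf y : 0 < y < 1 -> {for y, continuous (derive1 f)}.
  by move=> _; exact: (@smooth_continuous 1%N).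
by rewrite /primitive (FTC_oo cf df cdf Lf x0 x1) subrKC.
Qed.

Lemma bump_function0 f : bump_function f -> f 0 = 0.
Proof. by move=> [_ [a [b [a0 ab b1 ->]]]]//; rewrite ltNge (ltW a0). Qed.

Lemma bump_function1 f : bump_function f -> f 1 = 0.
Proof.
by move=> [_ [a [b [a0 ab b1 ->]]]]//; rewrite negb_and -!leNgt (ltW b1) orbT.
Qed.

Lemma bump_antiderivative psi : bump_function psi ->
  \int[mu]_(x in `]0, 1[) psi x = 0 ->
  exists2 eta, bump_function eta & derive1 eta = psi.
Proof.
move=> [spsi [a [b [a0 ab b1 psi0]]]] Ipsi.
have cpsi : continuous psi by exact: (@smooth_continuous 0%N).
have L01 : L1 `]0, 1[ psi by apply: L1_within_continuous; exact: continuous_subspaceT.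
have psiE : psi = psi \_ `]0, 1[.
  apply/funext => x; rewrite patchE; case: ifPn => //.
  rewrite notin_setE/= in_itv/= => /negP x01.
  apply: psi0; apply: contra x01 => /andP[ax xb].
  by rewrite (lt_trans a0 ax) (lt_trans xb b1).
have LT : L1 setT psi.
  rewrite psiE /L1 -restrict_EFin.
  by apply/integrable_restrict => //=; rewrite setTI.
have Li (i : interval R) : L1 [set` i] psi.
  apply: (@L1S _ setT) => //; exact: measurable_itv.
pose eta x := \int[mu]_(t in `]-oo, x]) psi t.
have deta x : is_derive x 1 eta (psi x).
  have xx : x < x + 1 by rewrite ltrDl.
  have [] := @continuous_FTC1 R psi (BInfty _ true) x (x + 1) xx (Li _) (ltNyr _) (cpsi x).
  by move=> d1 d2; split; [exact: d1|rewrite -derive1E; exact: d2].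
have d1 : derive1 eta = psi.
  by apply/funext => x; rewrite derive1E; case: (deta x).
exists eta; last exact: d1.
split.
  move=> [|n] x; first by case: (deta x).
  by rewrite derive1nSr d1; exact: spsi.
exists a, b; split=> // x; rewrite negb_and -!leNgt => /orP[xa|bx].
  rewrite /eta (_ : \int[mu]_(t in _) _ = \int[mu]_(t in `]-oo, x]) 0).
    by rewrite Rintegral_cst ?mul0r//; exact: measurable_itv.
  apply: eq_Rintegral => t /[1!inE]/=; rewrite in_itv/= => tx.
  by apply: psi0; rewrite negb_and -!leNgt (le_trans tx xa).
rewrite /eta -[RHS]Ipsi [in RHS](Rintegral_mkcond) -psiE.
rewrite [in LHS]Rintegral_mkcond; apply: eq_Rintegral => t _.
rewrite patchE; case: ifPn => //; rewrite notin_setE/= in_itv/= => /negP.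
rewrite -ltNge => xt; apply/esym/psi0.
by rewrite negb_and -!leNgt (le_trans bx (ltW xt)) orbT.
Qed.

(** If every bump function had integral zero, the fundamental lemma would make
    the constant function 1 vanish almost everywhere. *)
Lemma bump_integral1 : exists2 theta, bump_function theta &
  \int[mu]_(x in `]0, 1[) theta x = 1.
Proof.
have [[theta bt it]|nt] := pselect (exists2 theta, bump_function theta &
    \int[mu]_(x in `]0, 1[) theta x != 0).
  pose c := \int[mu]_(x in `]0, 1[) theta x.
  exists (fun x => theta x + (c^-1 - 1) * theta x); first exact: bump_function_lin.
  have Lt : L1 `]0, 1[ theta.
    apply: L1_within_continuous; apply: continuous_subspaceT.
    exact: (@smooth_continuous 0%N _ bt.1).
  rewrite RintegralD//; last exact: L1Z.
  by rewrite RintegralZl// -/c; field.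
have : {ae mu, forall x, I01 R x -> (1 : R) = 0}.
  apply: (@fundamental_lemma (fun=> 1)); first exact: L1_cst.
  move=> phi bphi; apply: contrapT => /eqP i0; apply: nt; exists phi => //.
  by under eq_Rintegral do rewrite -[phi _]mul1r.
move=> [N [mN N0 sN]].
have : (mu `]0%R, 1%R[%classic <= mu N)%E.
  apply: le_measure; rewrite ?inE; [exact: measurable_itv|exact: mN|].
  by move=> x x01; apply: sN => /(_ x01) /eqP; rewrite oner_eq0.
by rewrite N0 lebesgue_measure_itv/= lte_fin ltr01 -EFinB subr0 lee_fin ler10.
Qed.

(** The du Bois-Reymond lemma.  Fix a bump function theta of integral 1; for any
    phi, the function phi - (int phi) theta is the derivative of a bump function
    eta, against which the hypothesis is tested.  The contribution of theta
    becomes the constant C. *)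
Lemma weakd_step j u v : L1 `]0, 1[ u -> L1 `]0, 1[ v -> weakd j.+1 u v ->
  exists C, weakd j u (fun x => C + primitive v x).
Proof.
move=> Lu Lv uv; have [theta bt it] := bump_integral1.
have acP : abs_cont (primitive v) v.
  by have := abs_cont_primitive 0 Lv; under eq_fun do rewrite add0r.
have LP : L1 `]0, 1[ (primitive v) := L1_within_continuous (abs_cont_continuous acP).
pose A := \int[mu]_(x in `]0, 1[) (u x * derive1n j theta x).
pose B := \int[mu]_(x in `]0, 1[) (primitive v x * theta x).
exists ((-1) ^+ j * A - B) => phi bphi.
have Lphi : L1 `]0, 1[ phi.
  apply: L1_within_continuous; apply: continuous_subspaceT.
  exact: (@smooth_continuous 0%N _ bphi.1).
have Lt : L1 `]0, 1[ theta.
  apply: L1_within_continuous; apply: continuous_subspaceT.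
  exact: (@smooth_continuous 0%N _ bt.1).
pose m := \int[mu]_(x in `]0, 1[) phi x.
have bpsi : bump_function (fun x => phi x + (- m) * theta x).
  exact: bump_function_lin.
have [|eta beta deta] := bump_antiderivative bpsi.
  by rewrite RintegralD//; [rewrite RintegralZl// it -/m; ring|exact: L1Z].
have LuD n f : smooth f -> L1 `]0, 1[ (fun x => u x * derive1n n f x).
  exact: L1_mul_smooth.
have LPs f : smooth f -> L1 `]0, 1[ (fun x => primitive v x * f x).
  exact: (@L1_mul_smooth 0%N).
have := uv eta beta.
rewrite derive1nSr deta (derive1n_lin _ _ bphi.1 bt.1).
under eq_Rintegral do rewrite mulrDr mulrCA.
rewrite RintegralD//; last 2 first.
- by apply: LuD; exact: bphi.1.
- by apply: L1Z => //; apply: LuD; exact: bt.1.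
rewrite RintegralZl//; last by apply: LuD; exact: bt.1.
rewrite -/A.
have := abs_cont_Rintegral (abs_contM acP (smooth_abs_cont beta.1)).
rewrite (bump_function0 beta) (bump_function1 beta) !mulr0 subrr.
rewrite RintegralD//; last 2 first.
- by apply: (@L1_mul_smooth 0%N) => //; exact: beta.1.
- by apply: L1_eq (LPs _ bpsi.1) => // x _; rewrite deta mulrC.
rewrite deta => /eqP; rewrite addr_eq0 => /eqP ->.
under [X in _ * - X]eq_Rintegral do rewrite mulrC mulrDr mulrCA.
rewrite RintegralD//; last 2 first.
- by apply: LPs; exact: bphi.1.
- by apply: L1Z => //; apply: LPs; exact: bt.1.
rewrite RintegralZl//; last by apply: LPs; exact: bt.1.
rewrite -/B.
under [in X in _ -> _ = X]eq_Rintegral do rewrite mulrDl.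
rewrite [in X in _ -> _ = X]RintegralD//; last 2 first.
- exact: L1Z.
- by apply: LPs; exact: bphi.1.
rewrite RintegralZl// -/m.
have n1 : (-1) ^+ j * (-1) ^+ j = 1 :> R by rewrite -expr2 sqrr_sign.
move=> /(canRL (addrK _)) ->.
rewrite exprS; transitivity ((-1) ^+ j * (-1) ^+ j * A * m + (-1) ^+ j *
  (\int[mu]_(x in `]0, 1[) (primitive v x * phi x) - m * B)); last by ring.
by rewrite n1; ring.
Qed.

(** Each step down from w replaces a weak derivative by a primitive with a
    suitable constant; G 0 is then almost everywhere equal to u, by uniqueness of
    the weak derivative of order 0. *)
Lemma weakd_antiderivatives k u w : L1 `]0, 1[ u -> L1 `]0, 1[ w -> weakd k u w ->
  exists G : nat -> R -> R, [/\ G k = w,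
    forall i, (i < k)%N -> exists C, G i = (fun x => C + primitive (G i.+1) x),
    forall j, (j <= k)%N -> L1 `]0, 1[ (G j) &
    forall j, (j <= k)%N -> weakd j u (G j)].
Proof.
move=> Lu; elim: k w => [|k IH] w Lw uw.
  by exists (fun=> w); split=> // j; rewrite leqn0 => /eqP ->.
have [C uC] := weakd_step Lu Lw uw.
have LC : L1 `]0, 1[ (fun x => C + primitive w x).
  exact: (L1_within_continuous (abs_cont_continuous (abs_cont_primitive C Lw))).
have [G [Gk Gi LG uG]] := IH _ LC uC.
exists (fun j => if (j <= k)%N then G j else w); split.
- by rewrite /= ltnn.
- move=> i ik1; have [ik|ki|ik] := ltngtP i k.
  + by rewrite /= ?(ltnW ik) ?ik; exact: Gi.
  + by move: ik1; rewrite ltnS leqNgt ki.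
  + by exists C; rewrite /= ?ik ?leqnn ?ltnn Gk.
- by move=> j jk /=; case: ifP => // jk'; exact: LG.
- move=> j /=; case: ifP => [jk _|]; first exact: uG.
  move=> /negbT; rewrite -ltnNge => kj jk.
  by have -> : j = k.+1 by apply/eqP; rewrite eqn_leq jk kj.
Qed.

End weak.

(** * Uniqueness of moments and almost everywhere convergence *)

Section completeness.
Context {R : realType}.
Notation mu := (@lebesgue_measure R).
Implicit Types (x y a b : R) (f g h : R -> R) (p q : {poly R}).

Lemma bernoulli_ge (t : R) m : -1 <= t -> 1 + m%:R * t <= (1 + t) ^+ m.
Proof.
move=> t1; elim: m => [|m IH]; first by rewrite mul0r addr0 expr0.
rewrite exprS; apply: (@le_trans _ _ ((1 + t) * (1 + m%:R * t))).
  rewrite -natr1; have := ler0n R m; have := sqr_ge0 t; nra.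
by rewrite ler_wpM2l//; lra.
Qed.

(** The polynomials of the elementary proof of the Stone-Weierstrass theorem:
    with q = (1 + s - a) / 2, the value (1 - q^n)^(2^n) tends to 1 if 2 q < 1 and
    to 0 if 2 q > 1, by Bernoulli's inequality, so the sequence approaches the
    step function that drops from 1 to 0 at a. *)
Definition cutoff a n : {poly R} :=
  (1 - (2^-1 *: (1 + 'X - a%:P)) ^+ n) ^+ (2 ^ n).

Lemma cutoffE a n s : (cutoff a n).[s] = (1 - ((1 + s - a) / 2) ^+ n) ^+ (2 ^ n).
Proof.
by rewrite /cutoff horner_exp hornerD hornerN horner_exp hornerZ !hornerE mulrC.
Qed.

Lemma cutoff_itv a n s : 0 < a < 1 -> 0 < s < 1 -> 0 <= (cutoff a n).[s] <= 1.
Proof.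
move=> a01 s01; rewrite cutoffE.
have q0 : 0 <= ((1 + s - a) / 2) ^+ n by apply: exprn_ge0; lra.
have q1 : ((1 + s - a) / 2) ^+ n <= 1 by apply: exprn_ile1; lra.
by apply/andP; split; [apply: exprn_ge0|apply: exprn_ile1]; lra.
Qed.

Lemma cutoff_cvg1 a s : 0 < a < 1 -> 0 < s < 1 -> s < a ->
  (cutoff a n).[s] @[n --> \oo] --> (1 : R).
Proof.
move=> a01 s01 sa; set q := (1 + s - a) / 2.
have q01 : 0 < 2 * q < 1 by rewrite /q; lra.
apply: (@squeeze_cvgr _ _ _ _ (fun n => 1 - (2 * q) ^+ n) (fun=> 1)).
- near=> n; have /andP[_ ->] := cutoff_itv n a01 s01; rewrite andbT.
  have q1 : q ^+ n <= 1 by apply: exprn_ile1; rewrite /q; lra.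
  rewrite cutoffE -/q exprMn -natrX -mulrN; apply: bernoulli_ge; lra.
- rewrite -[X in _ --> X]subr0; apply: cvgB; first exact: cvg_cst.
  by apply: cvg_expr; rewrite ger0_norm; lra.
- exact: cvg_cst.
Unshelve. all: by end_near. Qed.

Lemma cutoff_cvg0 a s : 0 < a < 1 -> 0 < s < 1 -> a < s ->
  (cutoff a n).[s] @[n --> \oo] --> (0 : R).
Proof.
move=> a01 s01 sa; set q := (1 + s - a) / 2.
have q1 : 1 < 2 * q by rewrite /q; lra.
apply: (@squeeze_cvgr _ _ _ _ (fun=> 0) (fun n => (2 * q)^-1 ^+ n)).
- near=> n; have /andP[-> _] /= := cutoff_itv n a01 s01.
  have qn1 : q ^+ n <= 1 by apply: exprn_ile1; rewrite /q; lra.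
  have qn0 : 0 <= q ^+ n by apply: exprn_ge0; rewrite /q; lra.
  rewrite cutoffE -/q exprVn -[leRHS]mul1r ler_pdivlMr; last by apply: exprn_gt0; lra.
  apply: (@le_trans _ _ ((1 - q ^+ n) ^+ (2 ^ n) * (1 + q ^+ n) ^+ (2 ^ n))).
    rewrite ler_wpM2l ?exprn_ge0//; first lra.
    have B : 1 + (2 ^ n)%:R * q ^+ n <= (1 + q ^+ n) ^+ (2 ^ n).
      by apply: bernoulli_ge; lra.
    by apply: le_trans B; rewrite exprMn -natrX lerDr.
  by rewrite -exprMn; apply: exprn_ile1; nra.
- exact: cvg_cst.
- apply: cvg_expr; rewrite ger0_norm ?invr_ge0; last lra.
  by rewrite invf_lt1; lra.
Unshelve. all: by end_near. Qed.

(** Dominated convergence along the cutoff polynomials shows that h has integral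
    zero over all intervals that end at 1. *)
Lemma moments_eq0 h : L1 `]0, 1[ h ->
  (forall p, \int[mu]_(x in `]0, 1[) (h x * p.[1 - x]) = 0) ->
  {ae mu, forall x, I01 R x -> h x = 0}.
Proof.
move=> Lh h0.
have tail0 a : 0 < a < 1 -> \int[mu]_(x in `]a, 1[) h x = 0.
  move=> a01.
  have sub : `]a, 1[ `<=` `]0, 1[.
    by move=> x /=; rewrite !in_itv/=; lra.
  have mh := L1_measurable Lh.
  have mab : measurable (`]a, 1[%classic : set R) by exact: measurable_itv.
  have FF := ae_filter_ringOfSetsType mu.
  have xa : {ae mu, forall x, x != a}.
    exists [set a]; split; [exact: measurable_set1|exact: lebesgue_measure_set1|].
    by move=> x /= /negP; rewrite negbK => /eqP.
  have [|||||_] := @Rintegral_dominated R `]0, 1[ (fun n x => h x * (cutoff (1 - a) n).[1 - x])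
    (h \_ `]a, 1[) (fun x => `|h x|) _ _ _ _ _ (L1_norm Lh).
  - by [].
  - move=> n; apply: measurable_funM => //; apply: measurable_funTS.
    by apply: continuous_measurable_fun; exact: continuous_horner_onem.
  - by apply/measurable_restrict => //; apply: measurable_funS mh.
  - apply: filterS xa => x xa; rewrite /= in_itv/= => x01; rewrite patchE; case: ifPn => [|] xab.
      rewrite inE/= in_itv/= in xab.
      rewrite -[X in _ --> X]mulr1; apply: cvgM; first exact: cvg_cst.
      by apply: cutoff_cvg1; lra.
    rewrite notin_setE/= in_itv/= in xab.
    have {}xab : x < a.
      by rewrite lt_neqAle xa leNgt; apply/negP => ax; apply: xab; lra.
    rewrite -[X in _ --> X](mulr0 (h x)); apply: cvgM; first exact: cvg_cst.
    by apply: cutoff_cvg0; lra.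
  - apply: aeW => x n; rewrite /= in_itv/= => x01; rewrite normrM ler_piMr//.
    have /andP[c0 c1] : 0 <= (cutoff (1 - a) n).[1 - x] <= 1 by apply: cutoff_itv; lra.
    by rewrite ger0_norm.
  rewrite -Rintegral_mkcondr setIidr//.
  have -> : (fun n => \int[mu]_(x in `]0, 1[) (h x * (cutoff (1 - a) n).[1 - x])) = fun=> 0.
    by apply/funext => n; exact: h0.
  move=> c; have c0 : (fun=> 0 : R) n @[n --> \oo] --> (0 : R) by exact: cvg_cst.
  exact: (cvg_unique _ c c0).
apply: ae_eq0_of_Rintegral => // a b a0 ab b1.
have := @Rintegral_oo_split _ a 1 b h (L1_sub_oo (ltW a0) (lexx _) Lh) (ltW ab) (ltW b1).
rewrite !tail0 ?addr0; [by move=> <-|lra..].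
Qed.

(** The monotone convergence theorem makes the sum of the absolute values, which
    serves as the dominating function g, integrable and hence almost everywhere
    finite.  The limit F is taken as a limit superior so that it is measurable
    without reference to the exceptional set. *)
Lemma rapid_cvg (d : nat -> R -> R) (K : R) : (forall j, L1 `]0, 1[ (d j)) ->
  (forall j, \int[mu]_(x in `]0, 1[) `|d j x| <= K * 2^-1 ^+ j) ->
  exists F g : R -> R, [/\ measurable_fun (I01 R) F, L1 `]0, 1[ g,
   {ae mu, forall x, I01 R x -> (\sum_(i < j) d i x) @[j --> \oo] --> F x} &
   {ae mu, forall x j, I01 R x -> `|\sum_(i < j) d i x| <= g x}].
Proof.
move=> Ld dK.
have geo n : \sum_(0 <= i < n) 2^-1 ^+ i = 2 - 2 * 2^-1 ^+ n :> R.
  elim: n => [|n IH]; first by rewrite big_geq// expr0; lra.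
  by rewrite big_nat_recr//= IH exprS; lra.
pose S x := (\sum_(i <oo) `|d i x|%:E)%E.
have mdE i : measurable_fun (I01 R) (fun x => `|d i x|%:E).
  by apply: measurable_fun_EFin; apply: measurableT_comp => //; exact: L1_measurable.
have mS : measurable_fun (I01 R) S.
  by apply: ge0_emeasurable_sum => // i x _ _; rewrite lee_fin.
have S0 x : (0 <= S x)%E by apply: nneseries_ge0 => i _ _; rewrite lee_fin.
have LS : mu.-integrable (I01 R) S.
  apply/integrableP; split=> //.
  under eq_integral do rewrite gee0_abs//.
  rewrite integral_nneseries//.
  apply: (@le_lt_trans _ _ (2 * K)%:E); last exact: ltry.
  apply: lime_le; first by apply: is_cvg_nneseries => i _ _; exact: integral_ge0.
  near=> n; apply: (@le_trans _ _ (\sum_(0 <= i < n) (K * 2^-1 ^+ i)%:E)%E).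
    apply: lee_sum => i _; rewrite -EFin_Rintegral//; last exact: L1_norm.
    by rewrite lee_fin.
  rewrite sumEFin lee_fin -big_distrr/= mulrC ler_wpM2r//.
    have := dK 0%N; rewrite expr0 mulr1; apply: le_trans.
    by apply: Rintegral_ge0.
  by rewrite geo gerBl mulr_ge0// exprn_ge0.
have FF := ae_filter_ringOfSetsType mu.
have Sfin : {ae mu, forall x, I01 R x -> S x \is a fin_num}.
  exact: integrable_ae LS.
have partial x j : I01 R x -> S x \is a fin_num ->
    \sum_(i < j) `|d i x| <= fine (S x).
  move=> Dx Sx; rewrite -lee_fin fineK// -sumEFin.
  rewrite -(big_mkord xpredT (fun i => `|d i x|%:E)).
  by apply: nneseries_lim_ge => i _; rewrite lee_fin.
exists (fun x => fine (limn_esup (fun j => (\sum_(i < j) d i x)%:E))), (fine \o S); split.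
- apply: measurableT_comp; first exact: fine_measurable.
  apply: measurable_fun_limn_esup => j; apply: measurable_fun_EFin.
  by apply: measurable_sum => i; exact: L1_measurable.
- apply: (le_integrable _ _ _ LS) => //.
    apply: measurable_fun_EFin; apply: measurableT_comp => //.
  move=> x Dx /=; rewrite /comp.
  by case: (S x) => [r||] //=; rewrite normr0 ?leey.
- apply: filterS Sfin => x + Dx => /(_ Dx) Sx.
  have : cvgn (series (fun i => d i x)).
    apply: normed_cvg; apply: nondecreasing_is_cvgn.
      by apply: nondecreasing_series => i _ _; exact: normr_ge0.
    exists (fine (S x)) => _ [n _ <-].
    by have := partial x n Dx Sx; rewrite -(big_mkord xpredT (fun i => `|d i x|)).
  rewrite (_ : series (fun i => d i x) = (fun j => \sum_(i < j) d i x)); last first.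
    by apply/funext => j; rewrite /series/= big_mkord.
  move=> cd; set l := limn (fun j => \sum_(i < j) d i x).
  have cdE : (\sum_(i < j) d i x)%:E @[j --> \oo] --> l%:E.
    by apply: cvg_EFin; [exact: nearW|exact: cd].
  by rewrite (cvg_limn_einf_sup cdE).2.
- apply: filterS Sfin => x Sx j Dx; rewrite (le_trans (ler_norm_sum _ _ _))//.
  exact: partial (Sx Dx).
Unshelve. all: by end_near. Qed.

End completeness.

(** * Legendre expansions *)

Section expansion.
Context {R : realType}.
Notation mu := (@lebesgue_measure R).
Implicit Types (x y a b : R) (f g h : R -> R) (p q : {poly R}) (c : nat -> R).

Definition legendre_onb n : {poly R} := Num.sqrt (2 * n%:R + 1) *: legendre01 n.

Lemma shifted_legendreE n x : shifted_legendre n x = (legendre_onb n).[1 - x].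
Proof. by rewrite /shifted_legendre legendre_affine [RHS]hornerZ. Qed.

Lemma J_legendre_onb n m : J (legendre_onb n * legendre_onb m) = (n == m)%:R.
Proof.
rewrite -scalerAl -scalerAr !JZ J_legendre01; case: eqP => [->|_]; last by rewrite mul0r !mulr0.
have m0 : 0 <= 2 * m%:R + 1 :> R by have := ler0n R m; lra.
have -> : (m.*2.+1)%:R = 2 * m%:R + 1 :> R by rewrite -natr1 -muln2 natrM mulrC.
rewrite mulrA -expr2 sqr_sqrtr// div1r divff// gt_eqF//.
Qed.

(** The polynomial [legendre01 n] has degree exactly n, so these polynomials span
    by induction on the size. *)
Lemma legendre_span (phi : {poly R} -> R) :
  (forall p q, phi (p + q) = phi p + phi q) ->
  (forall (k : R) p, phi (k *: p) = k * phi p) ->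
  (forall n, phi (legendre_onb n) = 0) -> forall p, phi p = 0.
Proof.
move=> phiD phiZ phi0 p.
have phiL n : phi (legendre01 n) = 0.
  have := phi0 n; rewrite /legendre_onb phiZ => /eqP; rewrite mulf_eq0 => /orP[|/eqP//].
  by rewrite sqrtr_eq0 leNgt; have := ler0n R n; lra.
have phi00 : phi 0 = 0 by rewrite -(scale0r 0) phiZ mul0r.
suff : forall n q, (size q <= n)%N -> phi q = 0 by move=> /(_ _ p (leqnn _)).
elim=> [|n IH] q sq.
  by move: sq; rewrite leqn0 size_poly_eq0 => /eqP ->.
pose l := (legendre01 n)`_n : R.
have l0 : l != 0.
  rewrite /l coef_legendre01 binn mulr1 mulf_neq0 ?signr_eq0//.
  by rewrite pnatr_eq0 -lt0n bin_gt0 leq_addr.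
have -> : q = (q - (q`_n / l) *: legendre01 n) + (q`_n / l) *: legendre01 n.
  by rewrite subrK.
rewrite phiD phiZ phiL mulr0 addr0; apply: IH.
apply/leq_sizeP => j; rewrite leq_eqVlt => /predU1P[<-|nj].
  by rewrite coefB coefZ -/l mulfVK// subrr.
have qj : q`_j = 0 by apply: (leq_sizeP _ _ sq).
have Lj : (legendre01 n : {poly R})`_j = 0 by apply: (leq_sizeP _ _ (size_legendre01 n)).
by rewrite coefB (coefZ (q`_n / l)) qj Lj mulr0 subrr.
Qed.

(** The block of the Legendre series with indices from m to M - 1. *)
Definition psum c m M : {poly R} := \sum_(m <= n < M) c n *: legendre_onb n.

Lemma J_suml I (s : seq I) (F : I -> {poly R}) q :
  J ((\sum_(i <- s) F i) * q) = \sum_(i <- s) J (F i * q).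
Proof.
elim: s => [|i s IH]; last by rewrite !big_cons mulrDl JD IH.
by rewrite !big_nil mul0r -[X in J X](scale0r 0) JZ mul0r.
Qed.

Lemma J_psum_onb c m M n :
  J (psum c m M * legendre_onb n) = if (m <= n < M)%N then c n else 0.
Proof.
rewrite J_suml; under eq_bigr do rewrite -scalerAl JZ J_legendre_onb.
case: ifPn => [mnM|nmnM].
  rewrite (bigD1_seq n) ?mem_index_iota ?iota_uniq//= eqxx mulr1 big1 ?addr0//.
  by move=> i /negbTE ->; rewrite mulr0.
rewrite big1_seq// => i /andP[_]; rewrite mem_index_iota => imM.
by case: eqP => [ein|]; rewrite ?mulr0//; move: nmnM; rewrite -ein imM.
Qed.

Lemma J_psum_sqr c m M : J (psum c m M * psum c m M) = \sum_(m <= n < M) c n ^+ 2.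
Proof.
rewrite {1}/psum J_suml; apply: eq_big_nat => n mnM.
by rewrite -scalerAl JZ mulrC mulrC [legendre_onb n * _]mulrC J_psum_onb mnM expr2.
Qed.

Lemma legendre_sumE f N x :
  legendre_sum f N x = (psum (legendre_coef f) 0 N.+1).[1 - x].
Proof.
rewrite /legendre_sum /psum big_mkord horner_sum; apply: eq_bigr => n _.
by rewrite hornerZ shifted_legendreE.
Qed.

Lemma L1_mul_poly f p : L1 `]0, 1[ f -> L1 `]0, 1[ (fun x => f x * p.[1 - x]).
Proof.
move=> Lf; apply: L1_mul_continuous => //.
exact/continuous_subspaceT/continuous_horner_onem.
Qed.

Lemma legendre_coefE f n : legendre_coef f n =
  \int[mu]_(x in `]0, 1[) (f x * (legendre_onb n).[1 - x]).
Proof. by apply: eq_Rintegral => x _; rewrite shifted_legendreE. Qed.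

(** By 2 |z| <= T z^2 + 1 / T with T = 2^j, the L^1 norm of the block is bounded
    through the sum of its squared coefficients, which has 2^j terms, each at
    most K / 2^(3 j).  The exponent 3 is what makes the blocks summable. *)
Lemma psum_dyadic_L1 c (K : R) j :
  (forall n, (0 < n)%N -> c n ^+ 2 * n%:R ^+ 3 <= K) ->
  \int[mu]_(x in `]0, 1[) `|(psum c (2 ^ j).+1 (2 ^ j.+1).+1).[1 - x]| <=
  (K + 1) / 2 * 2^-1 ^+ j.
Proof.
move=> cK; set p := psum _ _ _.
have T0 : 0 < 2 ^+ j :> R by rewrite exprn_gt0.
have Lpp := L1_horner_onem (p * p).
apply: (@le_trans _ _ (\int[mu]_(x in `]0, 1[) (2 ^+ j / 2 * (p * p).[1 - x] + 2^-1 ^+ j / 2))).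
  apply: le_Rintegral => //.
  - exact: L1_norm (L1_horner_onem p).
  - by apply: L1D => //; [exact: L1Z|exact: L1_cst].
  - move=> x _; rewrite hornerM; set z := p.[1 - x].
    have -> : z * z = `|z| ^+ 2 by rewrite real_normK ?num_real// expr2.
    rewrite exprVn -subr_ge0.
    have -> : 2 ^+ j / 2 * `|z| ^+ 2 + (2 ^+ j)^-1 / 2 - `|z| =
        (2 ^+ j)^-1 / 2 * (2 ^+ j * `|z| - 1) ^+ 2 by field; rewrite gt_eqF.
    by rewrite mulr_ge0 ?sqr_ge0// divr_ge0// invr_ge0 ltW.
rewrite RintegralD//; [|exact: L1Z|exact: L1_cst].
rewrite RintegralZl// Rintegral_cst// -/(J _) J_psum_sqr.
have -> : fine (mu `]0%R, 1%R[%classic) = 1.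
  by rewrite lebesgue_measure_itv/= lte_fin ltr01 -EFinB subr0.
have K0 : 0 <= K by apply: le_trans (cK 1%N isT); rewrite expr1n mulr1 sqr_ge0.
have cT n : (2 ^ j < n)%N -> c n ^+ 2 <= K / (2 ^+ j) ^+ 3.
  move=> jn; rewrite ler_pdivlMr ?exprn_gt0//.
  apply: le_trans (cK n (leq_ltn_trans (leq0n _) jn)).
  rewrite ler_wpM2l ?sqr_ge0// lerXn2r ?nnegrE ?ltW ?ltr0n//.
    by rewrite (leq_ltn_trans _ jn).
  by rewrite -natrX ltr_nat.
have S : \sum_((2 ^ j).+1 <= n < (2 ^ j.+1).+1) c n ^+ 2 <= 2 ^+ j * (K / (2 ^+ j) ^+ 3).
  apply: (@le_trans _ _ (\sum_((2 ^ j).+1 <= n < (2 ^ j.+1).+1) (K / (2 ^+ j) ^+ 3))).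
    by apply: ler_sum_nat => n /andP[jn _]; exact: cT.
  by rewrite sumr_const_nat subSS expnS mul2n -addnn addnK -natrX mulr_natl.
rewrite exprVn mulr1.
have -> : (K + 1) / 2 * (2 ^+ j)^-1 = K / 2 * (2 ^+ j)^-1 + (2 ^+ j)^-1 / 2 by ring.
rewrite lerD2r.
apply: (@le_trans _ _ (2 ^+ j / 2 * (2 ^+ j * (K / (2 ^+ j) ^+ 3)))).
  by rewrite ler_wpM2l// divr_ge0// ltW.
by rewrite le_eqVlt; apply/orP; left; apply/eqP; field; rewrite gt_eqF.
Qed.

(** The partial sums along powers of 2 converge almost everywhere, dominatedly,
    to a function Fl with the Legendre coefficients of f, hence with its
    polynomial moments, so that Fl = f almost everywhere.  Fatou's lemma then
    bounds the integral of (f - f_N)^2 by the limit of the integrals of the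
    squared partial tails, which orthonormality evaluates. *)
Lemma legendre_error f (K B : R) N : L1 `]0, 1[ f ->
  let c := legendre_coef f in
  (forall n, (0 < n)%N -> c n ^+ 2 * n%:R ^+ 3 <= K) ->
  (forall M, \sum_(N.+1 <= n < M) c n ^+ 2 <= B) ->
  (\int[mu]_(x in I01 R) ((f x - legendre_sum f N x) ^+ 2)%:E <= B%:E)%E.
Proof.
move=> Lf c cK cB.
pose P j := psum c 0 (2 ^ j).+1.
pose d j x := (psum c (2 ^ j).+1 (2 ^ j.+1).+1).[1 - x].
have dP j x : \sum_(i < j) d i x = (P j).[1 - x] - (P 0%N).[1 - x].
  elim: j => [|j IH]; first by rewrite big_ord0 subrr.
  rewrite big_ord_recr/= IH /d /P /psum.
  rewrite [in RHS](@big_cat_nat _ _ _ (2 ^ j).+1 0 (2 ^ j.+1).+1)//=; last first.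
    by rewrite ltnS leq_exp2l.
  by rewrite [in RHS]hornerD; ring.
have Ld j : L1 `]0, 1[ (d j) by exact: L1_horner_onem.
have [F [g [mF Lg cF Fg]]] := rapid_cvg Ld (fun j => psum_dyadic_L1 j cK).
have FF := ae_filter_ringOfSetsType mu.
pose Fl x := (P 0%N).[1 - x] + F x.
have cP p : measurable_fun (I01 R) (fun x => p.[1 - x]).
  by apply: measurable_funTS; apply: continuous_measurable_fun; exact: continuous_horner_onem.
have mFl : measurable_fun (I01 R) Fl by exact: measurable_funD.
have cFl : {ae mu, forall x, I01 R x -> (P j).[1 - x] @[j --> \oo] --> Fl x}.
  apply: filterS cF => x cFx Dx; have {}cFx := cFx Dx.
  have -> : (fun j => (P j).[1 - x]) = (fun j => (P 0%N).[1 - x] + \sum_(i < j) d i x).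
    by apply/funext => j; rewrite dP subrKC.
  by apply: cvgD => //; exact: cvg_cst.
have Fbd : {ae mu, forall x j, I01 R x -> `|(P j).[1 - x]| <= `|(P 0%N).[1 - x]| + g x}.
  apply: filterS Fg => x Fgx j Dx.
  have -> : (P j).[1 - x] = (P 0%N).[1 - x] + \sum_(i < j) d i x.
    by rewrite dP subrKC.
  by rewrite (le_trans (ler_normD _ _))// lerD2l Fgx.
have Lbd : L1 `]0, 1[ (fun x => `|(P 0%N).[1 - x]| + g x).
  by apply: L1D => //; exact: L1_norm (L1_horner_onem _).
have [LFl _] := Rintegral_dominated (measurable_itv _) (fun j => cP (P j)) mFl cFl Fbd Lbd.
have Fl_coef n : \int[mu]_(x in `]0, 1[) (Fl x * (legendre_onb n).[1 - x]) = c n.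
  have [M pM] : exists M, forall x, 0 <= x <= 1 -> `|(legendre_onb n).[1 - x]| <= M.
    apply: within_continuous_bounded.
    exact/continuous_subspaceT/continuous_horner_onem.
  have [||||||_] := @Rintegral_dominated R `]0, 1[
    (fun j x => (P j).[1 - x] * (legendre_onb n).[1 - x])
    (fun x => Fl x * (legendre_onb n).[1 - x])
    (fun x => (`|(P 0%N).[1 - x]| + g x) * M) _ _ _ _ _ _ => //.
  - by move=> j; apply: measurable_funM; exact: cP.
  - by apply: measurable_funM; [exact: mFl|exact: cP].
  - apply: filterS cFl => x cx Dx; apply: cvgM; [exact: cx|exact: cvg_cst].
  - apply: filterS Fbd => x bx j Dx; rewrite normrM ler_pM ?bx//.
    by move: Dx; rewrite /= in_itv/= => x01; apply: pM; lra.
  - by apply: L1_eq (L1Z M _ Lbd) => // x _; rewrite mulrC.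
  move=> cI; have c1 : (\int[mu]_(x in `]0, 1[) ((P j).[1 - x] * (legendre_onb n).[1 - x]))
      @[j --> \oo] --> c n.
    apply: cvg_near_cst; exists n => // j /= nj.
    transitivity (J (P j * legendre_onb n)).
      by apply: eq_Rintegral => x _; rewrite hornerM.
    rewrite J_psum_onb leq0n/= ltnS ifT//.
    by apply: leq_trans nj _; apply: ltnW; exact: ltn_expl.
  exact: (cvg_unique _ cI c1).
have fFl : {ae mu, forall x, I01 R x -> f x - Fl x = 0}.
  apply: moments_eq0; first exact: L1B.
  have LfFl := L1B (measurable_itv _) Lf LFl.
  apply: legendre_span.
  - move=> p q; rewrite -RintegralD//; try exact: L1_mul_poly.
    by apply: eq_Rintegral => x _; rewrite hornerD mulrDr.
  - move=> a p; rewrite -RintegralZl//; last exact: L1_mul_poly.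
    by apply: eq_Rintegral => x _; rewrite hornerZ mulrCA.
  - move=> n; under eq_Rintegral do rewrite mulrBl.
    rewrite RintegralB//; try exact: L1_mul_poly.
    by rewrite Fl_coef /c legendre_coefE subrr.
have mf := L1_measurable Lf.
pose q j x := (P j - psum c 0 N.+1).[1 - x].
apply: (@le_trans _ _ (\int[mu]_(x in I01 R) limn_einf (fun j => (q j x ^+ 2)%:E))%E).
  apply: ae_ge0_le_integral => //.
  - by move=> x _; rewrite lee_fin sqr_ge0.
  - apply: measurable_fun_EFin; apply: measurable_funX; apply: measurable_funB => //.
    have -> : legendre_sum f N = fun x => (psum c 0 N.+1).[1 - x].
      by apply/funext => x; exact: legendre_sumE.
    exact: cP.
  - move=> x _; rewrite limn_einf_lim; apply: lime_ge; first exact: is_cvg_einfs.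
    near=> n; apply: le_ereal_inf_tmp => _ [m _ <-].
    by rewrite lee_fin sqr_ge0.
  - have mls : measurable_fun (I01 R) (fun x => limn_esup (fun j => (- (q j x ^+ 2))%:E)).
      apply: measurable_fun_limn_esup => j.
      apply: (@measurable_fun_EFin _ _ (fun x => - (q j x ^+ 2))).
      by apply: measurable_funN; apply: measurable_funX; exact: cP.
    exact: (measurableT_comp (@oppe_measurable R setT) mls).
  - apply: filterS2 fFl cFl => x fx cx Dx.
    have cq : q j x @[j --> \oo] --> f x - legendre_sum f N x.
      have /eqP := fx Dx; rewrite subr_eq0 => /eqP ->; rewrite legendre_sumE.
      under eq_fun do rewrite /q hornerD hornerN.
      by apply: cvgB; [exact: cx|exact: cvg_cst].
    have cq2 : (q j x ^+ 2)%:E @[j --> \oo] --> ((f x - legendre_sum f N x) ^+ 2)%:E.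
      apply: cvg_EFin; first exact: nearW.
      by rewrite expr2; under eq_fun do rewrite /= expr2; exact: cvgM.
    by rewrite (cvg_limn_einf_sup cq2).1.
apply: le_trans (fatou _ _ _ _) _ => //.
- by move=> j; apply: measurable_fun_EFin; apply: measurable_funX; exact: cP.
- by move=> j x _; rewrite lee_fin sqr_ge0.
rewrite limn_einf_lim; apply: lime_le; first exact: is_cvg_einfs.
near=> n; pose m := maxn n N.
apply: (@le_trans _ _ (\int[mu]_(x in I01 R) (q m x ^+ 2)%:E)%E).
  by apply: ereal_inf_lbound; exists m => //=; exact: leq_maxl.
have Nm : (N <= 2 ^ m)%N.
  by apply: (leq_trans (leq_maxr n N)); apply: ltnW; exact: ltn_expl.
have -> : (\int[mu]_(x in I01 R) (q m x ^+ 2)%:E)%E =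
    (J (psum c N.+1 (2 ^ m).+1 * psum c N.+1 (2 ^ m).+1))%:E.
  rewrite /J EFin_Rintegral//; last exact: L1_horner_onem.
  apply: eq_integral => x _; rewrite hornerM -expr2 /q; congr ((_ ^+ 2)%:E).
  congr horner; rewrite /P /psum (@big_cat_nat _ _ _ N.+1 0 (2 ^ m).+1)//=.
  by rewrite addrAC subrr add0r.
by rewrite J_psum_sqr lee_fin cB.
Unshelve. all: by end_near. Qed.

End expansion.

(** * Vanishing of the boundary terms at the origin *)

Section boundary.
Context {R : realType}.
Notation mu := (@lebesgue_measure R).
Implicit Types (x y t : R) (f u : R -> R) (G : nat -> R -> R).

Lemma primitive_is_derive f x : L1 `]0, 1[ f -> 0 < x < 1 ->
  {for x, continuous f} -> is_derive x 1 (primitive f) (f x).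
Proof.
move=> Lf /andP[x0 x1] cf.
have Lf' := L1_itv false false Lf.
have [|d1 d2] := @continuous_FTC1 R f (BRight 0) x 1 x1 Lf' _ cf.
  by rewrite ?bnd_simp ?x0.
apply: (@near_eq_is_derive R R R (fun y => \int[mu]_(t in `]0, y]) f t)).
  near=> y; rewrite /primitive (@Rintegral_itv_oo _ _ _ false false)//.
  apply: L1_itv0x Lf; apply: ltW; near: y; exact: lt_nbhsl.
by split; [exact: d1|rewrite -derive1E; exact: d2].
Unshelve. all: by end_near. Qed.

Lemma within_continuous_oo f : {within `[0, 1], continuous f} ->
  (forall x, 0 < x < 1 -> {for x, continuous f}) /\ f x @[x --> 0^'+] --> f 0.
Proof.
by move=> /(continuous_within_itvP _ (@ltr01 R))[cf f0 _]; split.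
Qed.

Lemma near_itvoo x : 0 < x < 1 -> \forall y \near x, 0 < y < 1.
Proof.
move=> /andP[x0 x1]; near=> y; apply/andP; split; near: y.
  exact: lt_nbhsr.
exact: lt_nbhsl.
Unshelve. all: by end_near. Qed.

Lemma near_itvpi t : 0 < t < pi -> \forall y \near t, 0 < y < pi.
Proof.
move=> /andP[x0 x1]; near=> y; apply/andP; split; near: y.
  exact: lt_nbhsr.
exact: lt_nbhsl.
Unshelve. all: by end_near. Qed.

Section antiderivatives.
Variables (G : nat -> R -> R) (k : nat).
Hypothesis GC : forall i, (i < k)%N -> exists C, G i = (fun x => C + primitive (G i.+1) x).
Hypothesis LG : forall i, (i <= k)%N -> L1 `]0, 1[ (G i).

(** [G 0] has [k] successive derivatives [G 1], ..., [G k]: the last is merely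
    integrable, the others are continuous up to the endpoints. *)
Lemma antiderivative_abs_cont i : (i < k)%N -> abs_cont (G i) (G i.+1).
Proof.
move=> ik; have [C ->] := GC ik; apply: abs_cont_primitive.
exact: LG.
Qed.

Lemma antiderivative_continuous i : (i < k)%N -> {within `[0, 1], continuous (G i)}.
Proof. by move=> ik; exact: abs_cont_continuous (antiderivative_abs_cont ik). Qed.

Lemma antiderivative_is_derive i x : (i.+1 < k)%N -> 0 < x < 1 ->
  is_derive x 1 (G i) (G i.+1 x).
Proof.
move=> ik x01; have [C ->] := GC (ltnW ik).
rewrite -[X in is_derive _ _ _ X]add0r; apply: is_deriveD.
apply: primitive_is_derive => //; first by apply: LG; exact: ltnW.
exact: (within_continuous_oo (antiderivative_continuous ik)).1.
Qed.

Lemma antiderivative_derive1n j x : (j < k)%N -> 0 < x < 1 ->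
  derive1n j (G 0%N) x = G j x.
Proof.
elim: j x => [//|j IH] x jk x01; rewrite derive1nS derive1E.
have [_ ->//] : is_derive x 1 (derive1n j (G 0%N)) (G j.+1 x).
apply: (@near_eq_is_derive R R R (G j)); last exact: antiderivative_is_derive.
apply: filterS (near_itvoo x01) => y y01.
by rewrite IH// ltnW.
Qed.

Lemma antiderivative_representative u : (0 < k)%N ->
  {ae mu, forall x, I01 R x -> u x = G 0%N x} ->
  Cn_representative k.-1 u (G 0%N).
Proof.
move=> k0 uG; have FF := ae_filter_ringOfSetsType mu; split.
- by apply: filterS uG => x + Dx => ->.
- move=> j x jk; rewrite /= in_itv/= => x01.
  have jk' : (j.+1 < k)%N by rewrite -(prednK k0) ltnS.
  have [] : is_derive x 1 (derive1n j (G 0%N)) (G j.+1 x).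
    apply: (@near_eq_is_derive R R R (G j)); last exact: antiderivative_is_derive.
    apply: filterS (near_itvoo x01) => y y01.
    by rewrite antiderivative_derive1n// ltnW.
  by [].
- move=> j x jk; rewrite /= in_itv/= => x01.
  have jk' : (j < k)%N by rewrite -(prednK k0) ltnS.
  have cG := (within_continuous_oo (antiderivative_continuous jk')).1 x x01.
  change (derive1n j (G 0%N) y @[y --> x] --> derive1n j (G 0%N) x).
  rewrite (antiderivative_derive1n jk' x01); apply: cvg_trans cG; apply: near_eq_cvg.
  apply: filterS (near_itvoo x01) => y y01.
  by rewrite antiderivative_derive1n.
Qed.

Definition sinsq t : R := sin (t / 2) ^+ 2.

Lemma is_derive_sinsq t : is_derive t 1 sinsq (sin t / 2).
Proof.
have d1 : is_derive t 1 (fun t => t / 2) (2^-1 : R).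
  have -> : (fun t : R => t / 2) = (fun t => 2^-1 * t).
    by apply/funext => z; rewrite mulrC.
  by have := is_deriveZ 2^-1 (is_derive_id t (1 : R)); rewrite /GRing.scale/= mulr1.
have d2 := @is_derive1_comp R sin (fun t => t / 2) t _ _ (is_derive_sin _) d1.
have -> : sinsq = (fun t => sin (t / 2) * sin (t / 2)).
  by apply/funext => z; rewrite /sinsq expr2.
apply: is_deriveW (is_deriveM d2 d2) _.
rewrite /GRing.scale/= [in RHS](splitr t) sinD.
by field.
Qed.

Lemma sinsq_itv t : 0 < t < pi -> 0 < sinsq t < 1.
Proof.
move=> /andP[t0 tpi].
have s0 : 0 < sin (t / 2) by apply: sin_gt0_pi; have := pi_gt0 R; lra.
have c0 : 0 < cos (t / 2) by apply: cos_gt0_pihalf; have := pi_gt0 R; lra.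
rewrite /sinsq exprn_gt0//= sin2cos2 gtrBl exprn_gt0//.
Qed.

(** The higher chain rule that [chain] encodes. *)
Lemma sinsq_derive1n j t : (j < k)%N -> 0 < t < pi ->
  derive1n j (fun t => G 0%N (sinsq t)) t =
  \sum_(i < j.+1) chain j i t * G i (sinsq t).
Proof.
elim: j t => [|j IH] t jk t0pi.
  by rewrite big_ord_recl big_ord0 /= mul1r addr0.
rewrite derive1nS derive1E.
pose D := \sum_(i < j.+1) (derive1 (chain j i) t * G i (sinsq t) +
  chain j i t * (G i.+1 (sinsq t) * (sin t / 2))).
have dS : is_derive t 1 (fun t => \sum_(i < j.+1) chain j i t * G i (sinsq t)) D.
  have dterm (i : 'I_j.+1) : is_derive t 1 (fun t => chain j i t * G i (sinsq t))
     (derive1 (chain j i) t * G i (sinsq t) + chain j i t * (G i.+1 (sinsq t) * (sin t / 2))).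
    have ik : (i.+1 < k)%N by apply: leq_ltn_trans jk; exact: ltn_ord.
    have dG := @is_derive1_comp R (G i) sinsq t _ _
      (antiderivative_is_derive ik (sinsq_itv t0pi)) (is_derive_sinsq t).
    have [dc _] := trigpoly_derive1 (@chain_trigpoly R j i).
    apply: is_deriveW (is_deriveM (dc t) dG) _.
    by rewrite /GRing.scale/=; ring.
  have := is_derive_sum dterm.
  by rewrite fct_sumE.
have [_ ->] : is_derive t 1 (derive1n j (fun t => G 0%N (sinsq t))) D.
  apply: near_eq_is_derive dS.
  apply: filterS (near_itvpi t0pi) => y y0pi.
  by rewrite IH// ltnW.
rewrite /D big_split/=.
under [in RHS]eq_bigr do rewrite /= mulrDl.
rewrite big_split; congr (_ + _).
  by rewrite [in RHS]big_ord_recr/= chain_gt// derive1_cst mul0r addr0.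
rewrite [in RHS]big_ord_recl/= !mul0r add0r; apply: eq_bigr => i _.
by rewrite /bump/= add1n; ring.
Qed.

Lemma sinsq_cvg0 : sinsq t @[t --> 0^'+] --> (0 : R)^'+.
Proof.
have c0 : sinsq t @[t --> (0 : R)] --> (0 : R).
  have s0 : sinsq 0 = 0 by rewrite /sinsq mul0r sin0 expr0n.
  rewrite -[X in _ --> X]s0.
  apply/differentiable_continuous/derivable1_diffP.
  by case: (is_derive_sinsq 0).
move=> A A0.
have {}A0 : \forall u \near (0 : R), 0 < u -> A u by exact: A0.
have := c0 _ A0; rewrite /= => c0A.
have : \forall t \near (0 : R), 0 < t -> A (sinsq t).
  near=> t => t0.
  have : 0 < sinsq t -> A (sinsq t) by near: t; exact: c0A.
  apply; have /andP[//] : 0 < sinsq t < 1.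
  apply: sinsq_itv; rewrite t0/=; near: t; exact: lt_nbhsl (pi_gt0 R).
by [].
Unshelve. all: by end_near. Qed.

(** By the chain rule the derivative of order j tends, at 0 from the right, to
    the value of [chainsum G j] at 0, everything being continuous there; the
    hypothesis says that this limit is 0. *)
Lemma chainsum_eq0 j : (j < k)%N ->
  derive1n j (fun t => G 0%N (sin (t / 2) ^+ 2)) t @[t --> 0^'] --> (0 : R) ->
  chainsum G j 0 = 0.
Proof.
move=> jk lim0.
have c1 : derive1n j (fun t => G 0%N (sinsq t)) t @[t --> 0^'+] --> chainsum G j 0.
  have : (\sum_(i < j.+1) chain j i t * G i (sinsq t)) @[t --> 0^'+] -->
      chainsum G j 0.
    rewrite /chainsum angle0.
    apply: cvg_big => [|i _]; first exact: add_continuous.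
    apply: cvgM.
      apply: cvg_at_right_filter.
      have [dc _] := trigpoly_derive1 (@chain_trigpoly R j i).
      apply/differentiable_continuous/derivable1_diffP.
      by case: (dc 0).
    apply: cvg_comp sinsq_cvg0 _.
    apply: (within_continuous_oo (antiderivative_continuous _)).2.
    by apply: (leq_ltn_trans _ jk); rewrite -ltnS.
  apply: cvg_trans; apply: near_eq_cvg.
  near=> t; rewrite sinsq_derive1n//; apply/andP; split.
    by near: t; exact: nbhs_right_gt.
  by near: t; exact: nbhs_right_lt (pi_gt0 R).
have c2 : derive1n j (fun t => G 0%N (sinsq t)) t @[t --> 0^'+] --> (0 : R).
  apply: cvg_trans lim0 => A; rewrite /= /nbhs/= /dnbhs /at_right /within /=.
  by apply: filterS => t h t0; apply: h; rewrite gt_eqF.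
exact: (cvg_unique _ c1 c2).
Unshelve. all: by end_near. Qed.

End antiderivatives.
End boundary.

(** * Decay of the Legendre coefficients *)

Section assembly.
Context {R : realType}.
Notation mu := (@lebesgue_measure R).
Implicit Types (x y t : R) (f u w : R -> R) (G : nat -> R -> R).

Lemma arcsine_densityE x : arcsine_density x = akernel 0 x.
Proof. by rewrite /arcsine_density /akernel subr0 mulrC. Qed.

Lemma akernel_ge1 x : 0 < x < 1 -> 1 <= akernel 0 x.
Proof.
move=> x01; have p0 : 0 < (1 - x) * (x - 0) by rewrite mulr_gt0; lra.
rewrite /akernel invf_ge1 ?sqrtr_gt0// -[leRHS]sqrtr1 ler_sqrt//.
have := sqr_ge0 (2 * x - 1); nra.
Qed.

Lemma in_L2_integrable w u : measurable_fun (I01 R) w ->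
  (forall x, I01 R x -> 0 <= w x) -> in_L2 w u ->
  L1 `]0, 1[ (fun x => u x ^+ 2 * w x).
Proof.
move=> mw w0 [mu_ uoo]; apply/integrableP; split.
  apply: measurable_fun_EFin; apply: measurable_funM => //.
  exact: measurable_funX.
apply: le_lt_trans uoo; rewrite le_eqVlt; apply/orP; left; apply/eqP.
apply: eq_integral => x /[1!inE] Dx.
by rewrite /= ger0_norm// mulr_ge0 ?sqr_ge0 ?w0.
Qed.

(** By |u| <= u^2 w + 1, valid since w is at least 1. *)
Lemma in_L2_L1 w u : measurable_fun (I01 R) w ->
  (forall x, I01 R x -> 1 <= w x) -> in_L2 w u -> L1 `]0, 1[ u.
Proof.
move=> mw w1 u2; have mu_ := u2.1.
have Lu2 : L1 `]0, 1[ (fun x => u x ^+ 2 * w x).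
  by apply: in_L2_integrable => // x Dx; rewrite (le_trans _ (w1 x Dx)).
apply: (@L1_le _ _ _ (fun x => u x ^+ 2 * w x + 1)) => //.
  move=> x Dx; apply: (@le_trans _ _ (u x ^+ 2 + 1)).
    by rewrite -[u x ^+ 2]real_normK ?num_real//; have := sqr_ge0 (`|u x| - 1); nra.
  by rewrite lerD2r ler_peMr ?sqr_ge0 ?w1.
by apply: L1D => //; exact: L1_cst.
Qed.

Lemma measurable_akernel0 : measurable_fun (I01 R) (akernel 0).
Proof. exact: L1_measurable (L1_akernel (@ltr01 R)). Qed.

Lemma measurable_arcsine : measurable_fun (I01 R) (@arcsine_density R).
Proof.
have -> : @arcsine_density R = akernel 0 by apply/funext => x; exact: arcsine_densityE.
exact: measurable_akernel0.
Qed.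

Lemma weakDP j u : (exists v, weak_derivative j u v) -> weakd j u (weakD j u).
Proof.
move=> [v uv]; have [_ _ H] : weak_derivative j u (weakD j u).
  exact: xgetPex (ex_intro _ v uv).
by move=> phi bphi; apply: H; exact: bump_function_test.
Qed.

(** With th half of the angle, cos th ^ 2 = 1 - x and sin th ^ 2 = x. *)
Lemma sine_kernel n x : 0 < x < 1 ->
  (sineU n).[1 - x] / Num.sqrt (1 - x) =
  (-1) ^+ n * (akernel 0 x * sin ((n%:R + 2^-1) * angle 0 x)).
Proof.
move=> x01; pose th := angle 0 x / 2.
have /andP[a0 api] : 0 <= angle 0 x <= pi by apply: angle_itv; lra.
have tE : angle 0 x = th + th by rewrite /th -splitr.
have c2 : cos th ^+ 2 = 1 - x.
  have := @cos_angle R x; rewrite tE cosD -!expr2 sin2cos2 => H.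
  by have := H _; lra.
have s2 : sin th = Num.sqrt x.
  rewrite -[LHS]ger0_norm; last by apply: sin_ge0_pi; rewrite /th; have := pi_ge0 R; lra.
  by rewrite -sqrtr_sqr sin2cos2 c2; congr Num.sqrt; lra.
rewrite mulrCA (_ : (n%:R + 2^-1) * angle 0 x = n.*2.+1%:R * th); last first.
  by rewrite tE -[n.*2.+1]addn1 -muln2 natrD natrM; field.
rewrite sin_odd c2 s2 /akernel subr0 sqrtrM; last lra.
have x0 : Num.sqrt x != 0 by rewrite sqrtr_eq0 -ltNge; lra.
have y0 : Num.sqrt (1 - x) != 0 by rewrite sqrtr_eq0 -ltNge; lra.
by field; rewrite x0 y0.
Qed.

Lemma measurable_comp_angle (T : R -> R) : continuous T ->
  measurable_fun (I01 R) (fun x => T (angle 0 x)).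
Proof.
move=> cT; apply: measurableT_comp; first exact: continuous_measurable_fun.
exact: within_continuous_measurable (angle_continuous (@ltr01 R)).
Qed.

(** The Legendre coefficients of f are sine coefficients of half-integer
    frequency of its Abel transform, which may be replaced by any function u equal
    to it almost everywhere. *)
Lemma abel_legendre_coef f u n : L1 `]0, 1[ f -> measurable_fun (I01 R) (abel f) ->
  measurable_fun (I01 R) u -> {ae mu, forall x, I01 R x -> abel f x = u x} ->
  pi * `|legendre_coef f n| = Num.sqrt (2 * n%:R + 1) *
  `|\int[mu]_(x in `]0, 1[) (akernel 0 x * u x * sin ((n%:R + 2^-1) * angle 0 x))|.
Proof.
move=> Lf mg mu_ gu.
have Lfp := L1_mul_poly (legendre01 n) Lf.
have -> : legendre_coef f n = Num.sqrt (2 * n%:R + 1) *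
    \int[mu]_(x in `]0, 1[) (f x * (legendre01 n).[1 - x]).
  rewrite legendre_coefE -RintegralZl//; apply: eq_Rintegral => x _.
  by rewrite /legendre_onb [(_ *: _).[_]]hornerZ mulrCA.
rewrite normrM ger0_norm ?sqrtr_ge0// mulrCA; congr (_ * _).
rewrite -[X in X * _]ger0_norm ?pi_ge0// -normrM -RintegralZl//.
have -> : \int[mu]_(x in `]0, 1[) (pi * (f x * (legendre01 n).[1 - x])) =
    \int[mu]_(x in `]0, 1[) (abel f x * ((sineU n).[1 - x] / Num.sqrt (1 - x))).
  rewrite (abel_adjoint (sineU n) Lf).
  apply: eq_Rintegral => y /[1!inE]/=; rewrite in_itv/= => y01.
  by rewrite Rintegral_sineU_akernel; [ring|lra].
have ms : measurable_fun (I01 R) (fun x => sin ((n%:R + 2^-1) * angle 0 x)).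
  exact: (measurable_comp_angle (@continuous_trigM _ true _)).
have mk := measurable_akernel0.
have -> : \int[mu]_(x in `]0, 1[) (abel f x * ((sineU n).[1 - x] / Num.sqrt (1 - x))) =
   (-1) ^+ n * \int[mu]_(x in `]0, 1[)
     (akernel 0 x * abel f x * sin ((n%:R + 2^-1) * angle 0 x)).
  rewrite -RintegralZl_measurable//; last by apply: measurable_funM => //; exact: measurable_funM.
  apply: eq_Rintegral => y /[1!inE]/=; rewrite in_itv/= => y01.
  by rewrite sine_kernel//; ring.
rewrite normrM normrX normrN1 expr1n mul1r; congr (`|_|).
apply: ae_eq_Rintegral => //.
- by apply: measurable_funM => //; exact: measurable_funM.
- by apply: measurable_funM => //; exact: measurable_funM.
have FF := ae_filter_ringOfSetsType mu.
by apply: filterS gu => x gu Dx; rewrite gu.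
Qed.

(** The choice l = P / X makes the term P / l equal to X. *)
Lemma sqr_le_of_scaled (X E P : R) : 0 <= X -> 0 < P -> 0 <= E ->
  (forall l, 0 < l -> 2 * X <= l * E + P / l) -> X ^+ 2 <= P * E.
Proof.
rewrite le_eqVlt => /predU1P[<- P0 E0 _|X0 P0 _ H].
  by rewrite expr0n mulr_ge0 ?(ltW P0).
have := H (P / X) (divr_gt0 P0 X0).
rewrite invf_div mulrCA divff ?gt_eqF// mulr1 => h.
have : X <= P / X * E by lra.
by rewrite mulrAC ler_pdivlMr// expr2.
Qed.

(** The scaled inequality 2 |h s| <= l h^2 + 1 / l is integrated against r, and
    [sqr_le_of_scaled] eliminates l. *)
Lemma Rintegral_cauchy_schwarz (r h s : R -> R) :
  (forall x, 0 < x < 1 -> 0 <= r x) -> (forall x, 0 < x < 1 -> `|s x| <= 1) ->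
  measurable_fun (I01 R) h -> measurable_fun (I01 R) s ->
  L1 `]0, 1[ r -> L1 `]0, 1[ (fun x => r x * h x ^+ 2) ->
  0 < \int[mu]_(x in `]0, 1[) r x ->
  (\int[mu]_(x in `]0, 1[) (r x * h x * s x)) ^+ 2 <=
  \int[mu]_(x in `]0, 1[) r x * \int[mu]_(x in `]0, 1[) (r x * h x ^+ 2).
Proof.
move=> r0 s1 mh ms Lr Lrh P0.
have mr := L1_measurable Lr.
have mrhs : measurable_fun (I01 R) (fun x => r x * h x * s x).
  by apply: measurable_funM => //; exact: measurable_funM.
have bd l x : 0 < l -> 0 < x < 1 ->
    `|2 * (r x * h x * s x)| <= l * (r x * h x ^+ 2) + l^-1 * r x.
  move=> l0 x01.
  have -> : l * (r x * h x ^+ 2) + l^-1 * r x =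
      r x * (2 * `|h x| + l^-1 * (l * `|h x| - 1) ^+ 2).
    by rewrite -(real_normK (num_real (h x))); field; rewrite gt_eqF.
  have -> : 2 * (r x * h x * s x) = r x * (2 * (h x * s x)) by ring.
  rewrite normrM ger0_norm ?r0// ler_wpM2l ?r0//.
  apply: (@le_trans _ _ (2 * `|h x|)).
    by rewrite !normrM ger0_norm// ler_wpM2l// ler_piMr ?s1.
  by rewrite lerDl mulr_ge0 ?sqr_ge0 ?invr_ge0 ?ltW.
have LB l : L1 `]0, 1[ (fun x => l * (r x * h x ^+ 2) + l^-1 * r x).
  by apply: L1D => //; exact: L1Z.
have L2 : L1 `]0, 1[ (fun x => 2 * (r x * h x * s x)).
  apply: (L1_le _ _ _ (LB 1)) => //; first exact: measurable_funM.
  by move=> x /=; rewrite in_itv/= => x01; exact: bd.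
have Lrhs : L1 `]0, 1[ (fun x => r x * h x * s x).
  by apply: L1_eq (L1Z 2^-1 _ L2) => // x _ /=; rewrite mulKf.
rewrite -[X in X <= _]real_normK ?num_real//; apply: sqr_le_of_scaled => //.
  by apply: Rintegral_ge0 => x /=; rewrite in_itv/= => x01; rewrite mulr_ge0 ?sqr_ge0 ?r0.
move=> l l0; have -> : 2 = `|2| :> R by rewrite ger0_norm.
rewrite -normrM -RintegralZl//; apply: (le_trans (le_normr_Rintegral _ _)) => //.
rewrite [X in _ + X]mulrC -!RintegralZl// -RintegralD//; last 2 first.
- exact: L1Z.
- exact: L1Z.
apply: le_Rintegral => //; [exact: L1_norm|exact: LB|].
by move=> x /=; rewrite in_itv/= => x01; exact: bd.
Qed.

Lemma sqr_sum_le (n : nat) (a : nat -> R) :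
  (\sum_(i < n) a i) ^+ 2 <= n%:R * \sum_(i < n) a i ^+ 2.
Proof.
elim: n => [|n IH]; first by rewrite !big_ord0 expr0n mul0r.
have : 0 <= \sum_(i < n) (a i - a n) ^+ 2 by apply: sumr_ge0 => i _; exact: sqr_ge0.
rewrite (_ : \sum_(i < n) (a i - a n) ^+ 2 = \sum_(i < n) a i ^+ 2
    - 2 * a n * (\sum_(i < n) a i) + n%:R * a n ^+ 2); last first.
  have -> : n%:R * a n ^+ 2 = \sum_(i < n) a n ^+ 2 by rewrite sumr_const card_ord mulr_natl.
  rewrite mulr_sumr -sumrB -big_split/=.
  by apply: eq_bigr => i _; ring.
rewrite !big_ord_recr/= -natr1; move: (\sum_(i < n) _ ^+ 2) (\sum_(i < n) _) IH => Q S.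
nra.
Qed.

Lemma chainsum_sqr G k x : chainsum G k x ^+ 2 <=
  k.+1%:R * k`!%:R ^+ 2 * \sum_(j < k.+1) G j x ^+ 2.
Proof.
apply: (le_trans (sqr_sum_le _ (fun i => chain k i (angle 0 x) * G i x))).
rewrite -mulrA ler_wpM2l// mulr_sumr ler_sum// => i _.
rewrite exprMn ler_wpM2r ?sqr_ge0// -[_ ^+ 2]real_normK ?num_real//.
by rewrite lerXn2r ?nnegrE// (trigpoly_bound (chain_trigpoly k i)).
Qed.

(** Compare 1 / n^2 with the telescoping 1 / (n - 1) - 1 / n. *)
Lemma sum_inv_sqr_le N m : (0 < N)%N ->
  \sum_(N.+1 <= n < N.+1 + m) (n%:R ^- 2 : R) <= N%:R^-1 - (N + m)%:R^-1.
Proof.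
move=> N0; elim: m => [|m IH]; first by rewrite !addn0 big_geq// subrr.
rewrite addnS big_nat_recr/=; last by rewrite leq_addr.
apply: (le_trans (lerD IH (lexx _))).
have Nm : 0 < (N + m)%:R :> R by rewrite ltr0n addn_gt0 N0.
rewrite addSn addnS -natr1; move: (N + m)%:R Nm => a a0.
rewrite -addrA lerD2l -subr_ge0.
have -> : - (a + 1)^-1 - (- a^-1 + (a + 1) ^- 2) = a^-1 * (a + 1) ^- 2.
  by field; rewrite !gt_eqF//; lra.
by rewrite mulr_ge0// invr_ge0 ?exprn_ge0; lra.
Qed.


(** Put nu = n + 1/2 and let Y be the integral left after k integrations by
    parts.  Then pi^2 c_n^2 nu^(2 k) = 2 nu Y^2, and Y^2 is at most pi, the total
    mass of the arcsine density, times the weighted integral of the square of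
    [chainsum G k]. *)
Lemma legendre_coef_decay f G k n : L1 `]0, 1[ f ->
  measurable_fun (I01 R) (abel f) ->
  (forall i, (i < k)%N -> abs_cont (G i) (G i.+1)) ->
  (forall i, (i <= k)%N -> L1 `]0, 1[ (fun x => akernel 0 x * G i x ^+ 2)) ->
  (forall i, (i <= k)%N -> L1 `]0, 1[ (G i)) ->
  {ae mu, forall x, I01 R x -> abel f x = G 0 x} ->
  (forall j, (j < k)%N -> chainsum G j 0 = 0) -> (0 < k)%N ->
  legendre_coef f n ^+ 2 * n%:R ^+ (2 * k).-1 <= 2 / pi * (k.+1%:R * k`!%:R ^+ 2) *
    \sum_(i < k.+1) \int[mu]_(x in `]0, 1[) (akernel 0 x * G i x ^+ 2).
Proof.
move=> Lf mg acG LG2 LG gG G0 k0.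
set nu : R := n%:R + 2^-1; set c := legendre_coef f n; set A := k.+1%:R * _.
have pi0 := pi_gt0 R.
have nu0 : 0 < nu by rewrite /nu; have := ler0n R n; lra.
have mG i : (i <= k)%N -> measurable_fun (I01 R) (G i) by move=> /LG; exact: L1_measurable.
have mk := measurable_akernel0.
pose rho := \sum_(i < k.+1) \int[mu]_(x in `]0, 1[) (akernel 0 x * G i x ^+ 2).
have Lsum : L1 `]0, 1[ (fun x => \sum_(i < k.+1) akernel 0 x * G i x ^+ 2).
  by apply: L1_sum => // i _; apply: LG2; rewrite -ltnS.
have LA : L1 `]0, 1[ (fun x => A * \sum_(i < k.+1) akernel 0 x * G i x ^+ 2) by exact: L1Z.
have mch : measurable_fun (I01 R) (chainsum G k).
  apply: measurable_sum => i; apply: measurable_funM; last by apply: mG; rewrite -ltnS.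
  apply: measurable_comp_angle => t.
  apply/differentiable_continuous/derivable1_diffP.
  by case: ((trigpoly_derive1 (chain_trigpoly k i)).1 t).
have bd x : 0 < x < 1 -> akernel 0 x * chainsum G k x ^+ 2 <=
    A * \sum_(i < k.+1) akernel 0 x * G i x ^+ 2.
  move=> x01; rewrite -mulr_sumr [leRHS]mulrCA ler_wpM2l ?akernel_ge0//; exact: chainsum_sqr.
have Lch : L1 `]0, 1[ (fun x => akernel 0 x * chainsum G k x ^+ 2).
  apply: (L1_le _ _ _ LA) => //; first by apply: measurable_funM => //; exact: measurable_funX.
  move=> x /=; rewrite in_itv/= => x01.
  rewrite ger0_norm; last by rewrite mulr_ge0 ?akernel_ge0 ?sqr_ge0.
  exact: bd.
have Ek : \int[mu]_(x in `]0, 1[) akernel 0 x = pi by rewrite Rintegral_akernel ?angle1//; lra.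
have CS := @Rintegral_cauchy_schwarz (akernel 0) (chainsum G k)
   (fun x => trig (~~ odd k) (nu * angle 0 x)).
have {}CS : (\int[mu]_(x in `]0, 1[) (akernel 0 x * chainsum G k x *
     trig (~~ odd k) (nu * angle 0 x))) ^+ 2 <= pi * (A * rho).
  apply: le_trans (CS _ _ _ _ _ _ _) _ => //.
  - by move=> x _; exact: akernel_ge0.
  - by move=> x _; exact: normr_trig.
  - exact: (measurable_comp_angle (@continuous_trigM _ _ _)).
  - exact: L1_akernel.
  - by rewrite Ek.
  rewrite Ek ler_wpM2l ?pi_ge0// /rho -Rintegral_sum//; last first.
    by move=> i _; apply: LG2; rewrite -ltnS.
  rewrite -RintegralZl//.
  by apply: le_Rintegral => // x /=; rewrite in_itv/=; exact: bd.
have := abel_legendre_coef n Lf mg (mG 0%N isT) gG.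
have := chainsum_parts n acG G0 (leqnn k).
rewrite -/c -/nu.
have -> : \int[mu]_(x in `]0, 1[) (akernel 0 x * chainsum G 0 x * sin (nu * angle 0 x))
  = \int[mu]_(x in `]0, 1[) (akernel 0 x * G 0%N x * sin (nu * angle 0 x)).
  by apply: eq_Rintegral => x _; rewrite /chainsum big_ord1 /= mul1r.
move: CS; rewrite -[X in X <= pi * _ -> _]real_normK ?num_real//.
move: `|\int[mu]_(x in _) (_ * chainsum G k _ * _)| => Y.
move: `|\int[mu]_(x in _) (_ * _)| => Z YA ZY cZ.
have E2 : pi ^+ 2 * (c ^+ 2 * nu ^+ (2 * k)) = 2 * nu * Y ^+ 2.
  rewrite -ZY -[c ^+ 2]real_normK ?num_real//.
  have -> : pi ^+ 2 * (`|c| ^+ 2 * nu ^+ (2 * k)) = (pi * `|c|) ^+ 2 * nu ^+ (2 * k) by ring.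
  rewrite cZ exprMn sqr_sqrtr; last by have := ler0n R n; lra.
  rewrite [(_ ^+ k * _) ^+ 2]exprMn -exprM [(k * 2)%N]mulnC /nu.
  have -> : 2 * n%:R + 1 = 2 * (n%:R + 2^-1) :> R by field.
  ring.
have c2 : c ^+ 2 * nu ^+ (2 * k).-1 <= 2 / pi * A * rho.
  rewrite -(ler_pM2l (exprn_gt0 2 pi0)) -(ler_pM2l nu0).
  have -> : nu * (pi ^+ 2 * (c ^+ 2 * nu ^+ (2 * k).-1)) = pi ^+ 2 * (c ^+ 2 * nu ^+ (2 * k)).
    by rewrite -[in RHS](prednK (_ : 0 < 2 * k)%N) ?exprS; [ring|lia].
  rewrite E2.
  have cancel (a r v p : R) : p != 0 -> v * (p ^+ 2 * (2 / p * a * r)) = 2 * v * (p * (a * r)).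
    by move=> p0; field.
  rewrite cancel ?gt_eqF//.
  by rewrite ler_wpM2l// mulr_ge0 ?ltW.
apply: le_trans c2; rewrite ler_wpM2l ?sqr_ge0// lerXn2r ?nnegrE ?ler0n ?ltW//.
by rewrite /nu; lra.
Qed.

End assembly.

(** * The tail of the expansion and the constant *)

Section constants.
Context {R : realType}.
Notation mu := (@lebesgue_measure R).

(** The factors pi of q2 and q4 cancel: q5^2 is 12 * C^2 * (k + 1) * (k!)^4 / (k - 1),
    with C the middle binomial coefficient. *)
Lemma q5_sqr_ge k : (1 < k)%N ->
  2 / pi * (k.+1%:R * k`!%:R ^+ 2) <= q5 R k ^+ 2.
Proof.
move=> k1; have pi2 := pi_ge2 R.
have k1R : 0 < k%:R - 1 :> R by rewrite subr_gt0 ltr1n.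
have C1 : 1 <= 'C(k, k./2)%:R :> R.
  by rewrite ler1n bin_gt0; lia.
have F1 : k%:R <= k`!%:R :> R by rewrite ler_nat; apply: fact_geq.
have -> : q5 R k ^+ 2 =
    12 * 'C(k, k./2)%:R ^+ 2 * (k.+1%:R * k`!%:R ^+ 2) * (k`!%:R ^+ 2 / (k%:R - 1)).
  rewrite /q5 /q2 /q3 /q4 !exprMn !sqr_sqrtr; last 2 first.
  - by rewrite mulr_ge0// addr_ge0.
  - by rewrite divr_ge0// mulr_ge0// ltW.
  rewrite -[k.+1]addn1 natrD; move: k%:R pi ('C(_, _))%:R k`!%:R pi2 k1R => K p c F p2 K1.
  by field; rewrite !gt_eqF//; lra.
rewrite [leRHS]mulrAC ler_wpM2r ?mulr_ge0 ?sqr_ge0//.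
apply: (@le_trans _ _ 1); first by rewrite ler_pdivrMr ?mul1r//; lra.
have FK : 1 <= k`!%:R ^+ 2 / (k%:R - 1) :> R.
  by rewrite ler_pdivlMr// mul1r; nra.
have : 1 <= 'C(k, k./2)%:R ^+ 2 :> R by rewrite exprn_ege1.
move: (_ ^+ 2) (_ / _) FK => a b; nra.
Qed.

(** For n > N, c_n^2 is at most A / N^(2 k - 3) times 1 / n^2. *)
Lemma legendre_tail (c : nat -> R) (A : R) k N M : (1 < k)%N -> (0 < N)%N ->
  (forall n, c n ^+ 2 * n%:R ^+ (2 * k).-1 <= A) ->
  \sum_(N.+1 <= n < M) c n ^+ 2 <= A / N%:R ^+ (2 * (k - 1)).
Proof.
move=> k1 N0 cA.
have A0 : 0 <= A.
  by apply: le_trans (cA 0%N); rewrite mulr_ge0 ?sqr_ge0 ?exprn_ge0.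
have NR : 0 < N%:R :> R by rewrite ltr0n.
have H n : (N < n)%N -> c n ^+ 2 <= A / N%:R ^+ (2 * k - 3) * n%:R ^- 2.
  move=> Nn; have n0 : 0 < n%:R :> R by rewrite ltr0n; lia.
  rewrite -mulrA -invfM ler_pdivlMr ?mulr_gt0 ?exprn_gt0//.
  apply: le_trans (cA n); rewrite ler_wpM2l ?sqr_ge0//.
  rewrite (_ : (2 * k).-1 = 2 * k - 3 + 2)%N; last lia.
  rewrite exprD ler_wpM2r ?exprn_ge0// lerXn2r ?nnegrE// ler_nat; lia.
case: (leqP M N.+1) => [MN|NM].
  by rewrite big_geq// divr_ge0// exprn_ge0.
have -> : M = (N.+1 + (M - N.+1))%N by lia.
move: (M - N.+1)%N => m.
apply: (@le_trans _ _ (A / N%:R ^+ (2 * k - 3) * \sum_(N.+1 <= n < N.+1 + m) n%:R ^- 2)).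
  by rewrite mulr_sumr; apply: ler_sum_nat => n /andP[Nn _]; exact: H.
apply: (@le_trans _ _ (A / N%:R ^+ (2 * k - 3) * N%:R^-1)).
  apply: ler_wpM2l; first by rewrite divr_ge0// exprn_ge0.
  by apply: le_trans (sum_inv_sqr_le _ N0) _; rewrite lerBlDr lerDl invr_ge0.
by rewrite -mulrA -invfM -exprSr (_ : (2 * k - 3).+1 = 2 * (k - 1))%N//; lia.
Qed.

Lemma sqr_sum_ge (n : nat) (a : nat -> R) : (forall i, 0 <= a i) ->
  \sum_(i < n) a i ^+ 2 <= (\sum_(i < n) a i) ^+ 2.
Proof.
move=> a0; elim: n => [|n IH]; first by rewrite !big_ord0 expr0n.
rewrite !big_ord_recr/= sqrrD; have : 0 <= \sum_(i < n) a i by exact: sumr_ge0.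
have := a0 n; move: (\sum_(i < n) a i ^+ 2) (\sum_(i < n) a i) IH => Q S; nra.
Qed.

Lemma ae_eq_L1 (u v : R -> R) : measurable_fun (I01 R) v -> L1 `]0, 1[ u ->
  {ae mu, forall x, I01 R x -> u x = v x} -> L1 `]0, 1[ v.
Proof.
move=> mv Lu uv; apply/integrableP; split; first exact: measurable_fun_EFin.
have /integrableP[mu_ uoo] := Lu; apply: le_lt_trans uoo.
rewrite le_eqVlt; apply/orP; left; apply/eqP; apply: ae_eq_integral => //.
- by apply: measurableT_comp => //; exact: measurable_fun_EFin.
- exact: measurableT_comp.
have FF := ae_filter_ringOfSetsType mu.
by apply: filterS uv => x uv Dx /=; rewrite uv.
Qed.

End constants.

Theorem proposition4 (R : realType) (k : nat) (f : R -> R)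
  (k_gt1 : (1 < k)%N)
  (f_L2 : in_L2 (@uniform_density R) f)
  (g_Hmu : in_Hmu k (abel f))
  (g_lim : forall G : R -> R, Cn_representative k.-1 (abel f) G ->
     forall j : nat, (j < k)%N ->
       derive1n j (fun t : R => G (sin (t / 2) ^+ 2)) t @[t --> 0^'] --> (0 : R))
  (N : nat) (N_ge1 : (1 <= N)%N) :
  L2_norm (@uniform_density R) (fun x => f x - legendre_sum f N x)
    <= q5 R k * (Hmu_norm k (abel f) / N%:R ^+ (k - 1)).
Proof.
have k_gt0 : (0 < k)%N by lia.
have Lf : L1 `]0, 1[ f by apply: (in_L2_L1 _ _ f_L2) => //; exact: measurable_cst.
have arc1 x : I01 R x -> 1 <= arcsine_density x.
  by rewrite /= in_itv/= => x01; rewrite arcsine_densityE akernel_ge1.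
have mw := @measurable_arcsine R.
have [g2 gD] := g_Hmu; set g := abel f in g2 gD g_lim *.
have Lg : L1 `]0, 1[ g by exact: in_L2_L1 g2.
have LD j : (j <= k)%N -> L1 `]0, 1[ (weakD j g).
  by move=> jk; have [_ v2] := gD j jk; exact: in_L2_L1 v2.
have WD j : (j <= k)%N -> weakd j g (weakD j g).
  by move=> jk; have [ex _] := gD j jk; exact: weakDP.
(* The functions G j are representatives of the weak derivatives of g. *)
have [G [Gk GC LG WG]] := weakd_antiderivatives Lg (LD k (leqnn k)) (WD k (leqnn k)).
have DG j : (j <= k)%N -> {ae leb R, forall x, I01 R x -> weakD j g x = G j x}.
  by move=> jk; exact: weakd_unique (LD j jk) (LG j jk) (WD j jk) (WG j jk).
have gG : {ae leb R, forall x, I01 R x -> g x = G 0%N x}.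
  have Wg : weakd 0 g g by move=> phi _; rewrite expr0 mul1r.
  exact: weakd_unique Lg (LG 0%N isT) Wg (WG 0%N isT).
have G0 j : (j < k)%N -> chainsum G j 0 = 0.
  move=> jk; apply: (chainsum_eq0 GC LG jk).
  by apply: g_lim => //; exact: (antiderivative_representative GC LG).
pose E i := \int[leb R]_(x in `]0, 1[) (akernel 0 x * G i x ^+ 2).
have mG i : (i <= k)%N -> measurable_fun (I01 R) (G i) by move=> /LG; exact: L1_measurable.
have mD i : (i <= k)%N -> measurable_fun (I01 R) (weakD i g) by move=> /LD; exact: L1_measurable.
have mk := @measurable_akernel0 R.
have mkG i : (i <= k)%N -> measurable_fun (I01 R) (fun x => akernel 0 x * G i x ^+ 2).
  by move=> ik; apply: measurable_funM => //; apply: measurable_funX; exact: mG.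
have LD2 i : (i <= k)%N ->
    L1 `]0, 1[ (fun x => weakD i g x ^+ 2 * arcsine_density x).
  move=> ik; apply: in_L2_integrable => //; last by have [] := gD i ik.
  by move=> x Dx; rewrite (le_trans _ (arc1 x Dx)).
have DG2 i : (i <= k)%N -> {ae leb R, forall x, I01 R x ->
    weakD i g x ^+ 2 * arcsine_density x = akernel 0 x * G i x ^+ 2}.
  move=> ik; have FF := ae_filter_ringOfSetsType (leb R).
  by apply: filterS (DG i ik) => x DGx Dx; rewrite DGx// arcsine_densityE mulrC.
have LG2 i : (i <= k)%N -> L1 `]0, 1[ (fun x => akernel 0 x * G i x ^+ 2).
  by move=> ik; exact: ae_eq_L1 (mkG i ik) (LD2 i ik) (DG2 i ik).
have EE i : (i <= k)%N -> E i = L2_norm (@arcsine_density R) (weakD i g) ^+ 2.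
  move=> ik; rewrite /L2_norm sqr_sqrtr.
    by apply/esym/ae_eq_Rintegral => //; [exact: L1_measurable (LD2 i ik)|exact: mkG|exact: DG2].
  apply: Rintegral_ge0 => x Dx.
  by rewrite mulr_ge0 ?sqr_ge0// (le_trans _ (arc1 x Dx)).
have EH : \sum_(i < k.+1) E i <= Hmu_norm k g ^+ 2.
  rewrite (eq_bigr (fun i : 'I_k.+1 => L2_norm (@arcsine_density R) (weakD i g) ^+ 2)); last first.
    by move=> i _; apply: EE; rewrite -ltnS.
  exact: (@sqr_sum_ge _ k.+1 (fun i => L2_norm (@arcsine_density R) (weakD i g))
    (fun i => sqrtr_ge0 _)).
have cA n := legendre_coef_decay n Lf g2.1 (antiderivative_abs_cont GC LG) LG2 LG gG G0 k_gt0.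
set A := 2 / pi * _ * _ in cA.
have A_le : A <= (q5 R k * Hmu_norm k g) ^+ 2.
  rewrite exprMn /A; apply: ler_pM => //; last exact: q5_sqr_ge.
    by rewrite !mulr_ge0 ?invr_ge0 ?pi_ge0 ?exprn_ge0.
  by apply: sumr_ge0 => i _; rewrite -/(E i) EE ?sqr_ge0// -ltnS.
have Hge0 : 0 <= q5 R k * Hmu_norm k g.
  rewrite mulr_ge0 ?sumr_ge0// => [|i _]; last exact: sqrtr_ge0.
  by rewrite /q5 /q2 /q3 /q4 !mulr_ge0 ?invr_ge0 ?pi_ge0 ?exprn_ge0 ?sqrtr_ge0.
(* The exponent 3 is at most 2 k - 1 because k > 1. *)
have cA3 n : (0 < n)%N -> legendre_coef f n ^+ 2 * n%:R ^+ 3 <= A.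
  move=> n0; apply: le_trans (cA n); rewrite ler_wpM2l ?sqr_ge0//.
  rewrite ler_weXn2l ?ler1n//; lia.
have err := legendre_error Lf cA3 (fun M => legendre_tail M k_gt1 N_ge1 cA).
rewrite /L2_norm mulrA -[leRHS]ger0_norm ?divr_ge0 ?exprn_ge0// -sqrtr_sqr.
apply: ler_wsqrtr.
apply: (@le_trans _ _ (A / N%:R ^+ (2 * (k - 1)))); last first.
  by rewrite expr_div_n -exprM mulnC ler_wpM2r ?invr_ge0 ?exprn_ge0.
rewrite /Rintegral -lee_fin; apply: (le_trans _ err).
under eq_integral do rewrite mulr1.
rewrite fineK// ge0_fin_numE ?(le_lt_trans err) ?ltry//.
by apply: integral_ge0 => x _; rewrite lee_fin sqr_ge0.
Qed.
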